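(* Let $k_0\in\mathbb{Z}$ and $\phi\in C(\partial\mathbb{D})$. Then the operators $\phi(U_{\pm,k_0})$ and $\phi(U_{\pm,k_0}^\top)$ are unitarily equivalent to the operators $M_{\pm,k_0}(\phi)$ of multiplication by $\phi$ on $L^2(\partial\mathbb{D};d\mu_\pm(\cdot,k_0))$. In particular, $$\sigma(\phi(U_{\pm,k_0}))=\sigma(\phi(U_{\pm,k_0}^\top))=\mathrm{ess.ran}_{d\mu_\pm(\cdot,k_0)}(\phi),$$ $$\sigma(U_{\pm,k_0})=\sigma(U_{\pm,k_0}^\top)=\mathrm{supp}\,(d\mu_\pm(\cdot,k_0)),$$ and the spectrum of $U_{\pm,k_0}$ is simple.
   Context: $\mathbb{D}$ is the open unit disk in $\mathbb{C}$ and $\partial\mathbb{D}$ the unit circle. Let $\{\alpha_k\}_{k\in\mathbb{Z}}\subset\mathbb{D}$ and $\rho_k=\sqrt{1-|\alpha_k|^2}$. Scalar products are linear in the second argument; $\{\delta_k\}$ is the standard basis; $[k_0,-\infty)\cap\mathbb{Z}$ means $(-\infty,k_0]\cap\mathbb{Z}$. CMV operators: $\theta_k=\begin{pmatrix}-\alpha_k&\rho_k\\ \rho_k&\overline{\alpha_k}\end{pmatrix}$. $V$ (resp. $W$) is the unitary operator on $\ell^2(\mathbb{Z})$ whose matrix in the standard basis is block diagonal with blocks $\theta_{2k}$ on rows/columns $2k-1,2k$ (resp. $\theta_{2k+1}$ on rows/columns $2k,2k+1$), $k\in\mathbb{Z}$, and $U=VW$. Half-lattice operators: if $\alpha_{k_0}$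 is replaced by $1$ (so $\rho_{k_0}=0$), then $V,W,U$ split as direct sums with respect to $\ell^2((-\infty,k_0-1]\cap\mathbb{Z})\oplus\ell^2([k_0,\infty)\cap\mathbb{Z})$; $V_{+,k_0},W_{+,k_0},U_{+,k_0}=V_{+,k_0}W_{+,k_0}$ denote the parts on $\ell^2([k_0,\infty)\cap\mathbb{Z})$. Similarly, replacing $\alpha_{k_0+1}$ by $1$, $V_{-,k_0},W_{-,k_0},U_{-,k_0}=V_{-,k_0}W_{-,k_0}$ denote the parts on $\ell^2((-\infty,k_0]\cap\mathbb{Z})$. $U_{\pm,k_0}^\top=W_{\pm,k_0}V_{\pm,k_0}$ is the operator with the transposed matrix. Spectral measures: $d\mu_\pm(\zeta,k_0)=d(\delta_{k_0},E_{U_{\pm,k_0}}(\zeta)\delta_{k_0})_{\ell^2([k_0,\pm\infty)\cap\mathbb{Z})}$, where $dE_{U_{\pm,k_0}}$ is the projection-valued spectral measure of the unitary operator $U_{\pm,k_0}$. $M_{\pm,k_0}(\phi)$ acts by $(M_{\pm,k_0}(\phi)f)(\zeta)=\phi(\zeta)f(\zeta)$. The essential range of $\phi$ with respect to a measure $d\mu$ on $\partial\mathbb{D}$ is $\mathrm{ess.ran}_{d\mu}(\phi)=\{z\in\mathbb{C}: \mu(\{\zeta\in\partial\mathbb{D}:|\phi(\zeta)-z|<\varepsilon\})>0\text{ for all }\varepsilon>0\}$. *)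

(* Defs.v *)
From HB Require Import structures.
From mathcomp Require Import all_boot all_order all_algebra.
From mathcomp Require Import complex.
From mathcomp Require Import all_classical all_reals all_analysis.
From mathcomp Require Import measurable_realfun.

Set Implicit Arguments.
Unset Strict Implicit.
Unset Printing Implicit Defensive.

Import Order.TTheory GRing.Theory Num.Theory.
Import numFieldNormedType.Exports.

Local Open Scope classical_set_scope.
Local Open Scope ring_scope.

(* The norm topology of the complex numbers R[i]. *)
HB.instance Definition _ (R : realType) := NormedModule.copy R[i] (R[i])^o.

HB.instance Definition _ := isPointed.Build int 0.
HB.instance Definition _ := @isMeasurable.Build default_measure_display
  int discrete_measurable discrete_measurable0
  discrete_measurableC discrete_measurableU.

Definition borelC (R : realType) := g_sigma_algebraType (@open R[i]).

Definition unit_circle (R : realType) : set R[i] := [set z | `|z| = 1].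
Arguments unit_circle : clear implicits.

Definition cmod (R : realType) (z : R[i]) : R := complex.Re `|z|.

(* A measurable subset sdom of a measure space. It stands for the Hilbert space
   L^2(sdom; smeas) of complex functions: vectors are represented by functions
   whose values outside sdom are irrelevant, and two of them are the same vector
   when they agree almost everywhere in sdom. *)
Record mspace (R : realType) := MSpace {
  sdisp : measure_display;
  scar : measurableType sdisp;
  smeas : {measure set scar -> \bar R};
  sdom : set scar;
  sdom_measurable : measurable sdom }.
Arguments sdom {R} m _.
Arguments smeas {R} m.

Section L2.
Context (R : realType).
Implicit Types (X Y : mspace R).

Definition vec X := scar X -> R[i].

Definition veq X (f g : vec X) : Prop := f = g %[ae smeas X in sdom X].

Definition L2 X : set (vec X) := [set f |
  [/\ measurable_fun (sdom X) (fun x => complex.Re (f x)),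
      measurable_fun (sdom X) (fun x => complex.Im (f x)) &
      (\int[smeas X]_(x in sdom X) ((cmod (f x)) ^+ 2)%:E < +oo)%E]].

Definition cint d (T : measurableType d) (mu : {measure set T -> \bar R})
    (D : set T) (f : T -> R[i]) : R[i] :=
  (\int[mu]_(x in D) complex.Re (f x) +i* \int[mu]_(x in D) complex.Im (f x))%C.

(* Linear in the second argument. *)
Definition inner X (f g : vec X) : R[i] :=
  cint (smeas X) (sdom X) (fun x => (f x)^* * g x).

Definition l2norm X (f : vec X) : R := Num.sqrt (complex.Re (inner f f)).

Definition bounded_op X Y (A : vec X -> vec Y) : Prop :=
  [/\ forall f, L2 f -> L2 (A f),
      forall (c : R[i]) f g, L2 f -> L2 g ->
        veq (A (fun x => c * f x + g x)) (fun y => c * A f y + A g y) &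
      exists M : R, forall f, L2 f -> l2norm (A f) <= M * l2norm f].

Definition unitary_op X Y (V : vec X -> vec Y) : Prop :=
  [/\ bounded_op V,
      forall f g, L2 f -> L2 g -> inner (V f) (V g) = inner f g &
      forall h, L2 h -> exists2 f, L2 f & veq (V f) h].

Definition unitarily_equivalent X Y (A : vec X -> vec X) (B : vec Y -> vec Y) :=
  exists2 V : vec X -> vec Y,
    unitary_op V & forall f, L2 f -> veq (V (A f)) (B (V f)).

Definition spectrum X (A : vec X -> vec X) : set R[i] := [set z |
  ~ exists2 B : vec X -> vec X, bounded_op B & forall f, L2 f ->
      veq (B (fun x => A f x - z * f x)) f /\
      veq (fun x => A (B f) x - z * B f x) f].

Definition orthogonal_projection X (P : vec X -> vec X) : Prop :=
  [/\ bounded_op P, forall f, L2 f -> veq (P (P f)) (P f) &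
      forall f g, L2 f -> L2 g -> inner f (P g) = inner (P f) g].

(* Projection-valued measures on the unit circle, encoded as projection-valued
   Borel measures on the complex plane that are concentrated on the circle. *)
Record pvm X := Pvm {
  pvm_op :> set (borelC R) -> vec X -> vec X;
  pvm_projection : forall B, measurable B -> orthogonal_projection (pvm_op B);
  pvm_circle : forall f, L2 f -> veq (pvm_op (unit_circle R) f) f;
  pvm_setI : forall A B, measurable A -> measurable B -> forall f, L2 f ->
    veq (pvm_op (A `&` B) f) (pvm_op A (pvm_op B f));
  pvm_sigma_additive : forall f, L2 f ->
    semi_sigma_additive
      (fun B : set (borelC R) => (complex.Re (inner f (pvm_op B f)))%:E) }.

End L2.

(* The scalar measure d(f, E f). The value 0 on sets that are not Borel is
   irrelevant, but measures of the library are functions on all sets. *)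
Definition pvm_measure (R : realType) (X : mspace R) (E : pvm X)
    (f : vec X) (hf : L2 f) (B : set (borelC R)) : \bar R :=
  if `[< measurable B >] then (complex.Re (inner f (E B f)))%:E else 0%E.

Section pvm_measure.
Context (R : realType) (X : mspace R) (E : pvm X) (f : vec X) (hf : L2 f).

Let m := pvm_measure E hf.

Lemma inner_veq (g h k : vec X) : L2 g -> L2 h -> L2 k -> veq h k ->
  inner g h = inner g k.
Proof.
have mRe (u v : vec X) : L2 u -> L2 v -> measurable_fun (sdom X)
    (fun x => complex.Re ((u x)^* * v x)) /\
  measurable_fun (sdom X) (fun x => complex.Im ((u x)^* * v x)).
  move=> [mu1 mu2 _] [mv1 mv2 _]; split.
  - rewrite (_ : (fun _ => _) = fun x =>
      complex.Re (u x) * complex.Re (v x) + complex.Im (u x) * complex.Im (v x)).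
      by apply: measurable_funD; apply: measurable_funM.
    apply/funext => x; case: (u x) => ? ?; case: (v x) => ? ? /=.
    by rewrite mulNr opprK.
  - rewrite (_ : (fun _ => _) = fun x =>
      complex.Re (u x) * complex.Im (v x) - complex.Im (u x) * complex.Re (v x)).
      by apply: measurable_funB; apply: measurable_funM.
    apply/funext => x; case: (u x) => ? ?; case: (v x) => ? ? /=.
    by rewrite mulNr.
move=> Lg Lh Lk hk; rewrite /inner /cint /Rintegral.
have [mh1 mh2] := mRe _ _ Lg Lh; have [mk1 mk2] := mRe _ _ Lg Lk.
congr (fine _ +i* fine _)%C.
all: apply: ae_eq_integral; [exact: sdom_measurable | | | ].
all: try exact/measurable_EFinP.
all: by apply: filterS hk => x /= hx Dx; rewrite hx.
Qed.

Let m0 : m set0 = 0%E.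
Proof.
pose B (n : nat) : set (borelC R) := set0.
have mB n : measurable (B n) by exact: measurable0.
have tB : trivIset setT B by apply/trivIsetP => i j _ _ _; rewrite /B set0I.
have := pvm_sigma_additive (p := E) hf mB tB (bigcupT_measurable _ mB).
rewrite bigcup0 // /m /pvm_measure asboolT //.
set c := complex.Re _.
rewrite (_ : (fun _ => _) = (fun n => (c *+ n)%:E)); last first.
  apply/funext => n; rewrite sumEFin; congr _%:E.
  by rewrite big_mkord sumr_const card_ord.
move=> /fine_cvgP[_] /= cv; congr _%:E.
have cv1 : (fun n => c *+ n.+1) @ \oo --> c by rewrite (cvg_shiftS (fun n => c *+ n)).
have : (fun n => c *+ n.+1 - c *+ n) @ \oo --> c - c by apply: cvgB.
rewrite subrr (_ : (fun _ => _) = fun=> c); last first.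
  by apply/funext => n; rewrite mulrS addrK.
by move=> /(cvg_unique (@Rhausdorff R) (cvg_cst c)).
Qed.

Let m_ge0 B : (0 <= m B)%E.
Proof.
rewrite /m /pvm_measure; case: asboolP => // mB.
have [[LE _ _] EE sa] := pvm_projection E mB.
rewrite lee_fin -(inner_veq hf (LE _ (LE _ hf)) (LE _ hf) (EE _ hf)).
rewrite sa //; last exact: LE.
apply: Rintegral_ge0 => x _.
by case: (E B f x) => u v /=; rewrite mulNr opprK addr_ge0 // -expr2 sqr_ge0.
Qed.

Let m_sigma : semi_sigma_additive m.
Proof.
move=> F mF tF mUF; rewrite /m /pvm_measure asboolT //.
rewrite (_ : (fun _ => _) = fun n =>
  (\sum_(0 <= i < n) (complex.Re (inner f (E (F i) f)))%:E)%E).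
  exact: pvm_sigma_additive.
by apply/funext => n; apply: eq_bigr => i _; rewrite asboolT.
Qed.

HB.instance Definition _ := isMeasure.Build _ _ _ m m0 m_ge0 m_sigma.

End pvm_measure.

Lemma measurable_unit_circle (R : realType) :
  measurable (unit_circle R : set (borelC R)).
Proof.
rewrite -[unit_circle R]setCK; apply: measurableC; apply: sub_sigma_algebra.
rewrite /= openC (_ : unit_circle R = Num.norm @^-1` [set 1]) //.
apply: preimage_closed => [z _|]; first exact: norm_continuous.
exact: accessible_closed_set1 (hausdorff_accessible (@norm_hausdorff _ _)) _.
Qed.

Section spectral_theory.
Context (R : realType) (X : mspace R) (E : pvm X).
Implicit Types (phi : R[i] -> R[i]) (A U : vec X -> vec X).

(* A is the integral of phi with respect to E. By polarization the quadratic
   form determines A up to almost everywhere equality. *)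
Definition is_spectral_integral phi A : Prop :=
  bounded_op A /\ forall (f : vec X) (hf : L2 f),
    inner f (A f) = cint (pvm_measure E hf) (unit_circle R) phi.

Definition is_spectral_measure_of U : Prop := is_spectral_integral id U.

(* phi(U), where E is the spectral measure of U. *)
Definition functional_calculus phi : vec X -> vec X :=
  get [set A | is_spectral_integral phi A].

(* Multiplicity one: the vectors E(B) g, for a single g, span a dense subspace. *)
Definition simple_spectrum : Prop :=
  exists2 g : vec X, L2 g & forall f : vec X, L2 f -> forall e : R, 0 < e ->
    exists n (c : 'I_n -> R[i]) (B : 'I_n -> set (borelC R)),
      (forall i, measurable (B i)) /\
      l2norm (fun x => f x - \sum_(i < n) c i * E (B i) g x : R[i]) < e.

End spectral_theory.

Section circle_measure.
Context (R : realType) (mu : {measure set (borelC R) -> \bar R}).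

Definition circle_space : mspace R := MSpace mu (@measurable_unit_circle R).

Definition multiplication (phi : R[i] -> R[i]) :
  vec circle_space -> vec circle_space := fun f z => phi z * f z.

Definition ess_ran (phi : R[i] -> R[i]) : set R[i] := [set z |
  forall e : R, 0 < e ->
    (0 < mu [set w | unit_circle R w /\ (cmod (phi w - z) < e)%R])%E].

Definition measure_supp : set R[i] := [set z |
  forall O : set R[i], open O -> O z -> (0 < mu O)%E].

End circle_measure.
Arguments multiplication {R} mu phi f z.

Section cmv.
Context (R : realType).
Implicit Types (al : R[i]) (a : int -> R[i]).

Definition rho al : R[i] := (Num.sqrt (1 - cmod al ^+ 2))%:C%C.

Definition theta al : 'M[R[i]]_2 := \matrix_(i, j)
  if i == j then (if i == 0 then - al else al^*) else rho al.

(* The block diagonal operator with blocks theta (a j) on the rows and columns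
   j - 1, j, where j ranges over the integers of parity b (odd if b). *)
Definition cmv_factor (b : bool) a (f : int -> R[i]) : int -> R[i] := fun k =>
  let j := if odd `|k|%N == b then k else k + 1 in
  let r : 'I_2 := if k == j then 1 else 0 in
  theta (a j) r 0 * f (j - 1) + theta (a j) r 1 * f j.

Definition cmvV a := cmv_factor false a.
Definition cmvW a := cmv_factor true a.

Inductive side := Plus | Minus.

Definition half_lattice (s : side) (k0 : int) : set int :=
  match s with
  | Plus => [set k | (k0 <= k)%R]
  | Minus => [set k | (k <= k0)%R]
  end.

Definition ell2 s k0 : mspace R :=
  @MSpace R _ int (@counting int R) (half_lattice s k0) I.

(* After this modification the entries of V and W with row index in the
   half-lattice and column index outside of it are 0, so V and W act on
   ell2 s k0 without truncating functions. *)
Definition decouple s (k0 : int) a : int -> R[i] :=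
  let k1 := match s with Plus => k0 | Minus => k0 + 1 end in
  fun k => if k == k1 then 1 else a k.

Definition half_U s k0 a : vec (ell2 s k0) -> vec (ell2 s k0) :=
  fun f => cmvV (decouple s k0 a) (cmvW (decouple s k0 a) f).

Definition half_Ut s k0 a : vec (ell2 s k0) -> vec (ell2 s k0) :=
  fun f => cmvW (decouple s k0 a) (cmvV (decouple s k0 a) f).

Definition delta s (k0 : int) : vec (ell2 s k0) := fun k => (k == k0)%:R.
Arguments delta : clear implicits.

Lemma L2_delta s k0 : L2 (delta s k0).
Proof.
split; [by [] | by [] |] => /=.
rewrite (_ : (\int[_]_(x in _) _ =
    \int[@counting int R]_(x in half_lattice s k0) (\1_[set k0] x)%:E)%E).
  rewrite integral_indic //.
  apply: (@le_lt_trans _ _ (@counting int R [set k0])).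
    by apply: le_measure; rewrite ?inE //; exact: subIsetl.
  by rewrite /counting asboolT ?ltry //; exact: finite_set1.
apply: eq_integral => k _; congr _%:E.
rewrite /cmod /delta indicE (_ : (k \in [set k0]) = (k == k0)).
  case: eqP => _; rewrite ?normr1 ?normr0; [exact: expr1n|exact: expr0n].
by apply/idP/eqP; rewrite inE.
Qed.

Definition delta_measure s k0 (E : pvm (ell2 s k0)) :
  {measure set (borelC R) -> \bar R} := pvm_measure E (L2_delta s k0).

End cmv.
Arguments half_U : clear implicits.
Arguments half_Ut : clear implicits.

(* Main.v *)
Require Import Defs.
From HB Require Import structures.
From mathcomp Require Import all_boot all_order all_algebra.
From mathcomp Require Import complex.
From mathcomp Require Import all_classical all_reals all_analysis.
From mathcomp Require Import measurable_realfun zify ring lra.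

(* The vector [delta k0] is cyclic for [U]: the vectors [f] with
   [(delta k0, E(B) f) = 0] for all Borel [B] form a subspace invariant under [U]
   and its inverse, all of whose members vanish at [k0], and the block structure of
   [V] and [W] then forces them to vanish at each further site in turn.

   Sending [f] to the density of [B |-> (delta k0, E(B) f)] with respect to [mu] is
   therefore a unitary map onto [L^2(mu)]. It turns [E(B)] into multiplication by the
   indicator of [B], hence [phi(U)] into multiplication by [phi], whose spectrum is
   the essential range of [phi]; simplicity is the density of simple functions.

   The transpose is [W V = W (V W) W^-1]. That its spectral measure is [W E W^-1] is
   seen without approximating by polynomials: the range of [E] on a closed disk with
   centre [a] and radius [r] is determined by the growth rate of [(U - a)^n f], and
   closed disks generate the Borel sets. *)

Set Implicit Arguments.
Unset Strict Implicit.
Unset Printing Implicit Defensive.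

Import Order.TTheory GRing.Theory Num.Theory.
Import numFieldNormedType.Exports.

Local Open Scope classical_set_scope.
Local Open Scope ring_scope.

(** Two things are known only weakly. Countable additivity of a [pvm] is postulated for the scalar
    measures alone, and a spectral integral is given by its quadratic form, not by a multiplicative
    calculus. Operator identities about [E] are therefore checked on quadratic forms and recovered
    by polarization, up to [veq].

    The existence of phi(U) is not granted either: [functional_calculus] selects an operator with
    [get]. The witness is the multiplication operator pulled back along the unitary map, so the
    representation has to precede every statement on phi(U).

    A Radon-Nikodym density is a priori only integrable. Its square integrability is obtained with a
    crude constant, which suffices: the map onto L^2(mu) is bounded, hence has an adjoint (built
    coordinatewise on [ell2]), and it becomes isometric because that adjoint turns out to be its
    inverse.

    Growth rates give only an inclusion between ranges of spectral projections; equality needs the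
    inclusion for the inverse intertwiner as well. *)

Local Notation Re := (@complex.Re _).
Local Notation Im := (@complex.Im _).

(** * Complex numbers and complex integrals through real and imaginary parts *)

Section complex_facts.
Context (R : realType).
Implicit Types (x y z : R[i]).

Lemma ReD x y : Re (x + y) = Re x + Re y.
Proof. by case: x y => [? ?] []. Qed.

Lemma ImD x y : Im (x + y) = Im x + Im y.
Proof. by case: x y => [? ?] []. Qed.

Lemma ReM x y : Re (x * y) = Re x * Re y - Im x * Im y.
Proof. by case: x y => [? ?] []. Qed.

Lemma ImM x y : Im (x * y) = Re x * Im y + Im x * Re y.
Proof. by case: x y => [? ?] []. Qed.

Lemma ReN x : Re (- x) = - Re x. Proof. by case: x. Qed.
Lemma ImN x : Im (- x) = - Im x. Proof. by case: x. Qed.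
Lemma ReJ z : Re z^* = Re z. Proof. by case: z. Qed.
Lemma ImJ z : Im z^* = - Im z. Proof. by case: z. Qed.

Definition complexReIm := (ReM, ImM, ReD, ImD, ReN, ImN, ReJ, ImJ).

Lemma complexP x y : Re x = Re y -> Im x = Im y -> x = y.
Proof. by case: x y => [? ?] [? ?] /= -> ->. Qed.

Lemma sqr_cmod z : cmod z ^+ 2 = Re z ^+ 2 + Im z ^+ 2.
Proof. by rewrite /cmod normc_def /= sqr_sqrtr // addr_ge0 // sqr_ge0. Qed.

Lemma normC_cmod z : `|z| = (cmod z)%:C%C.
Proof. by rewrite /cmod normc_def. Qed.

Lemma cmod_ge0 z : 0 <= cmod z.
Proof. by rewrite /cmod normc_def /= sqrtr_ge0. Qed.

Lemma mulJc z : z^* * z = (cmod z ^+ 2)%:C%C.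
Proof. by apply: complexP; rewrite sqr_cmod !complexReIm /=; ring. Qed.

Lemma cmodM x y : cmod (x * y) = cmod x * cmod y.
Proof. by apply: complexI; rewrite rmorphM -!normC_cmod normrM. Qed.

Lemma cmodD x y : cmod (x + y) <= cmod x + cmod y.
Proof. by rewrite -lecR rmorphD -!normC_cmod ler_normD. Qed.

Lemma cmodN x : cmod (- x) = cmod x.
Proof. by rewrite /cmod normrN. Qed.

Lemma cmodJ x : cmod x^* = cmod x.
Proof.
by apply/eqP; rewrite -(eqrXn2 (n := 2)) ?cmod_ge0 // !sqr_cmod ReJ ImJ sqrrN.
Qed.

Lemma cmod_eq0 x : (cmod x == 0) = (x == 0).
Proof. by rewrite -(normr_eq0 x) normC_cmod eq_complex /= eqxx andbT. Qed.

Lemma cmod_real (r : R) : cmod r%:C%C = `|r|.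
Proof. by rewrite /cmod normc_def /= expr0n addr0 sqrtr_sqr. Qed.

Lemma cmod0 : cmod (0 : R[i]) = 0.
Proof. by apply/eqP; rewrite cmod_eq0. Qed.

Lemma ler_Re_cmod x : `|Re x| <= cmod x.
Proof.
by rewrite -(ler_pXn2r (n := 2)) ?nnegrE ?cmod_ge0 // real_normK ?num_real //
  sqr_cmod lerDl sqr_ge0.
Qed.

Lemma ler_Im_cmod x : `|Im x| <= cmod x.
Proof.
by rewrite -(ler_pXn2r (n := 2)) ?nnegrE ?cmod_ge0 // real_normK ?num_real //
  sqr_cmod lerDr sqr_ge0.
Qed.

Lemma conj_real (r : R) : (r%:C%C : R[i])^* = r%:C%C.
Proof. by apply: complexP; rewrite !complexReIm //= oppr0. Qed.

End complex_facts.

Section complex_integral.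
Context (R : realType) d (T : measurableType d) (mu : {measure set T -> \bar R}).
Implicit Types (D : set T) (f g : T -> R[i]).

Definition cmeasurable D f :=
  measurable_fun D (Re \o f) /\ measurable_fun D (Im \o f).

Definition cintegrable D f :=
  mu.-integrable D (EFin \o (Re \o f)) /\ mu.-integrable D (EFin \o (Im \o f)).

Lemma eq_cint D f g : {in D, f =1 g} -> cint mu D f = cint mu D g.
Proof. by move=> e; congr Complex; apply: eq_Rintegral => x xD; rewrite e. Qed.

Lemma cmeasurable_cst D (c : R[i]) : cmeasurable D (fun=> c).
Proof. by split; exact: measurable_cst. Qed.

Lemma cmeasurableD D f g : cmeasurable D f -> cmeasurable D g ->
  cmeasurable D (fun x => f x + g x).
Proof.
move=> [f1 f2] [g1 g2]; split.
  by rewrite (_ : _ \o _ = (Re \o f) \+ (Re \o g)); [exact: measurable_funD|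
     apply/funext => x /=; rewrite ReD].
by rewrite (_ : _ \o _ = (Im \o f) \+ (Im \o g)); [exact: measurable_funD|
   apply/funext => x /=; rewrite ImD].
Qed.

Lemma cmeasurableM D f g : cmeasurable D f -> cmeasurable D g ->
  cmeasurable D (fun x => f x * g x).
Proof.
move=> [f1 f2] [g1 g2]; split.
  rewrite (_ : _ \o _ =
    ((Re \o f) \* (Re \o g)) \- ((Im \o f) \* (Im \o g))).
    by apply: measurable_funB; exact: measurable_funM.
  by apply/funext => x /=; rewrite ReM.
rewrite (_ : _ \o _ =
    ((Re \o f) \* (Im \o g)) \+ ((Im \o f) \* (Re \o g))).
  by apply: measurable_funD; exact: measurable_funM.
by apply/funext => x /=; rewrite ImM.
Qed.

Lemma cmeasurableJ D f : cmeasurable D f -> cmeasurable D (fun x => (f x)^*).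
Proof.
move=> [f1 f2]; split.
  by rewrite (_ : _ \o _ = Re \o f) //; apply/funext => x /=; rewrite ReJ.
rewrite (_ : _ \o _ = \- (Im \o f)); first exact: measurable_funN.
by apply/funext => x /=; rewrite ImJ.
Qed.

Lemma measurable_sqr_cmod D f : cmeasurable D f ->
  measurable_fun D (fun x => cmod (f x) ^+ 2).
Proof.
move=> [f1 f2]; under eq_fun do rewrite sqr_cmod.
by apply: measurable_funD; exact: measurable_funX.
Qed.

Lemma cint_lin D (c : R[i]) f g : measurable D ->
  cintegrable D f -> cintegrable D g ->
  cint mu D (fun x => c * f x + g x) = c * cint mu D f + cint mu D g.
Proof.
move=> mD [f1 f2] [g1 g2].
have iZ (r : R) (h : T -> R) : mu.-integrable D (EFin \o h) ->
    mu.-integrable D (EFin \o (fun x => r * h x)).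
  by move=> ih; exact: (integrableZl mD r ih).
have iD (h k : T -> R) : mu.-integrable D (EFin \o h) ->
    mu.-integrable D (EFin \o k) -> mu.-integrable D (EFin \o (h \+ k)).
  by move=> ih ik; exact: (integrableD mD ih ik).
apply: complexP; rewrite !complexReIm /=.
  rewrite -!RintegralZl // -RintegralB ?iZ // -RintegralD ?iZ //.
    by apply: eq_Rintegral => x _; rewrite !complexReIm.
  rewrite (_ : _ \o _ = EFin \o ((fun x => Re c * Re (f x)) \+
    (fun x => - Im c * Im (f x)))); first by apply: iD; apply: iZ.
  by apply/funext => x /=; rewrite mulNr.
rewrite -!RintegralZl // -RintegralD ?iZ // -RintegralD ?iZ //.
  by apply: eq_Rintegral => x _; rewrite !complexReIm.
by apply: iD; apply: iZ.
Qed.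

Lemma cintegrable_le D f (g : T -> R) : measurable D -> cmeasurable D f ->
  mu.-integrable D (EFin \o g) -> (forall x, D x -> cmod (f x) <= g x) ->
  cintegrable D f.
Proof.
move=> mD [f1 f2] ig fg; split.
  apply: le_integrable ig => //; first exact/measurable_EFinP.
  move=> x Dx /=; rewrite lee_fin (le_trans (ler_Re_cmod _)) //.
  by rewrite (le_trans (fg _ Dx)) // ler_norm.
apply: le_integrable ig => //; first exact/measurable_EFinP.
move=> x Dx /=; rewrite lee_fin (le_trans (ler_Im_cmod _)) //.
by rewrite (le_trans (fg _ Dx)) // ler_norm.
Qed.

Lemma cintJ D f : measurable D -> cintegrable D f ->
  cint mu D (fun x => (f x)^*) = (cint mu D f)^*.
Proof.
move=> mD [f1 f2]; apply: complexP; rewrite !complexReIm /=.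
  by apply: eq_Rintegral => x _; rewrite ReJ.
rewrite -[RHS]mulN1r -RintegralZl //.
by apply: eq_Rintegral => x _; rewrite ImJ mulN1r.
Qed.

End complex_integral.

(** * Hilbert space geometry up to almost everywhere equality *)

Section hilbert.
Context (R : realType).
Implicit Types (X Y : mspace R) (c : R[i]).

Definition lin X c (f g : vec X) : vec X := fun x => c * f x + g x.

Lemma L2_lin X c (f g : vec X) : L2 f -> L2 g -> L2 (lin c f g).
Proof.
move=> [f1 f2 fi] [g1 g2 gi].
have mf : cmeasurable (sdom X) f by [].
have mg : cmeasurable (sdom X) g by [].
have mfg : cmeasurable (sdom X) (lin c f g).
  by apply: cmeasurableD => //; apply: cmeasurableM => //; exact: cmeasurable_cst.
split; [exact: mfg.1 | exact: mfg.2 |].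
pose k := 2 * cmod c ^+ 2.
have mD := sdom_measurable X.
have k0 : 0 <= k by rewrite mulr_ge0 // sqr_ge0.
apply: (@le_lt_trans _ _ (\int[smeas X]_(x in sdom X)
    (k%:E * (cmod (f x) ^+ 2)%:E + 2%:E * (cmod (g x) ^+ 2)%:E))%E).
  apply: ge0_le_integral => //.
  - by move=> x _; rewrite lee_fin sqr_ge0.
  - by apply/measurable_EFinP; exact: measurable_sqr_cmod.
  - by apply: emeasurable_funD; apply: measurable_funeM;
      apply/measurable_EFinP; exact: measurable_sqr_cmod.
  move=> x _; rewrite -!EFinM -EFinD lee_fin /k /lin.
  have := cmodD (c * f x) (g x).
  rewrite cmodM => h.
  have h1 : cmod (c * f x + g x) ^+ 2 <= (cmod c * cmod (f x) + cmod (g x)) ^+ 2.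
    by rewrite ler_pXn2r // nnegrE ?addr_ge0 ?mulr_ge0 ?cmod_ge0.
  apply: le_trans h1 _.
  have := sqr_ge0 (cmod c * cmod (f x) - cmod (g x)); nra.
rewrite ge0_integralD //; first last.
- by apply: measurable_funeM; apply/measurable_EFinP; exact: measurable_sqr_cmod.
- by move=> x _; rewrite mule_ge0 // lee_fin // sqr_ge0.
- by apply: measurable_funeM; apply/measurable_EFinP; exact: measurable_sqr_cmod.
- by move=> x _; rewrite mule_ge0 // lee_fin // sqr_ge0.
rewrite !ge0_integralZl //.
- by rewrite lte_add_pinfty // lte_mul_pinfty // ?lee_fin // ltNye_eq ?fin_numE.
- by apply/measurable_EFinP; exact: measurable_sqr_cmod.
- by move=> x _; rewrite lee_fin sqr_ge0.
- by apply/measurable_EFinP; exact: measurable_sqr_cmod.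
- by move=> x _; rewrite lee_fin sqr_ge0.
Qed.

Lemma L2_0 X : L2 ((fun=> 0) : vec X).
Proof.
split; [exact: measurable_cst | exact: measurable_cst |].
under eq_integral do rewrite cmod0 expr0n /=.
by rewrite integral0.
Qed.

Lemma L2_cint X (f g : vec X) : L2 f -> L2 g ->
  cintegrable (smeas X) (sdom X) (fun x => (f x)^* * g x).
Proof.
move=> [f1 f2 fi] [g1 g2 gi].
have mD := sdom_measurable X.
have mf : cmeasurable (sdom X) f by [].
have mg : cmeasurable (sdom X) g by [].
have is2 (h : vec X) : cmeasurable (sdom X) h ->
    (\int[smeas X]_(x in sdom X) (cmod (h x) ^+ 2)%:E < +oo)%E ->
    (smeas X).-integrable (sdom X) (EFin \o (fun x => cmod (h x) ^+ 2)).
  move=> mh hi; apply/integrableP; split.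
    by apply/measurable_EFinP; exact: measurable_sqr_cmod.
  by under eq_integral do rewrite /= ger0_norm ?sqr_ge0 //.
apply: (@cintegrable_le _ _ _ _ _ _ (fun x => cmod (f x) ^+ 2 + cmod (g x) ^+ 2)) => //.
- by apply: cmeasurableM => //; exact: cmeasurableJ.
- exact: (integrableD mD (is2 _ mf fi) (is2 _ mg gi)).
- move=> x _; rewrite cmodM cmodJ.
  have := cmod_ge0 (f x); have := cmod_ge0 (g x).
  have := sqr_ge0 (cmod (f x) - cmod (g x)); nra.
Qed.

Lemma inner_linr X c (h f g : vec X) : L2 h -> L2 f -> L2 g ->
  inner h (lin c f g) = c * inner h f + inner h g.
Proof.
move=> Lh Lf Lg; rewrite /inner -cint_lin; [|exact: sdom_measurable|exact: L2_cint..].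
by apply: eq_cint => x _; rewrite /lin mulrDr mulrCA.
Qed.

Lemma innerJ X (f g : vec X) : L2 f -> L2 g -> (inner f g)^* = inner g f.
Proof.
move=> Lf Lg; rewrite /inner -cintJ; [|exact: sdom_measurable|exact: L2_cint].
by apply: eq_cint => x _; apply: complexP; rewrite !complexReIm; ring.
Qed.

Lemma inner_linl X c (h f g : vec X) : L2 h -> L2 f -> L2 g ->
  inner (lin c f g) h = c^* * inner f h + inner g h.
Proof.
move=> Lh Lf Lg; rewrite -innerJ ?inner_linr //; last exact: L2_lin.
by rewrite rmorphD rmorphM /= !innerJ.
Qed.

Lemma inner0r X (f : vec X) : inner f (fun=> 0) = 0 :> R[i].
Proof.
rewrite /inner (@eq_cint _ _ _ _ _ _ (fun=> 0)) => [|x _]; last by rewrite mulr0.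
by rewrite /cint /= /Rintegral integral0.
Qed.

Lemma inner0l X (f : vec X) : inner (fun=> 0) f = 0 :> R[i].
Proof.
rewrite /inner (@eq_cint _ _ _ _ _ _ (fun=> 0)) => [|x _]; last first.
  by rewrite rmorph0 mul0r.
by rewrite /cint /= /Rintegral integral0.
Qed.

(** Squared norms keep the estimates free of square roots; [l2norm] only reappears where the
    definitions ask for it. *)
Definition n2 X (f : vec X) : R := Re (inner f f).

Lemma n2_0 X : n2 ((fun=> 0) : vec X) = 0.
Proof. by rewrite /n2 inner0r. Qed.

Lemma n2_integral X (f : vec X) : L2 f ->
  (n2 f)%:E = (\int[smeas X]_(x in sdom X) (cmod (f x) ^+ 2)%:E)%E.
Proof.
move=> [f1 f2 fi]; rewrite /n2 /inner /= /Rintegral.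
under eq_integral do rewrite mulJc /=.
rewrite fineK // ge0_fin_numE //.
by apply: integral_ge0 => x _; rewrite lee_fin sqr_ge0.
Qed.

Lemma n2_ge0 X (f : vec X) : 0 <= n2 f.
Proof.
by rewrite /n2 /inner /=; apply: Rintegral_ge0 => x _; rewrite mulJc /= sqr_ge0.
Qed.

Lemma innerE X (f : vec X) : inner f f = (n2 f)%:C%C.
Proof.
apply: complexP => //=; rewrite /inner /=.
rewrite (@eq_Rintegral _ _ _ _ _ (cst 0)) => [|x _].
  by rewrite /Rintegral integral0.
by rewrite mulJc.
Qed.

Lemma veq_refl X (f : vec X) : veq f f.
Proof. exact: filterE. Qed.

Lemma veq_eq X (f g : vec X) : (forall x, sdom X x -> f x = g x) -> veq f g.
Proof. by move=> h; apply: filterE. Qed.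

Lemma veq_sym X (f g : vec X) : veq f g -> veq g f.
Proof. by apply: filterS => x h Dx; rewrite h. Qed.

Lemma veq_trans X (f g h : vec X) : veq f g -> veq g h -> veq f h.
Proof. by apply: filterS2 => x p q Dx; rewrite p // q. Qed.

Lemma veq_lin X c (f g f' g' : vec X) : veq f f' -> veq g g' ->
  veq (lin c f g) (lin c f' g').
Proof. by apply: filterS2 => x p q Dx; rewrite /lin p // q. Qed.

Lemma inner_veql X (g h k : vec X) : L2 g -> L2 h -> L2 k -> veq h k ->
  inner h g = inner k g.
Proof. by move=> Lg Lh Lk hk; rewrite -innerJ // (inner_veq Lg Lh Lk hk) innerJ. Qed.

Lemma n2_veq X (f g : vec X) : L2 f -> L2 g -> veq f g -> n2 f = n2 g.
Proof.
by move=> Lf Lg fg; rewrite /n2 (inner_veq Lf Lf Lg fg) (inner_veql Lg Lf Lg fg).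
Qed.

Lemma n2_eq0 X (f : vec X) : L2 f -> n2 f = 0 -> veq f (fun=> 0).
Proof.
move=> Lf f0; have := n2_integral Lf; rewrite f0 => /esym.
case: Lf => f1 f2 _.
under eq_integral do rewrite -(@ger0_norm _ (_ ^+ 2)) ?sqr_ge0 // -abse_EFin.
move=> /(ae_eq_integral_abs (smeas X) (sdom_measurable X)) h.
have : measurable_fun (sdom X) (fun x => (cmod (f x) ^+ 2)%:E).
  by apply/measurable_EFinP; exact: measurable_sqr_cmod.
move=> /h; apply: filterS => x /= hx Dx; apply/eqP.
by rewrite -cmod_eq0 -sqrf_eq0 -eqe hx.
Qed.

Lemma n2_lin X c (f g : vec X) : L2 f -> L2 g ->
  n2 (lin c f g) = cmod c ^+ 2 * n2 f + 2 * Re (c^* * inner f g) + n2 g.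
Proof.
move=> Lf Lg; rewrite /n2 inner_linr //; last exact: L2_lin.
rewrite !inner_linl // -(innerJ Lf Lg) sqr_cmod !innerE !complexReIm /=; ring.
Qed.

Lemma inner_eq X (f g : vec X) : L2 f -> L2 g ->
  (forall h : vec X, L2 h -> inner h f = inner h g) -> veq f g.
Proof.
move=> Lf Lg fg; have Ld := L2_lin (-1) Lf Lg.
have : n2 (lin (-1) f g) = 0.
  by rewrite /n2 inner_linr // fg // mulN1r addNr.
move=> /(n2_eq0 Ld); apply: filterS => x h Dx.
by apply/eqP; rewrite eq_sym -subr_eq0 addrC -[- f x]mulN1r; apply/eqP/h.
Qed.

Lemma cauchy_schwarz X (f g : vec X) : L2 f -> L2 g ->
  cmod (inner f g) ^+ 2 <= n2 f * n2 g.
Proof.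
move=> Lf Lg; have [f0|fn0] := eqVneq (n2 f) 0.
  rewrite -innerJ // (inner_veq Lg Lf (L2_0 X) (n2_eq0 Lf f0)) cmodJ.
  by rewrite f0 mul0r inner0r cmod0 expr0n.
have fp : 0 < n2 f by rewrite lt_def fn0 n2_ge0.
pose r := (n2 f)^-1; have r0 : 0 < r by rewrite invr_gt0.
(* This multiple of [f] minimises the distance from [g] to the line spanned by [f]. *)
have := n2_ge0 (lin (- (r%:C%C * inner f g)) f g); rewrite n2_lin //.
rewrite cmodN cmodM cmod_real gtr0_norm // exprMn -ler_pdivrMl // -/r -(subr_ge0 (r * _)).
have : r * n2 f = 1 by rewrite mulVf // lt0r_neq0.
move: (inner f g) (n2 f) (n2 g) => u w z e h; apply: le_trans h _.
rewrite le_eqVlt; apply/orP; left; apply/eqP.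
have -> : r ^+ 2 * cmod u ^+ 2 * w = (r * w) * r * cmod u ^+ 2 by ring.
by rewrite e sqr_cmod !complexReIm /=; ring.
Qed.

Lemma l2norm_sqr X (f : vec X) : l2norm f ^+ 2 = n2 f.
Proof. by rewrite /l2norm sqr_sqrtr // n2_ge0. Qed.

Lemma l2norm_ge0 X (f : vec X) : 0 <= l2norm f.
Proof. exact: sqrtr_ge0. Qed.

Lemma bounded_opP X Y (A : vec X -> vec Y) :
  (forall f, L2 f -> L2 (A f)) ->
  (forall c f g, L2 f -> L2 g -> veq (A (lin c f g)) (lin c (A f) (A g))) ->
  (exists K : R, forall f, L2 f -> n2 (A f) <= K * n2 f) ->
  bounded_op A.
Proof.
move=> AL Al [K AK]; split => //; exists (Num.sqrt `|K|) => f Lf.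
rewrite /l2norm -sqrtrM // ler_wsqrtr // (le_trans (AK _ Lf)) //.
by rewrite ler_wpM2r ?n2_ge0 ?ler_norm.
Qed.

Lemma bounded_n2 X Y (A : vec X -> vec Y) : bounded_op A ->
  exists2 K : R, 0 <= K & forall f, L2 f -> n2 (A f) <= K * n2 f.
Proof.
move=> [_ _ [M AM]]; exists (M ^+ 2); first exact: sqr_ge0.
move=> f Lf; rewrite -!l2norm_sqr -exprMn ler_pXn2r ?AM // nnegrE ?l2norm_ge0 //.
exact: le_trans (l2norm_ge0 _) (AM _ Lf).
Qed.

Lemma bounded_L2 X Y (A : vec X -> vec Y) f : bounded_op A -> L2 f -> L2 (A f).
Proof. by case=> h _ _; exact: h. Qed.

Lemma bounded_lin X Y (A : vec X -> vec Y) c f g : bounded_op A ->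
  L2 f -> L2 g -> veq (A (lin c f g)) (lin c (A f) (A g)).
Proof. by case=> _ h _; exact: h. Qed.

(** Operators act on representatives, and compatibility with [veq] is not part of [bounded_op]: it
    follows by applying the norm bound to the null vector [g - f]. *)
Lemma bounded_veq X Y (A : vec X -> vec Y) f g : bounded_op A ->
  L2 f -> L2 g -> veq f g -> veq (A f) (A g).
Proof.
move=> bA Lf Lg fg; have Ld := L2_lin (-1) Lf Lg.
have d0 : n2 (lin (-1) f g) = 0.
  have dv : veq (lin (-1) f g) (fun=> 0).
    by apply: filterS fg => x h Dx; rewrite /lin h // mulN1r addNr.
  by rewrite (n2_veq Ld (L2_0 X) dv) n2_0.
have [K K0 AK] := bounded_n2 bA.
have A0 : n2 (A (lin (-1) f g)) = 0.
  by apply/le_anti; rewrite n2_ge0 andbT (le_trans (AK _ Ld)) // d0 mulr0.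
have := veq_trans (veq_sym (bounded_lin (-1) bA Lf Lg))
                  (n2_eq0 (bounded_L2 bA Ld) A0).
apply: filterS => x /= h Dx; apply/eqP.
by rewrite eq_sym -subr_eq0 addrC -[- A f x]mulN1r; apply/eqP/h.
Qed.

Lemma inner_bounded_lin X Y (A : vec X -> vec Y) c f g h : bounded_op A ->
  L2 f -> L2 g -> L2 h ->
  inner h (A (lin c f g)) = c * inner h (A f) + inner h (A g).
Proof.
move=> bA Lf Lg Lh; have LA k : L2 k -> L2 (A k) by exact: bounded_L2.
rewrite -(inner_linr c Lh (LA _ Lf) (LA _ Lg)).
apply: inner_veq => //; last exact: bounded_lin.
  by apply: LA; exact: L2_lin.
by apply: L2_lin; apply: LA.
Qed.

Lemma inner_bounded_veq X Y (A : vec X -> vec Y) f g h : bounded_op A ->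
  L2 f -> L2 g -> L2 h -> veq f g -> inner h (A f) = inner h (A g).
Proof.
move=> bA Lf Lg Lh fg; apply: inner_veq => //; try exact: bounded_L2.
exact: bounded_veq.
Qed.

Lemma bounded_0 X Y (A : vec X -> vec Y) : bounded_op A ->
  veq (A (fun=> 0)) (fun=> 0).
Proof.
move=> bA; have [K K0 AK] := bounded_n2 bA; have L0 := L2_0 X.
apply: n2_eq0; first exact: bounded_L2.
by apply/le_anti; rewrite n2_ge0 andbT (le_trans (AK _ L0)) // n2_0 mulr0.
Qed.

Lemma inner_bounded_scale X Y (A : vec X -> vec Y) c f h : bounded_op A ->
  L2 f -> L2 h -> inner h (A (lin c f (fun=> 0))) = c * inner h (A f).
Proof.
move=> bA Lf Lh; have L0 := L2_0 X; rewrite (inner_bounded_lin c bA Lf L0 Lh).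
rewrite (inner_veq Lh (bounded_L2 bA L0) (L2_0 Y) (bounded_0 bA)).
by rewrite inner0r addr0.
Qed.

(** Expanding both sides leaves c (p, A q) + conj(c) (q, A p) = 0, and a single value of [c] would
    control only one combination of the two terms. This is the common core of polarization and of
    the block-diagonality of spectral integrals. *)
Lemma cross_terms_vanish X (A : vec X -> vec X) p q : bounded_op A ->
  L2 p -> L2 q ->
  (forall c, inner (lin c q p) (A (lin c q p)) =
     inner (lin c q (fun=> 0)) (A (lin c q (fun=> 0))) + inner p (A p)) ->
  inner p (A q) = 0 /\ inner q (A p) = 0.
Proof.
move=> bA Lp Lq H; have L0 := L2_0 X; have LA k : L2 k -> L2 (A k) by exact: bounded_L2.
have A0 (h : vec X) : L2 h -> inner h (A (fun=> 0)) = 0.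
  move=> Lh; have := inner_bounded_lin 1 bA L0 L0 Lh.
  rewrite (_ : lin 1 _ _ = fun=> 0); last first.
    by apply/funext => x; rewrite /lin mulr0 addr0.
  by rewrite mul1r => /eqP; rewrite -subr_eq subrr eq_sym => /eqP.
have E c : c * inner p (A q) + c^* * inner q (A p) = 0.
  have := H c; rewrite !inner_bounded_lin ?inner_linl //; try exact: L2_lin.
  all: try by apply: LA; exact: L2_lin.
  all: try exact: LA.
  rewrite !inner0l (A0 _ Lq) => e.
  apply: (addrI (c * (c^* * inner q (A q)) + inner p (A p))).
  by apply: etrans (etrans _ e) _; ring.
(* [c = 1] gives the sum of the two cross terms, [c = i] their difference. *)
have := E 1; have := E ('i%C); rewrite rmorph1 !mul1r.
rewrite (_ : ('i%C)^* = - 'i%C :> R[i]); last first.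
  by apply: complexP; rewrite !complexReIm //= ?oppr0.
rewrite mulNr -mulrBr => /eqP; rewrite mulf_eq0 => /orP[/eqP/(congr1 Im) /= /eqP|].
  by rewrite oner_eq0.
rewrite subr_eq0 => /eqP e1; rewrite e1 -mulr2n => /eqP.
by rewrite mulrn_eq0 /= => /eqP ->.
Qed.

(** The difference [D] has zero quadratic form, so [cross_terms_vanish] applies to it with both
    sides of its hypothesis equal to 0. *)
Lemma polarization X (A B : vec X -> vec X) : bounded_op A -> bounded_op B ->
  (forall f, L2 f -> inner f (A f) = inner f (B f)) ->
  forall f, L2 f -> veq (A f) (B f).
Proof.
move=> bA bB AB f Lf; apply: inner_eq; [exact: bounded_L2..|] => h Lh.
pose D (k : vec X) : vec X := lin (-1) (A k) (B k).
have LAB k : L2 k -> L2 (A k) /\ L2 (B k) by split; exact: bounded_L2.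
have bD : bounded_op D.
  have [K K0 AK] := bounded_n2 bA; have [K' K0' BK] := bounded_n2 bB.
  apply: bounded_opP => [k /LAB[]||]; first exact: L2_lin.
    move=> c k l Lk Ll; have := veq_lin (-1) (bounded_lin c bA Lk Ll)
      (bounded_lin c bB Lk Ll).
    by apply: filterS => x h1 Dx; rewrite /D h1 // /lin; ring.
  exists (2 * K + 2 * K') => k Lk; have [LAk LBk] := LAB _ Lk.
  (* Parallelogram estimate: positivity of the norm of [A k + B k] bounds the cross term in the norm
     of [B k - A k]. *)
  have h1 := n2_ge0 (lin 1 (A k) (B k)); rewrite n2_lin // in h1.
  rewrite /D n2_lin //; move: h1 (AK _ Lk) (BK _ Lk).
  rewrite cmodN (_ : cmod 1 = 1); last by rewrite /cmod normr1.
  rewrite expr1n !complexReIm /=; lra.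
have D0 k : L2 k -> inner k (D k) = 0.
  by move=> Lk; have [? ?] := LAB _ Lk; rewrite /D inner_linr // AB // mulN1r addNr.
have [|h1 _] := @cross_terms_vanish X D h f bD Lh Lf.
  by move=> c; rewrite !D0 ?addr0 //; apply: L2_lin => //; exact: L2_0.
have [? ?] := LAB _ Lf.
by move: h1; rewrite /D inner_linr // mulN1r addrC => /eqP; rewrite subr_eq0 => /eqP.
Qed.

End hilbert.

(** * Projection-valued measures and spectral integrals *)

Section pvm_facts.
Context (R : realType) (X : mspace R) (E : pvm X).
Implicit Types (f g : vec X) (B C : set (borelC R)).

Lemma pvm_bounded B : measurable B -> bounded_op (E B).
Proof. by move=> /(pvm_projection E)[]. Qed.

Lemma pvm_L2 B f : measurable B -> L2 f -> L2 (E B f).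
Proof. by move=> mB; exact/bounded_L2/pvm_bounded. Qed.

Lemma pvm_selfadjoint B f g : measurable B -> L2 f -> L2 g ->
  inner f (E B g) = inner (E B f) g.
Proof. by move=> /(pvm_projection E)[_ _]; exact. Qed.

Lemma pvm_innerI B C f g : measurable B -> measurable C -> L2 f -> L2 g ->
  inner (E B f) (E C g) = inner f (E (B `&` C) g).
Proof.
move=> mB mC Lf Lg; have LE := pvm_L2 mC Lg.
have mBC := measurableI _ _ mB mC.
rewrite -pvm_selfadjoint //; apply: inner_veq => //; [exact: pvm_L2..|].
by apply: veq_sym; exact: pvm_setI.
Qed.

Lemma pvm_inner_n2 B f : measurable B -> L2 f ->
  inner f (E B f) = (n2 (E B f))%:C%C.
Proof. by move=> mB Lf; rewrite -innerE pvm_innerI // setIid. Qed.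

Lemma pvm_measureE B f (Lf : L2 f) : measurable B ->
  pvm_measure E Lf B = (n2 (E B f))%:E.
Proof. by move=> mB; rewrite /pvm_measure asboolT // pvm_inner_n2. Qed.

Let finite_pvm_measure f (Lf : L2 f) : fin_num_fun (pvm_measure E Lf).
Proof. by move=> B mB; rewrite pvm_measureE. Qed.

HB.instance Definition _ f (Lf : L2 f) :=
  Measure_isFinite.Build _ _ _ (pvm_measure E Lf) (finite_pvm_measure Lf).

(** The record normalises [E] only on the circle; [E setT] absorbs [E] of the circle by
    multiplicativity. *)
Lemma pvm_setT f : L2 f -> veq (E setT f) f.
Proof.
move=> Lf; have mU := @measurable_unit_circle R.
have LEf := pvm_L2 mU Lf.
apply: veq_trans (bounded_veq (pvm_bounded measurableT) Lf LEf _) _.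
  exact/veq_sym/pvm_circle.
apply: veq_trans (pvm_circle E Lf); apply: veq_sym.
by have := pvm_setI E measurableT mU Lf; rewrite setTI.
Qed.

Lemma pvm_set0 f : L2 f -> veq (E set0 f) (fun=> 0).
Proof.
move=> Lf; apply: n2_eq0; first exact: pvm_L2.
by apply: EFin_inj; rewrite -(pvm_measureE Lf) // measure0.
Qed.

(** Only the scalar measures are additive by assumption, so the identity is checked on quadratic
    forms and polarized. *)
Lemma pvm_setC B f : measurable B -> L2 f ->
  veq (E (~` B) f) (lin (-1) (E B f) f).
Proof.
move=> mB; have mCB := measurableC mB; have bB := pvm_bounded mB.
move: f; apply: polarization; first exact: pvm_bounded.
  apply: bounded_opP => [f Lf||].
  - by apply: L2_lin => //; exact: bounded_L2.
  - move=> c f g Lf Lg; have := bounded_lin c bB Lf Lg.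
    by apply: filterS => x h Dx; rewrite /lin h // /lin; ring.
  exists 1 => f Lf; have LB := bounded_L2 bB Lf.
  rewrite n2_lin // -innerJ // pvm_inner_n2 // cmodN cmod_real normr1 !complexReIm /=.
  have := n2_ge0 (E B f); lra.
move=> f Lf; have LB := bounded_L2 bB Lf.
rewrite inner_linr // !pvm_inner_n2 // innerE -(n2_veq (pvm_L2 _ Lf) Lf (pvm_setT Lf)) //.
have -> : n2 (E setT f) = n2 (E B f) + n2 (E (~` B) f).
  apply: EFin_inj; rewrite EFinD -!(pvm_measureE Lf) //.
  by rewrite -(setUv B) measureU // setICr.
by apply: complexP; rewrite !complexReIm /=; ring.
Qed.

Lemma pvm_le B f : measurable B -> L2 f -> n2 (E B f) <= n2 f.
Proof.
move=> mB Lf; rewrite -(n2_veq (pvm_L2 _ Lf) Lf (pvm_setT Lf)) //.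
by rewrite -lee_fin -!(pvm_measureE Lf) // le_measure ?inE.
Qed.

End pvm_facts.

Section bounded_integrand.
Context (R : realType) d (T : measurableType d).
Implicit Types (m : {measure set T -> \bar R}) (f : T -> R[i]) (D : set T).

Definition cbounded_measurable D f :=
  cmeasurable D f /\ exists M : R, forall z, D z -> cmod (f z) <= M.

Lemma cbounded_cintegrable m D f : (m D < +oo)%E -> measurable D ->
  cbounded_measurable D f -> cintegrable m D f.
Proof.
move=> fm mD [mf [M fM]]; apply: (@cintegrable_le _ _ _ _ _ _ (cst M)) => //.
apply/integrableP; split.
  by apply/measurable_EFinP; exact: measurable_cst.
rewrite /= integral_cst //.
by rewrite lte_mul_pinfty //= ltNye_eq.
Qed.

Lemma cint_measure_add (m1 m2 : {measure set T -> \bar R}) D f : measurable D ->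
  cintegrable m1 D f -> cintegrable m2 D f ->
  cint (measure_add m1 m2) D f = cint m1 D f + cint m2 D f.
Proof.
move=> mD; have H (h : T -> R) : m1.-integrable D (EFin \o h) -> m2.-integrable D (EFin \o h) ->
    \int[measure_add m1 m2]_(x in D) h x =
    \int[m1]_(x in D) h x + \int[m2]_(x in D) h x.
  move=> i1 i2; rewrite /Rintegral -fineD.
  - congr fine; exact: (integral_measure_add mD i1 i2).
  - exact: integrable_fin_num.
  - exact: integrable_fin_num.
by move=> [f1 f2] [g1 g2]; apply: complexP; rewrite !complexReIm /=; exact: H.
Qed.

Lemma eq_cint_measure (m1 m2 : {measure set T -> \bar R}) D f :
  (forall A, measurable A -> A `<=` D -> m1 A = m2 A) ->
  cint m1 D f = cint m2 D f.
Proof.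
move=> m12; congr Complex; rewrite /Rintegral; congr fine;
  exact: eq_measure_integral.
Qed.

End bounded_integrand.

Section spectral_integral_facts.
Context (R : realType) (X : mspace R) (E : pvm X) (phi : R[i] -> R[i]).
Hypothesis hphi : cbounded_measurable (unit_circle R : set (borelC R)) phi.
Variable A : vec X -> vec X.
Hypothesis hA : is_spectral_integral E phi A.

(** The hypothesis makes the scalar measure of [c q + p] the sum of those of [c q] and [p]. The form
    of [A] then splits in the same way, which kills its cross terms. *)
Lemma spectral_integral_orthogonal (p q : vec X) : L2 p -> L2 q ->
  (forall C : set (borelC R), measurable C -> inner p (E C q) = 0) ->
  inner p (A q) = 0 /\ inner q (A p) = 0.
Proof.
move=> Lp Lq pq; have [bA EA] := hA; have mU := @measurable_unit_circle R.
apply: cross_terms_vanish => // c.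
have Lc := L2_lin c Lq (L2_0 X); have Lcp := L2_lin c Lq Lp.
have fin k (Lk : L2 k) : (pvm_measure E Lk (unit_circle R) < +oo)%E.
  by rewrite pvm_measureE // ltry.
rewrite (EA _ Lcp) (EA _ Lc) (EA _ Lp) -cint_measure_add //; first last.
- exact: cbounded_cintegrable (fin _ _) _ _.
- exact: cbounded_cintegrable (fin _ _) _ _.
apply: eq_cint_measure => B mB _; transitivity (pvm_measure E Lcp B) => //.
rewrite pvm_measureE //.
transitivity (pvm_measure E Lc B + pvm_measure E Lp B)%E; last first.
  by rewrite -measure_addE.
rewrite !pvm_measureE //.
have bB := pvm_bounded E mB; have [LBq LBp] := (bounded_L2 bB Lq, bounded_L2 bB Lp).
have L0 := L2_0 X; have LB0 := bounded_L2 bB L0.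
rewrite (n2_veq (bounded_L2 bB Lcp) (L2_lin c LBq LBp) (bounded_lin c bB Lq Lp)).
rewrite (n2_veq (bounded_L2 bB Lc) (L2_lin c LBq LB0) (bounded_lin c bB Lq L0)).
rewrite !n2_lin // pvm_innerI // setIid.
have -> : inner q (E B p) = 0 by rewrite pvm_selfadjoint // -innerJ // pq // rmorph0.
have /(n2_eq0 LB0) h : n2 (E B (fun=> 0)) = 0.
  apply/le_anti; rewrite n2_ge0 andbT (le_trans (pvm_le E mB L0)) //.
  by rewrite n2_0.
rewrite (inner_veq LBq LB0 L0 h) (n2_veq LB0 L0 h) inner0r n2_0.
by rewrite addr0 -EFinD.
Qed.

(** Vectors from the ranges of [E] on [B] and on its complement are orthogonal under every [E C], so
    [A] has no matrix element between the two ranges: it is block diagonal, and such operators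
    commute with [E B]. *)
Lemma spectral_integral_commute (B : set (borelC R)) f : measurable B -> L2 f ->
  veq (E B (A f)) (A (E B f)).
Proof.
move=> mB Lf; have [bA _] := hA; have mCB := measurableC mB.
have LA k : L2 k -> L2 (A k) by exact: bounded_L2.
have LE k : L2 k -> L2 (E B k) by exact: pvm_L2.
have LC k : L2 k -> L2 (E (~` B) k) by exact: pvm_L2.
have split k : L2 k -> veq k (lin 1 (E B k) (E (~` B) k)).
  move=> Lk; have := pvm_setC E mB Lk.
  by apply: filterS => x h Dx; rewrite /lin h // /lin; ring.
have X0 h k : L2 h -> L2 k -> inner (E B h) (A (E (~` B) k)) = 0 /\
    inner (E (~` B) k) (A (E B h)) = 0.
  move=> Lh Lk; apply: spectral_integral_orthogonal => [||C mC]; [exact: LE|exact: LC|].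
  have LEk := LE k Lk; rewrite pvm_innerI //; last exact: LC.
  rewrite pvm_selfadjoint //; [|exact: measurableI|exact: LC].
  rewrite pvm_innerI //; last exact: measurableI.
  rewrite setIAC setICr set0I.
  by rewrite (inner_veq Lh (pvm_L2 E measurable0 Lk) (L2_0 X) (pvm_set0 E Lk)) inner0r.
apply: inner_eq => [||h Lh]; [exact/LE/LA|exact/LA/LE|].
rewrite pvm_selfadjoint //; last exact: LA.
rewrite (inner_bounded_veq bA Lf (L2_lin 1 (LE _ Lf) (LC _ Lf)) (LE _ Lh) (split _ Lf)).
rewrite (inner_bounded_lin 1 bA (LE _ Lf) (LC _ Lf) (LE _ Lh)) (X0 _ _ Lh Lf).1.
rewrite (inner_veql (LA _ (LE _ Lf)) Lh (L2_lin 1 (LE _ Lh) (LC _ Lh)) (split _ Lh)).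
rewrite (inner_linl 1 (LA _ (LE _ Lf)) (LE _ Lh) (LC _ Lh)) (X0 _ _ Lf Lh).2.
by rewrite rmorph1 !mul1r.
Qed.

End spectral_integral_facts.

(** * Unitary operators with explicit inverse, and unitary invariance of the spectrum *)

Section unitary_pairs.
Context (R : realType).
Implicit Types (X Y Z : mspace R).

(** [T] is both the adjoint and the inverse of [V]. Carrying it along makes inversion and
    composition immediate, whereas [unitary_op] only provides a preimage for each vector
    separately. *)
Definition unitary_pair X Y (V : vec X -> vec Y) (T : vec Y -> vec X) : Prop :=
  [/\ bounded_op V, bounded_op T,
      forall f h, L2 f -> L2 h -> inner (V f) h = inner f (T h),
      forall f, L2 f -> veq (T (V f)) f & forall h, L2 h -> veq (V (T h)) h].

Lemma unitary_pair_sym X Y (V : vec X -> vec Y) (T : vec Y -> vec X) :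
  unitary_pair V T -> unitary_pair T V.
Proof.
move=> [bV bT VT TV VTh]; split => // f h Lf Lh.
by rewrite -innerJ -?VT ?innerJ //; [exact: (bounded_L2 bV)|exact: (bounded_L2 bT)].
Qed.

Lemma bounded_comp X Y Z (A : vec X -> vec Y) (B : vec Y -> vec Z) :
  bounded_op A -> bounded_op B -> bounded_op (B \o A).
Proof.
move=> bA bB; have LA k : L2 k -> L2 (A k) by exact: (bounded_L2 bA).
have [K K0 AK] := bounded_n2 bA; have [K' K0' BK] := bounded_n2 bB.
apply: bounded_opP.
- by move=> f /LA; exact: (bounded_L2 bB).
- move=> c f g Lf Lg /=.
  apply: veq_trans (bounded_veq bB (LA _ (L2_lin c Lf Lg))
    (L2_lin c (LA _ Lf) (LA _ Lg)) (bounded_lin c bA Lf Lg)) _.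
  by apply: bounded_lin => //; exact: LA.
- exists (K' * K) => f Lf /=; apply: le_trans (BK _ (LA _ Lf)) _.
  by rewrite -mulrA ler_wpM2l // AK.
Qed.

Lemma unitary_pair_comp X Y Z (V : vec X -> vec Y) T (V' : vec Y -> vec Z) T' :
  unitary_pair V T -> unitary_pair V' T' -> unitary_pair (V' \o V) (T \o T').
Proof.
move=> [bV bT VT TV VTh] [bV' bT' VT' TV' VTh'].
have LV k : L2 k -> L2 (V k) by exact: (bounded_L2 bV).
have LT k : L2 k -> L2 (T k) by exact: (bounded_L2 bT).
have LV' k : L2 k -> L2 (V' k) by exact: (bounded_L2 bV').
have LT' k : L2 k -> L2 (T' k) by exact: (bounded_L2 bT').
split; [exact: bounded_comp|exact: bounded_comp| | |].
- by move=> f h Lf Lh /=; rewrite VT' ?VT //; [exact: LT'|exact: LV].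
- move=> f Lf /=; have Lf1 := LV _ Lf.
  exact: veq_trans (bounded_veq bT (LT' _ (LV' _ Lf1)) Lf1 (TV' _ Lf1)) (TV _ Lf).
- move=> f Lf /=; have Lf1 := LT' _ Lf.
  exact: veq_trans (bounded_veq bV' (LV _ (LT _ Lf1)) Lf1 (VTh _ Lf1)) (VTh' _ Lf).
Qed.

Lemma unitary_pair_inner X Y (V : vec X -> vec Y) T f g : unitary_pair V T ->
  L2 f -> L2 g -> inner (V f) (V g) = inner f g.
Proof.
move=> [bV bT VT TV VTh] Lf Lg; have LVg := bounded_L2 bV Lg.
by rewrite VT // (inner_veq Lf (bounded_L2 bT LVg) Lg (TV _ Lg)).
Qed.

Lemma unitary_pair_unitary X Y (V : vec X -> vec Y) T :
  unitary_pair V T -> unitary_op V.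
Proof.
move=> VT; have [bV bT _ _ VTh] := VT; split => // [f g|h Lh].
  exact: unitary_pair_inner VT.
by exists (T h); [exact: (bounded_L2 bT)|exact: VTh].
Qed.

(** A resolvent [C] of [A] becomes the resolvent V C T of [B]. The reverse inclusion is the same
    argument for the inverse pair. *)
Lemma spectrum_unitary_sub X Y (V : vec X -> vec Y) T A B :
  unitary_pair V T -> bounded_op A -> bounded_op B ->
  (forall f, L2 f -> veq (V (A f)) (B (V f))) -> spectrum B `<=` spectrum A.
Proof.
move=> [bV bT VT TV VTh] bA bB AB z sB [C bC hC]; apply: sB.
have LV k : L2 k -> L2 (V k) by exact: (bounded_L2 bV).
have LT k : L2 k -> L2 (T k) by exact: (bounded_L2 bT).
have LC k : L2 k -> L2 (C k) by exact: (bounded_L2 bC).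
have LA k : L2 k -> L2 (A k) by exact: (bounded_L2 bA).
have LB k : L2 k -> L2 (B k) by exact: (bounded_L2 bB).
have sub W (D : vec W -> vec W) f :
    (fun x => D f x - z * f x) = lin (- z) f (D f).
  by apply/funext => x; rewrite /lin mulNr addrC.
have BV k : L2 k -> veq (lin (- z) (V k) (B (V k))) (V (lin (- z) k (A k))).
  move=> Lk; apply: veq_trans (veq_sym (bounded_lin (- z) bV Lk (LA _ Lk))).
  by apply: veq_lin; [exact: veq_refl|exact/veq_sym/AB].
exists (V \o C \o T); first exact: (bounded_comp (bounded_comp bT bC) bV).
move=> f Lf; have LTf := LT _ Lf; have LCTf := LC _ LTf.
have fVT := veq_sym (VTh _ Lf).
have LzA k : L2 k -> L2 (lin (- z) k (A k)) by move=> Lk; apply: L2_lin => //; exact: LA.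
have LzB k : L2 k -> L2 (lin (- z) k (B k)) by move=> Lk; apply: L2_lin => //; exact: LB.
split.
  rewrite sub /=; apply: veq_trans (VTh _ Lf).
  apply: (bounded_veq bV (LC _ (LT _ (LzB _ Lf))) LTf).
  have := (hC _ LTf).1; rewrite sub; apply: veq_trans.
  apply: (bounded_veq bC (LT _ (LzB _ Lf)) (LzA _ LTf)).
  apply: veq_trans (TV _ (LzA _ LTf)).
  apply: (bounded_veq bT (LzB _ Lf) (LV _ (LzA _ LTf))).
  apply: veq_trans (BV _ LTf); apply: veq_lin => //.
  by apply: (bounded_veq bB Lf (LV _ LTf)).
rewrite sub /=; apply: veq_trans (VTh _ Lf).
apply: veq_trans (BV _ LCTf) _.
apply: (bounded_veq bV (LzA _ LCTf) LTf).
by have := (hC _ LTf).2; rewrite sub.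
Qed.

Lemma spectrum_unitary X Y (V : vec X -> vec Y) T A B :
  unitary_pair V T -> bounded_op A -> bounded_op B ->
  (forall f, L2 f -> veq (V (A f)) (B (V f))) -> spectrum A = spectrum B.
Proof.
move=> VT bA bB AB; apply/seteqP; split; last exact: (spectrum_unitary_sub VT bA bB AB).
apply: (spectrum_unitary_sub (unitary_pair_sym VT)) => // h Lh.
have [bV bT _ TV VTh] := VT; have LTh := bounded_L2 bT Lh.
have LA := bounded_L2 bA LTh; apply: veq_trans (TV _ LA).
apply: (bounded_veq bT (bounded_L2 bB Lh) (bounded_L2 bV LA)).
apply: veq_trans (veq_sym (AB _ LTh)).
exact: (bounded_veq bB Lh (bounded_L2 bV LTh) (veq_sym (VTh _ Lh))).
Qed.

End unitary_pairs.

(** * Multiplication operators and their spectrum *)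

Section multiplication_operator.
Context (R : realType) (X : mspace R).
Implicit Types (f g : vec X) (phi : scar X -> R[i]).

Definition mulop phi : vec X -> vec X := fun f x => phi x * f x.

Lemma L2_mulop phi (M : R) f : cmeasurable (sdom X) phi ->
  (forall x, sdom X x -> cmod (phi x) <= M) -> L2 f ->
  L2 (mulop phi f) /\ n2 (mulop phi f) <= M ^+ 2 * n2 f.
Proof.
move=> mphi phiM Lf; have mD := sdom_measurable X.
have mf : cmeasurable (sdom X) f by case: Lf.
have mpf : cmeasurable (sdom X) (mulop phi f) by exact: cmeasurableM.
have le : (\int[smeas X]_(x in sdom X) (cmod (mulop phi f x) ^+ 2)%:E <=
    (M ^+ 2 * n2 f)%:E)%E.
  rewrite EFinM n2_integral // -ge0_integralZl //.
  - apply: ge0_le_integral => //.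
    + by move=> x _; rewrite lee_fin sqr_ge0.
    + by apply/measurable_EFinP; exact: measurable_sqr_cmod.
    + by apply: measurable_funeM; apply/measurable_EFinP; exact: measurable_sqr_cmod.
    + move=> x Dx; rewrite -EFinM lee_fin /mulop cmodM exprMn ler_wpM2r ?sqr_ge0 //.
      have h := phiM _ Dx; rewrite ler_pXn2r ?nnegrE ?cmod_ge0 //.
      exact: le_trans (cmod_ge0 _) h.
  - by apply/measurable_EFinP; exact: measurable_sqr_cmod.
  - by move=> x _; rewrite lee_fin sqr_ge0.
  - by rewrite lee_fin sqr_ge0.
have LM : L2 (mulop phi f).
  by split; [exact: mpf.1|exact: mpf.2|exact: le_lt_trans le (ltry _)].
by split => //; rewrite -lee_fin n2_integral.
Qed.

Lemma bounded_mulop phi : cbounded_measurable (sdom X) phi -> bounded_op (mulop phi).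
Proof.
move=> [mphi [M phiM]]; apply: bounded_opP.
- by move=> f Lf; exact: (L2_mulop mphi phiM Lf).1.
- by move=> c f g _ _; apply: veq_eq => x _; rewrite /mulop /lin; ring.
- by exists (M ^+ 2) => f Lf; exact: (L2_mulop mphi phiM Lf).2.
Qed.

Definition ind (S : set (scar X)) : vec X := fun x => (\1_S x)%:C%C.

Lemma indE S x : ind S x = (x \in S)%:R.
Proof. by rewrite /ind indicE; case: (_ \in _). Qed.

Lemma cmeasurable_ind D S : measurable S -> cmeasurable D (ind S).
Proof.
move=> mS; split; last exact: measurable_cst.
exact: measurable_indic.
Qed.

Lemma sqr_cmod_ind S x : cmod (ind S x) ^+ 2 = \1_S x.
Proof.
rewrite /ind indicE cmod_real; case: (_ \in _); rewrite ?normr1 ?normr0.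
  by rewrite expr1n.
by rewrite expr0n.
Qed.

Lemma L2_mul_ind S f : measurable S -> L2 f -> L2 (mulop (ind S) f).
Proof.
move=> mS Lf; apply: (L2_mulop (M := 1) (cmeasurable_ind (sdom X) mS) _ Lf).1 => x _.
by rewrite /ind indicE cmod_real; case: (_ \in _); rewrite ?normr1 ?normr0.
Qed.

Lemma L2_ind S : measurable S -> (smeas X (S `&` sdom X) < +oo)%E -> L2 (ind S).
Proof.
move=> mS fS; have [m1 m2] := cmeasurable_ind (sdom X) mS.
split => //; under eq_integral do rewrite sqr_cmod_ind.
by rewrite integral_indic //; exact: sdom_measurable.
Qed.

Lemma n2_ind S : measurable S -> (smeas X (S `&` sdom X) < +oo)%E ->
  (n2 (ind S))%:E = smeas X (S `&` sdom X).
Proof.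
move=> mS fS; rewrite n2_integral; last exact: L2_ind.
under eq_integral do rewrite sqr_cmod_ind.
by rewrite integral_indic //; exact: sdom_measurable.
Qed.

Lemma measurable_essential_set phi z (e : R) : cmeasurable (sdom X) phi ->
  measurable [set x | sdom X x /\ cmod (phi x - z) < e].
Proof.
move=> mphi; have mD := sdom_measurable X.
have [e0|e0] := leP e 0.
  rewrite (_ : [set _ | _] = set0) //; apply/seteqP; split => // x [_] /=.
  by move=> /lt_le_trans/(_ e0); rewrite ltNge cmod_ge0.
rewrite (_ : [set _ | _] = sdom X `&`
   (fun x => cmod (phi x - z) ^+ 2) @^-1` `]-oo, e ^+ 2[%classic).
  have : measurable_fun (sdom X) (fun x => cmod (phi x - z) ^+ 2).
    by apply: measurable_sqr_cmod; apply: cmeasurableD => //; exact: cmeasurable_cst.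
  by apply; [exact: mD|exact: measurable_itv].
by apply/seteqP; split => x /=; rewrite in_itv /= ltr_pXn2r // nnegrE ?cmod_ge0 // ltW.
Qed.

(** If a level set of [phi] around [z] is null, a truncated reciprocal of [phi - z] gives a bounded
    inverse. Otherwise indicators of level sets are approximate eigenvectors, which no bounded
    inverse tolerates. *)
Lemma spectrum_mulop phi : (smeas X (sdom X) < +oo)%E ->
  cbounded_measurable (sdom X) phi ->
  spectrum (mulop phi) = [set z | forall e : R, 0 < e ->
    (0 < smeas X [set x | sdom X x /\ (cmod (phi x - z) < e)%R])%E].
Proof.
move=> fX hphi; have [mphi _] := hphi; have mD := sdom_measurable X.
apply/seteqP; split => z.
  move=> sz e e0; rewrite lt_neqAle measure_ge0 andbT; apply/negP => /eqP/esym S0.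
  set S := [set x | _] in S0.
  have mS : measurable S by exact: measurable_essential_set.
  apply: sz; pose g x := phi x - z.
  have mg : cmeasurable (sdom X) g by apply: cmeasurableD => //; exact: cmeasurable_cst.
  (* The cutoff at [e ^+ 2] keeps [psi] bounded by [e^-1] everywhere, while [psi] still equals the
     reciprocal of [g] off the null set [S]. *)
  pose k (r : R) := (Num.max r (e ^+ 2))^-1.
  have e20 : 0 < e ^+ 2 by rewrite exprn_gt0.
  have mk0 r : 0 < Num.max r (e ^+ 2) by rewrite lt_max e20 orbT.
  have mk : measurable_fun setT k.
    apply: nonincreasing_measurable => // r s rs.
    rewrite /k lef_pV2 ?posrE // ge_max !le_max rs lexx !orbT //.
  pose psi x := (g x)^* * (k (cmod (g x) ^+ 2))%:C%C.
  have mpsi : cmeasurable (sdom X) psi.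
    apply: cmeasurableM; first exact: cmeasurableJ.
    split; last exact: measurable_cst.
    apply: (measurableT_comp mk); exact: measurable_sqr_cmod.
  have psie x : sdom X x -> ~ S x -> psi x * g x = 1.
    move=> Dx Sx; have ge : e <= cmod (g x) by rewrite leNgt; apply/negP => ?; exact: Sx.
    have ge2 : e ^+ 2 <= cmod (g x) ^+ 2.
      by rewrite ler_pXn2r // nnegrE ?cmod_ge0 // ltW.
    rewrite /psi mulrAC mulJc -rmorphM /= /k max_l // mulfV // gt_eqF //.
    exact: lt_le_trans ge2.
  have psiM x : sdom X x -> cmod (psi x) <= e^-1.
    move=> Dx; rewrite /psi cmodM cmodJ cmod_real ger0_norm; last first.
      by rewrite invr_ge0 ltW.
    rewrite /k ler_pdivrMr // ler_pdivlMl // le_max.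
    have [h|h] := leP e (cmod (g x)).
      by rewrite expr2 ler_wpM2r ?cmod_ge0.
    by apply/orP; right; rewrite expr2 ler_wpM2l // ltW.
  exists (mulop psi); first by apply: bounded_mulop; split => //; exists e^-1.
  move=> f Lf; have aS : {ae smeas X, forall x, ~ S x}.
    by exists S; split => // x /contrapT.
  split; apply: filterS aS => x Sx Dx; have := psie _ Dx Sx; rewrite /g => h.
    by rewrite /mulop -mulrBl mulrA h mul1r.
  by rewrite /mulop -mulrBl mulrA [(_ - _) * _]mulrC h mul1r.
move=> ez [B bB hB]; have [K K0 BK] := bounded_n2 bB.
have e20 : 0 < (K + 1)^-1 by rewrite invr_gt0 ltr_wpDl.
(* This choice makes [K * e ^+ 2 < 1], whereas the bound on [B], applied to [phi - z] times the
   indicator of [S], would force [1 <= K * e ^+ 2]. *)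
pose e := Num.sqrt (K + 1)^-1.
have e0 : 0 < e by rewrite sqrtr_gt0.
have := ez _ e0; set S := [set x | _] => S0.
have mS : measurable S by exact: measurable_essential_set.
have SD : S `&` sdom X = S by apply/seteqP; split => x [] // ? ?; split.
have fS : (smeas X (S `&` sdom X) < +oo)%E.
  rewrite SD; apply: le_lt_trans fX; apply: le_measure; rewrite ?inE //.
  by move=> x [].
have LS := L2_ind mS fS; have nS := n2_ind mS fS.
have [hS _] := hB _ LS.
(* The indicator is built into [psi] so that the bound by [e] holds on the whole domain; multiplying
   by [ind S] once more changes nothing. *)
pose psi x := (phi x - z) * ind S x.
have mpsi : cmeasurable (sdom X) psi.
  apply: cmeasurableM; last exact: cmeasurable_ind.
  by apply: cmeasurableD => //; exact: cmeasurable_cst.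
have psie x : sdom X x -> cmod (psi x) <= e.
  move=> Dx; rewrite /psi cmodM /ind indicE cmod_real.
  case: (boolP (x \in S)) => [|_]; last by rewrite normr0 mulr0 ltW.
  by rewrite inE normr1 mulr1 => -[_ /ltW].
have [Lp np] := L2_mulop mpsi psie LS.
have pE : (fun x => mulop phi (ind S) x - z * ind S x) = mulop psi (ind S).
  apply/funext => x; rewrite /mulop /psi /ind indicE -mulrBl.
  by case: (_ \in _); rewrite ?mulr1 ?mulr0.
rewrite pE in hS; have LBp := bounded_L2 bB Lp.
have := BK _ Lp; rewrite (n2_veq LBp LS hS) => h.
have nS0 : 0 < n2 (ind S) by rewrite -lte_fin nS SD.
have : n2 (ind S) <= K * (e ^+ 2 * n2 (ind S)).
  by apply: le_trans h _; rewrite ler_wpM2l.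
rewrite sqr_sqrtr ?(ltW e20) // mulrA ler_pMl // ler_pdivlMr ?ltr_wpDl // mul1r.
by rewrite gerDl ler10.
Qed.

End multiplication_operator.

(** * Topology and Borel sets of the complex plane *)

Section complex_topology.
Context (R : realType).
Implicit Types (z w a : R[i]) (O : set R[i]).

Lemma openC_cmodP O : open O <->
  (forall z, O z -> exists2 e : R, 0 < e & forall w, cmod (w - z) < e -> O w).
Proof.
split=> [oO z Oz|H].
  have /nbhs_ballP[e /= e0 he] : nbhs z O by exact: open_nbhs_nbhs.
  (* Radii of balls in [R[i]] are complex; positivity forces them to be real, so [Re e] is the
     radius. *)
  exists (Re e); first by move: e0; rewrite ltcE => /andP[].
  move=> w h; apply: he; rewrite -ball_normE /ball_ /= distrC normC_cmod ltcE /=.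
  by move: e0; rewrite ltcE /= => /andP[-> _].
rewrite openE => z /H[e e0 he]; apply/nbhs_ballP; exists e%:C%C.
  by rewrite /= ltcR.
move=> w; rewrite -ball_normE /ball_ /= distrC normC_cmod ltcR; exact: he.
Qed.

Lemma cmod_lt_ReIm z (e : R) : `|Re z| < e -> `|Im z| < e -> cmod z < 2 * e.
Proof.
move=> h1 h2; have e0 : 0 < e by exact: le_lt_trans h1.
rewrite -(ltr_pXn2r (n := 2)) ?nnegrE ?cmod_ge0 ?mulr_ge0 ?(ltW e0) //.
have sq (u : R) : `|u| < e -> u ^+ 2 < e ^+ 2.
  by move=> h; rewrite -(real_normK (num_real u)) ltr_pXn2r ?nnegrE ?(ltW e0).
have := sq _ h1; have := sq _ h2; rewrite sqr_cmod exprMn.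
have := sqr_ge0 e; lra.
Qed.

Lemma measurable_Re : measurable_fun setT (Re : borelC R -> R).
Proof.
apply: (measurability (@RGenOInfty.G R)).
  exact: RGenOInfty.measurableE.
move=> _ [_ [r ->] <-]; rewrite setTI; apply: sub_sigma_algebra => /=.
apply/openC_cmodP => z; rewrite /= in_itv /= andbT => zr.
exists (Re z - r); first by rewrite subr_gt0.
move=> w h; rewrite /= in_itv /= andbT.
have := le_lt_trans (ler_Re_cmod _) h.
by rewrite !complexReIm ltr_norml; lra.
Qed.

Lemma measurable_Im : measurable_fun setT (Im : borelC R -> R).
Proof.
apply: (measurability (@RGenOInfty.G R)).
  exact: RGenOInfty.measurableE.
move=> _ [_ [r ->] <-]; rewrite setTI; apply: sub_sigma_algebra => /=.
apply/openC_cmodP => z; rewrite /= in_itv /= andbT => zr.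
exists (Im z - r); first by rewrite subr_gt0.
move=> w h; rewrite /= in_itv /= andbT.
have := le_lt_trans (ler_Im_cmod _) h.
by rewrite !complexReIm ltr_norml; lra.
Qed.

Lemma cmeasurable_id : cmeasurable setT (id : borelC R -> R[i]).
Proof. by split; [exact: measurable_Re|exact: measurable_Im]. Qed.

Lemma unit_circle_cmod z : unit_circle R z <-> cmod z = 1.
Proof.
rewrite /unit_circle /= normC_cmod; split; first by case.
by move=> ->.
Qed.

Definition cdisk (a : R[i]) (r : R) : set (borelC R) := [set w | cmod (w - a) <= r].

Lemma measurable_cdisk a r : measurable (cdisk a r).
Proof.
rewrite -[cdisk a r]setCK; apply: measurableC; apply: sub_sigma_algebra => /=.
apply/openC_cmodP => z /= /negP; rewrite -ltNge => zr.
exists (cmod (z - a) - r); first by rewrite subr_gt0.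
move=> w h /=; apply/negP; rewrite -ltNge.
have := cmodD (z - w) (w - a); rewrite addrA subrK -[cmod (z - w)]cmodN opprB.
by move=> h2; lra.
Qed.

(** An open set is the union of the closed disks with rational centre and radius that it contains,
    and these are countably many. *)
Lemma borelC_cdisk_ind (P : set (set (borelC R))) : sigma_algebra setT P ->
  (forall a r, P (cdisk a r)) -> forall B, measurable B -> P B.
Proof.
move=> sP Pd B mB; have [P0 _ PU] := sP.
suff : <<s @open R[i] >> `<=` P by exact.
apply: smallest_sub => // O oO.
pose D (t : rat * rat * rat) : set (borelC R) :=
  cdisk (ratr t.1.1 +i* ratr t.1.2)%C (ratr t.2).
pose F k := if unpickle k is Some t then
  if `[< D t `<=` O >] then D t else set0 else set0.
rewrite (_ : O = \bigcup_k F k).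
  apply: PU => k; rewrite /F; case: unpickle => // t.
  by case: asboolP => _ //; exact: Pd.
apply/seteqP; split=> [z Oz|z [k _]]; last first.
  by rewrite /F; case: unpickle => // t; case: asboolP => //; exact.
have [e e0 he] := (openC_cmodP O).1 oO _ Oz.
(* With the centre within [e / 4] of [z] and a radius between [e / 4] and [e / 2], the disk contains
   [z] and stays within [3 * e / 4] of it. *)
have e8 : 0 < e / 8 by rewrite divr_gt0.
have [p] : exists q : rat, ratr q \in `](Re z - e / 8), (Re z + e / 8)[.
  by apply: rat_in_itvoo; lra.
have [q] : exists q : rat, ratr q \in `](Im z - e / 8), (Im z + e / 8)[.
  by apply: rat_in_itvoo; lra.
have [r] : exists r : rat, ratr r \in `](e / 4), (e / 2)[.
  by apply: rat_in_itvoo; lra.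
rewrite !in_itv /= => rr qq pp.
exists (pickle (p, q, r)); first exact: I.
rewrite /F pickleK /D [(p, q, r).1]/= [(p, q, r).2]/= [(p, q).1]/= [(p, q).2]/=.
move: {p q r F D} (ratr p : R) (ratr q : R) (ratr r : R) rr qq pp => p q r.
move=> /andP[r1 r2] /andP[q1 q2] /andP[p1 p2].
pose c : R[i] := (p +i* q)%C.
have zc : cmod (z - c) < 2 * (e / 8).
  by apply: cmod_lt_ReIm; rewrite !complexReIm /= ltr_norml; apply/andP; split; lra.
rewrite asboolT; first by rewrite /cdisk /= -/c; lra.
rewrite -/c => w; rewrite /cdisk /= => wc; apply: he.
have := cmodD (w - c) (c - z); rewrite addrA subrK.
rewrite -[cmod (c - z)]cmodN opprB => h; lra.
Qed.

End complex_topology.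

(** * Measurability and boundedness of continuous functions on the circle *)

Section continuous_on_circle.
Context (R : realType) (phi : R[i] -> R[i]).
Hypothesis cphi : {within unit_circle R, continuous phi}.

Let phi_eps z (e : R) : unit_circle R z -> 0 < e -> exists2 d : R, 0 < d &
  forall w, unit_circle R w -> cmod (w - z) < d -> cmod (phi w - phi z) < e.
Proof.
move=> Uz e0; have /cvgrPdist_lt := @cphi z.
move=> /(_ e%:C%C); rewrite ltcR => /(_ e0).
move=> h; have {h} : within (unit_circle R) (nbhs z)
    (fun t => `|phi z - phi t| < e%:C%C) by rewrite (nbhs_subspace_in Uz).
move=> /nbhs_ballP[d /= d0 hd].
exists (Re d); first by move: d0; rewrite ltcE => /andP[].
move=> w Uw h; rewrite -ltcR -normC_cmod distrC; apply: hd => //.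
rewrite -ball_normE /ball_ /= distrC normC_cmod ltcE /=.
by move: d0; rewrite ltcE /= => /andP[-> _].
Qed.

Let phi_measurable : cmeasurable (unit_circle R : set (borelC R)) phi.
Proof.
have main (h : R[i] -> R) : (forall z w, `|h w - h z| <= cmod (w - z)) ->
    measurable_fun (unit_circle R : set (borelC R)) (h \o phi).
  move=> hh mU; apply: (measurability (@RGenOInfty.G R)) => //.
    exact: RGenOInfty.measurableE.
  move=> _ [_ [r ->] <-].
  (* Continuity holds only along the circle, so the preimage is written as the trace of an open set
     of the plane: the union of disks around points [u] of the preimage on which continuity at [u]
     keeps [h \o phi] above [r]. *)
  pose O := [set z | exists2 u, unit_circle R u /\ r < h (phi u) &
    exists2 d : R, cmod (z - u) < d & forall w, unit_circle R w ->
      cmod (w - u) < d -> cmod (phi w - phi u) < h (phi u) - r].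
  rewrite (_ : _ `&` _ = unit_circle R `&` O).
    apply: measurableI => //; apply: sub_sigma_algebra => /=.
    apply/openC_cmodP => z [u Uu [d zd hd]]; exists (d - cmod (z - u)).
      by rewrite subr_gt0.
    move=> w wz; exists u => //; exists d => //.
    have := cmodD (w - z) (z - u); rewrite addrA subrK; lra.
  apply/seteqP; split=> z [Uz]; rewrite /= in_itv /= andbT.
    move=> rz; split => //; exists z => //.
    have [|d d0 hd] := @phi_eps z (h (phi z) - r) Uz; first by rewrite subr_gt0.
    by exists d => //; rewrite subrr cmod0.
  move=> [u [Uu ru] [d zd hd]]; split => //.
  have := le_lt_trans (hh _ _) (hd _ Uz zd).
  by rewrite ltr_norml; lra.
split; apply: main => z w; [have := ler_Re_cmod (w - z)|have := ler_Im_cmod (w - z)].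
  by rewrite !complexReIm.
by rewrite !complexReIm.
Qed.

(** Compactness is borrowed from the interval [- pi, pi]: the modulus of [phi] along the angle
    parametrization [gam] attains a maximum there, and each point of the circle has an angle in it,
    namely [acos] of the real part up to the sign of the imaginary part. *)
Let phi_bounded : exists M : R, forall z, unit_circle R z -> cmod (phi z) <= M.
Proof.
pose gam (t : R) : R[i] := (cos t +i* sin t)%C.
have Ugam t : unit_circle R (gam t).
  apply/unit_circle_cmod/eqP.
  by rewrite -(eqrXn2 (n := 2)) ?cmod_ge0 // sqr_cmod /= cos2Dsin2 expr1n.
pose f t := cmod (phi (gam t)).
have cf : continuous f.
  move=> t; apply/cvgrPdist_lt => e e0.
  have [d d0 hd] := phi_eps (Ugam t) e0.
  have d2 : 0 < d / 2 by rewrite divr_gt0.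
  have /cvgrPdist_lt/(_ _ d2) hc := @continuous_cos R t.
  have /cvgrPdist_lt/(_ _ d2) hs := @continuous_sin R t.
  near=> s.
  have cs : `|cos t - cos s| < d / 2 by near: s.
  have ss : `|sin t - sin s| < d / 2 by near: s.
  have h : cmod (phi (gam s) - phi (gam t)) < e.
    apply: hd => //; rewrite -[d](divfK (_ : 2 != 0)) // mulrC.
    by apply: cmod_lt_ReIm; rewrite !complexReIm /= distrC.
  apply: le_lt_trans h; rewrite /f ler_norml.
  have h1 := cmodD (phi (gam s) - phi (gam t)) (phi (gam t)).
  have h2 := cmodD (phi (gam t) - phi (gam s)) (phi (gam s)).
  rewrite subrK in h1; rewrite subrK -[cmod (_ - _)]cmodN opprB in h2; lra.
have [|c _ hc] := @EVT_max R f (- pi) pi _ (continuous_subspaceT cf).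
  by have := pi_ge0 R; lra.
exists (f c) => z /unit_circle_cmod/(congr1 (fun x => x ^+ 2)).
rewrite sqr_cmod expr1n => z1.
have x1 : -1 <= Re z <= 1 by nra.
have [y0|y0] := leP 0 (Im z).
  have -> : z = gam (acos (Re z)).
    apply: complexP => /=; first by rewrite acosK.
    rewrite sin_acos // (_ : 1 - Re z ^+ 2 = Im z ^+ 2); last lra.
    by rewrite sqrtr_sqr ger0_norm.
  apply: hc; rewrite in_itv /= acos_lepi // andbT.
  by have := acos_ge0 x1; have := pi_ge0 R; lra.
have -> : z = gam (- acos (Re z)).
  apply: complexP => /=; first by rewrite cosN acosK.
  rewrite sinN sin_acos // (_ : 1 - Re z ^+ 2 = Im z ^+ 2); last lra.
  by rewrite sqrtr_sqr ltr0_norm // opprK.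
apply: hc; rewrite in_itv /=.
by have := acos_ge0 x1; have := acos_lepi x1; have := pi_ge0 R; lra.
Unshelve. all: by end_near.
Qed.

Lemma continuous_cbounded_measurable :
  cbounded_measurable (unit_circle R : set (borelC R)) phi.
Proof. by split. Qed.

End continuous_on_circle.

(** * Square integrable densities of the complex measures (g0, E(B) f) *)

Section cyclic_density.
Context (R : realType) (X : mspace R) (E : pvm X) (g0 : vec X) (Lg0 : L2 g0).
Implicit Types (f : vec X) (B C : set (borelC R)).

Local Notation mu := (pvm_measure E Lg0).

Lemma null_pvm_measure B f : measurable B -> L2 f -> mu B = 0%E ->
  inner g0 (E B f) = 0.
Proof.
move=> mB Lf; rewrite pvm_measureE // => -[h].
have LB := pvm_L2 E mB Lg0; have := n2_eq0 LB h => {}h.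
by rewrite pvm_selfadjoint // (inner_veql Lf LB (L2_0 X) h) inner0l.
Qed.

(** Radon-Nikodym is applied to a real charge, so the real part is treated alone; the imaginary part
    will be the real part belonging to [- i f]. *)
Lemma pvm_density_Re f : L2 f -> exists u : borelC R -> R,
  mu.-integrable setT (EFin \o u) /\
  forall B, measurable B -> (\int[mu]_(x in B) (u x)%:E)%E = (Re (inner g0 (E B f)))%:E.
Proof.
move=> Lf; have Lp := L2_lin 1 Lg0 Lf; have Lm := L2_lin (-1) Lg0 Lf.
(* Polarization: the real part is a quarter of the difference between the scalar measures of
   [f + g0] and [f - g0]. *)
pose nu := cadd (cscale (4^-1) (charge_of_finite_measure (pvm_measure E Lp)))
                (cscale (- 4^-1) (charge_of_finite_measure (pvm_measure E Lm))).
have nuE B : measurable B -> nu B = (Re (inner g0 (E B f)))%:E.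
  move=> mB; have bB := pvm_bounded E mB.
  have LB k : L2 k -> L2 (E B k) by exact: bounded_L2.
  transitivity ((4^-1)%:E * pvm_measure E Lp B +
                (- 4^-1)%:E * pvm_measure E Lm B)%E => //.
  rewrite !pvm_measureE // -!EFinM -EFinD; congr EFin.
  rewrite (n2_veq (LB _ Lp) (L2_lin 1 (LB _ Lg0) (LB _ Lf)) (bounded_lin 1 bB Lg0 Lf)).
  rewrite (n2_veq (LB _ Lm) (L2_lin (-1) (LB _ Lg0) (LB _ Lf)) (bounded_lin (-1) bB Lg0 Lf)).
  rewrite !n2_lin; try exact: LB.
  rewrite pvm_innerI // setIid cmodN.
  move: (inner _ _) (n2 _) (n2 _) => v x y; rewrite !complexReIm /=; by field.
have dom : nu `<< mu.
  move=> N N0 A mA AN; rewrite nuE // null_pvm_measure //.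
  exact: N0.
exists (fine \o Radon_Nikodym nu mu).
have fE : EFin \o (fine \o Radon_Nikodym nu mu) = Radon_Nikodym nu mu.
  by apply/funext => x /=; rewrite fineK //; exact: Radon_Nikodym_fin_num.
split=> [|B mB]; first by rewrite fE; exact: Radon_Nikodym_integrable.
rewrite -nuE //; apply: etrans (esym (Radon_Nikodym_integral dom mB)).
by apply: eq_integral => x _; rewrite -[LHS]/((EFin \o (fine \o _)) x) fE.
Qed.

(** Integrating over [B] gives t mu(B) <= Re (E(B) g0, E(B) f). Cauchy-Schwarz bounds the square of
    the right side by mu(B) times [n2 (E B f)], and one factor mu(B) cancels unless it is 0. *)
Let slice_bound f (u : borelC R -> R) B (t : R) : L2 f ->
  mu.-integrable setT (EFin \o u) ->
  (forall B, measurable B -> (\int[mu]_(x in B) (u x)%:E)%E = (Re (inner g0 (E B f)))%:E) ->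
  measurable B -> 0 <= t -> (forall x, B x -> t <= u x) ->
  t ^+ 2 * n2 (E B g0) <= n2 (E B f).
Proof.
move=> Lf iu uE mB t0 tu.
have LB k : L2 k -> L2 (E B k) by exact: pvm_L2.
have h1 : t * n2 (E B g0) <= Re (inner (E B g0) (E B f)).
  rewrite pvm_innerI // setIid -lee_fin -uE // EFinM -(pvm_measureE E Lg0) //.
  rewrite -integral_cst //; apply: le_integral => //.
  - by apply: (integrableS measurableT) => //; exact: finite_measure_integrable_cst.
  - exact: (integrableS measurableT).
  - by move=> x Bx /=; rewrite lee_fin tu // -inE.
have h2 := cauchy_schwarz (LB _ Lg0) (LB _ Lf).
have h3 : (t * n2 (E B g0)) ^+ 2 <= n2 (E B g0) * n2 (E B f).
  apply: le_trans h2; rewrite sqr_cmod.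
  have h4 : 0 <= t * n2 (E B g0) by rewrite mulr_ge0 // n2_ge0.
  have := sqr_ge0 (Im (inner (E B g0) (E B f))).
  have : (t * n2 (E B g0)) ^+ 2 <= Re (inner (E B g0) (E B f)) ^+ 2.
    by rewrite ler_pXn2r // nnegrE (le_trans h4).
  lra.
have [z|nz] := eqVneq (n2 (E B g0)) 0; first by rewrite z mulr0 n2_ge0.
have p0 : 0 < n2 (E B g0) by rewrite lt_def nz n2_ge0.
rewrite -(ler_pM2l p0); apply: le_trans h3.
by rewrite exprMn mulrCA expr2.
Qed.

(* The L2 estimate for the density [u] comes from the slices [n d <= u < (n + 1) d],
   on which Cauchy-Schwarz compares [u^2] with [n2 (E B f)]. *)
Let half_bound f (u : borelC R -> R) (d : R) : L2 f ->
  mu.-integrable setT (EFin \o u) ->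
  (forall B, measurable B -> (\int[mu]_(x in B) (u x)%:E)%E = (Re (inner g0 (E B f)))%:E) ->
  0 < d ->
  (\int[mu]_(x in [set x | (0 <= u x)%R]) ((u x) ^+ 2)%:E <=
    (2 * n2 f + 2 * d ^+ 2 * n2 g0)%:E)%E.
Proof.
move=> Lf iu uE d0.
have mu_ : measurable_fun setT u by apply/measurable_EFinP; exact: measurable_int iu.
pose F (n : nat) := u @^-1` `[n%:R * d, n.+1%:R * d[%classic : set (borelC R).
have mF n : measurable (F n).
  by rewrite -[F n]setTI; apply: mu_ => //; exact: measurable_itv.
have FE : [set x | 0 <= u x] = \bigcup_n F n.
  apply/seteqP; split=> [x /= u0|x [n _]]; last first.
    rewrite /F /= in_itv /= => /andP[h _]; apply: le_trans h.
    by rewrite mulr_ge0 // ltW.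
  exists (Num.truncn (u x / d)) => //; rewrite /F /= in_itv /=.
  rewrite -ler_pdivlMr // -ltr_pdivrMr //; apply: truncn_itv.
  by rewrite divr_ge0 // ltW.
have tF : trivIset setT F.
  apply/trivIsetP => i j _ _ ij; apply/seteqP; split=> // x [].
  rewrite /F /= !in_itv /= => /andP[a1 a2] /andP[b1 b2].
  have := le_lt_trans a1 b2; have := le_lt_trans b1 a2.
  rewrite !ltr_pM2r // !ltr_nat !ltnS => h1 h2.
  by move: ij; rewrite eqn_leq h1 h2.
have mu2 : measurable_fun setT (fun x => (u x ^+ 2)%:E).
  by apply/measurable_EFinP; exact: measurable_funX.
rewrite FE ge0_integral_bigcup //; first last.
- by move=> x _; rewrite lee_fin sqr_ge0.
- exact: measurable_funS mu2.
have step n : (\int[mu]_(x in F n) (u x ^+ 2)%:E <=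
    2%:E * pvm_measure E Lf (F n) + (2 * d ^+ 2)%:E * mu (F n))%E.
  apply: (@le_trans _ _ ((((n.+1%:R * d) ^+ 2)%:E * mu (F n)))%E).
    rewrite -integral_cst //; apply: ge0_le_integral => //.
    - by move=> x _; rewrite lee_fin sqr_ge0.
    - exact: measurable_funS mu2.
    - move=> x; rewrite /F /= in_itv /= => /andP[a1 /ltW a2]; rewrite lee_fin.
      have a0 : 0 <= u x by apply: le_trans a1; rewrite mulr_ge0 // ltW.
      by rewrite ler_pXn2r // nnegrE (le_trans a0).
  have h := @slice_bound f u (F n) (n%:R * d) Lf iu uE (mF n).
  have {}h : (n%:R * d) ^+ 2 * n2 (E (F n) g0) <= n2 (E (F n) f).
    apply: h; first by rewrite mulr_ge0 // ltW.
    by move=> x; rewrite /F /= in_itv /= => /andP[].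
  rewrite !pvm_measureE // -!EFinM -EFinD lee_fin.
  have g1 := n2_ge0 (E (F n) g0).
  (* (n + 1)^2 <= 2 n^2 + 2 since (n - 1)^2 >= 0; both factors 2 of the estimate come from here. *)
  have := mulr_ge0 g1 (sqr_ge0 (n%:R * d - d)); move: h; rewrite -natr1.
  move: (n2 _) (n2 _) g1 => v w; move: (n%:R : R) => k; nra.
apply: le_trans; first apply: lee_nneseries => // n _.
- by move=> _; apply: integral_ge0 => x _; rewrite lee_fin sqr_ge0.
- exact: step.
rewrite nneseriesD; first last.
- by move=> n _ _; rewrite mule_ge0 // lee_fin mulr_ge0 // sqr_ge0.
- by move=> n _ _; rewrite mule_ge0 // lee_fin.
rewrite !nneseriesZl //.
have bc (m : {measure set (borelC R) -> \bar R}) :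
    (\sum_(0 <= i <oo) m (F i))%E = m (\bigcup_n F n).
  by rewrite measure_bigcup //; apply: eq_eseriesl => i; rewrite mem_set.
have mU : measurable (\bigcup_n F n) by exact: bigcupT_measurable.
have bE k (Lk : L2 k) : (\sum_(0 <= i <oo) pvm_measure E Lk (F i))%E =
    (n2 (E (\bigcup_n F n) k))%:E.
  by rewrite -(pvm_measureE E Lk) //; exact: bc.
rewrite !bE -!EFinM -EFinD lee_fin lerD //.
  by rewrite ler_wpM2l // pvm_le.
by rewrite ler_wpM2l ?pvm_le // mulr_ge0 // sqr_ge0.
Qed.

(** [half_bound] is used for [u] and for [- u], the density belonging to [- f], whence 2 + 2 = 4;
    the mesh [d] can be taken arbitrarily small. *)
Let full_bound f (u : borelC R -> R) : L2 f ->
  mu.-integrable setT (EFin \o u) ->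
  (forall B, measurable B -> (\int[mu]_(x in B) (u x)%:E)%E = (Re (inner g0 (E B f)))%:E) ->
  (\int[mu]_x ((u x) ^+ 2)%:E <= (4 * n2 f)%:E)%E.
Proof.
move=> Lf iu uE; apply/lee_addgt0Pr => e e0; rewrite -EFinD.
have mu_ : measurable_fun setT u by apply/measurable_EFinP; exact: measurable_int iu.
have mu2 : measurable_fun setT (fun x => (u x ^+ 2)%:E).
  by apply/measurable_EFinP; exact: measurable_funX.
(* The two mesh errors add up to [4 * d ^+ 2 * n2 g0], which the choice of [d] makes at most [e];
   the [+ 1] avoids dividing by 0 when [g0] is null. *)
pose c := 4 * n2 g0 + 1.
have c0 : 0 < c by rewrite ltr_wpDl // mulr_ge0 // n2_ge0.
pose d := Num.sqrt (e / c).
have d0 : 0 < d by rewrite sqrtr_gt0 divr_gt0.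
have d2 : 4 * d ^+ 2 * n2 g0 <= e.
  rewrite sqr_sqrtr ?(ltW (divr_gt0 e0 c0)) //.
  rewrite mulrAC mulrC mulrAC ler_pdivrMr // ler_pM2l // /c.
  by rewrite lerDl.
pose v x := - u x.
have Lv := L2_lin (-1) Lf (L2_0 X).
have iv : mu.-integrable setT (EFin \o v) by exact: (integrableN iu).
have vE B : measurable B -> (\int[mu]_(x in B) (v x)%:E)%E =
    (Re (inner g0 (E B (lin (-1) f (fun=> 0)))))%:E.
  move=> mB; have bB := pvm_bounded E mB.
  rewrite (inner_bounded_scale (-1) bB Lf Lg0) mulN1r ReN EFinN -uE //.
  rewrite -integralN //; apply: integrable_add_def => //.
  exact: (integrableS measurableT).
have n2v : n2 (lin (-1) f (fun=> 0)) = n2 f.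
  by rewrite n2_lin //; [rewrite inner0r mulr0 n2_0 cmodN cmod_real normr1 /=; ring|exact: L2_0].
have mP : measurable [set x | 0 <= u x].
  rewrite (_ : [set _ | _] = setT `&` u @^-1` `[0, +oo[%classic).
    by apply: mu_ => //; exact: measurable_itv.
  by rewrite setTI; apply/seteqP; split => x /=; rewrite in_itv /= andbT.
have mN : measurable [set x | 0 <= v x].
  rewrite (_ : [set _ | _] = setT `&` u @^-1` `]-oo, 0]%classic).
    by apply: mu_ => //; exact: measurable_itv.
  by rewrite setTI; apply/seteqP; split => x /=; rewrite in_itv /= /v oppr_ge0.
have := half_bound Lv iv vE d0.
have := half_bound Lf iu uE d0; rewrite n2v => h1 h2.
have := leeD h1 h2.
rewrite -(setvU [set x | 0 <= u x]) ge0_integral_setU //; first last.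
- by rewrite disj_set2E setICl.
- by move=> x _; rewrite lee_fin sqr_ge0.
- by rewrite setvU.
- exact: measurableC.
move=> h; apply: le_trans (le_trans _ h) _; last first.
  by rewrite -EFinD lee_fin; lra.
rewrite addeC leeD2l //.
under [in leRHS]eq_integral do rewrite /v sqrrN.
apply: ge0_subset_integral => //; first exact: measurableC.
- exact: measurable_funS mu2.
- by move=> x _; rewrite lee_fin sqr_ge0.
- by move=> x /= /negP; rewrite -ltNge /v oppr_ge0 => /ltW.
Qed.

Local Notation Y := (circle_space mu).

(** The constant 8 is 4 for the real part plus 4 for the imaginary part. It is not sharp, but
    boundedness is all that is needed to obtain an adjoint. *)
Lemma pvm_density f : L2 f -> exists psi : vec Y,
  [/\ cintegrable mu setT psi, L2 psi, n2 psi <= 8 * n2 f &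
    forall B, measurable B -> cint mu B psi = inner g0 (E B f)].
Proof.
move=> Lf; have mU := @measurable_unit_circle R.
have [u [iu uE]] := pvm_density_Re Lf.
pose fi := lin (- 'i%C) f (fun=> 0).
have Lfi : L2 fi by apply: L2_lin => //; exact: L2_0.
have [v [iv vE]] := pvm_density_Re Lfi.
have n2i : n2 fi = n2 f.
  rewrite n2_lin //; last exact: L2_0.
  rewrite inner0r mulr0 n2_0 sqr_cmod !complexReIm /=; ring.
have hu := full_bound Lf iu uE; have := full_bound Lfi iv vE; rewrite n2i => hv.
have mu_ : measurable_fun setT u by apply/measurable_EFinP; exact: measurable_int iu.
have mv_ : measurable_fun setT v by apply/measurable_EFinP; exact: measurable_int iv.
pose psi : vec Y := fun x => (u x +i* v x)%C.
have m2 (w : borelC R -> R) : measurable_fun setT w ->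
    measurable_fun setT (fun x => (w x ^+ 2)%:E).
  by move=> mw; apply/measurable_EFinP; exact: measurable_funX.
have bnd : (\int[smeas Y]_(x in sdom Y) (cmod (psi x) ^+ 2)%:E <= (8 * n2 f)%:E)%E.
  under eq_integral do rewrite sqr_cmod EFinD.
  rewrite ge0_integralD //=; first last.
  - by apply: measurable_funS (m2 _ mv_).
  - by move=> x _; rewrite lee_fin sqr_ge0.
  - by apply: measurable_funS (m2 _ mu_).
  - by move=> x _; rewrite lee_fin sqr_ge0.
  have sub (w : borelC R -> R) : measurable_fun setT w ->
      (\int[mu]_(x in unit_circle R) (w x ^+ 2)%:E <= \int[mu]_x (w x ^+ 2)%:E)%E.
    move=> mw; apply: ge0_subset_integral => //; first exact: m2.
    by move=> x _; rewrite lee_fin sqr_ge0.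
  apply: le_trans (leeD (le_trans (sub _ mu_) hu) (le_trans (sub _ mv_) hv)) _.
  by rewrite -EFinD lee_fin; lra.
have Lpsi : L2 psi.
  split; [exact: measurable_funS mu_|exact: measurable_funS mv_|].
  exact: le_lt_trans bnd (ltry _).
exists psi; split => //; first by rewrite -lee_fin n2_integral.
move=> B mB; have bB := pvm_bounded E mB.
apply: complexP; rewrite [LHS]/= /Rintegral.
  by rewrite uE.
rewrite vE // (inner_bounded_scale _ bB Lf Lg0).
by move: (inner _ _) => w; rewrite !complexReIm /=; ring.
Qed.

End cyclic_density.

(** * The unitary map onto L^2(mu) and the functional calculus *)

Section spectral_representation.
Context (R : realType) (X : mspace R) (E : pvm X) (g0 : vec X) (Lg0 : L2 g0).
Implicit Types (f : vec X) (B C : set (borelC R)).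

Local Notation mu := (pvm_measure E Lg0).
Local Notation Y := (circle_space mu).
Local Notation indY := (@ind R Y).
Local Notation mulY := (@mulop R Y).

Let fin_mu B : measurable B -> (mu B < +oo)%E.
Proof. by move=> mB; rewrite pvm_measureE // ltry. Qed.

Let mU : measurable (unit_circle R : set (borelC R)).
Proof. exact: measurable_unit_circle. Qed.

Lemma L2_circle_ind B : measurable B -> L2 (indY B).
Proof. by move=> mB; apply: L2_ind => //; apply: fin_mu; exact: measurableI. Qed.

Lemma inner_ind (psi : vec Y) B : measurable B ->
  inner (indY B) psi = cint mu (B `&` unit_circle R) psi.
Proof.
move=> mB; rewrite /inner /cint; congr Complex; rewrite Rintegral_mkcondl;
  apply: eq_Rintegral => x _; rewrite patchE indE rmorph_nat;
  by case: (_ \in _); rewrite ?mul1r ?mul0r.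
Qed.

(** Pairing with indicators yields the integrals over all Borel subsets of the circle, and
    integrable functions with equal integrals there agree almost everywhere. *)
Lemma inner_ind_inj (psi psi' : vec Y) : L2 psi -> L2 psi' ->
  (forall B, measurable B -> inner (indY B) psi = inner (indY B) psi') -> veq psi psi'.
Proof.
move=> L L' H.
have L1 : L2 (indY setT) by exact: L2_circle_ind.
have ci (k : vec Y) : L2 k -> cintegrable mu (unit_circle R) k.
  move=> Lk; have [h1 h2] := L2_cint L1 Lk.
  split; [apply: eq_integrable h1 => //|apply: eq_integrable h2 => //] => x _ /=;
  by rewrite indE in_setT rmorph1 mul1r.
have [i1 i2] := ci _ L; have [j1 j2] := ci _ L'.
have E1 B : B `<=` unit_circle R -> measurable B -> cint mu B psi = cint mu B psi'.
  by move=> BU mB; have := H _ mB; rewrite !inner_ind // (setIidl BU).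
have EQ (h k : borelC R -> R) : mu.-integrable (unit_circle R) (EFin \o h) ->
    mu.-integrable (unit_circle R) (EFin \o k) ->
    (forall B, B `<=` unit_circle R -> measurable B ->
      \int[mu]_(x in B) h x = \int[mu]_(x in B) k x) ->
    ae_eq mu (unit_circle R) (EFin \o h) (EFin \o k).
  move=> ih ik hk; apply: integral_ae_eq => //; first exact: measurable_int ik.
  move=> B BU mB.
  have f1 : (\int[mu]_(x in B) (EFin \o h) x)%E \is a fin_num.
    by apply: integrable_fin_num => //; exact: integrableS ih.
  have f2 : (\int[mu]_(x in B) (EFin \o k) x)%E \is a fin_num.
    by apply: integrable_fin_num => //; exact: integrableS ik.
  by rewrite -(fineK f1) -(fineK f2); congr EFin; exact: hk.
have a1 : ae_eq mu (unit_circle R) (EFin \o (Re \o psi)) (EFin \o (Re \o psi')).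
  by apply: EQ => // B BU mB; have [] := E1 B BU mB.
have a2 : ae_eq mu (unit_circle R) (EFin \o (Im \o psi)) (EFin \o (Im \o psi')).
  by apply: EQ => // B BU mB; have [] := E1 B BU mB.
apply: filterS2 a1 a2 => x /= h1 h2 Dx.
by apply: complexP; [have [] := h1 Dx|have [] := h2 Dx].
Qed.

Hypothesis cyclic_g0 : forall f, L2 f ->
  (forall B, measurable B -> inner g0 (E B f) = 0) -> veq f (fun=> 0).

Hypothesis has_adjoint : forall V : vec X -> vec Y, bounded_op V ->
  exists2 T : vec Y -> vec X, bounded_op T &
    forall f h, L2 f -> L2 h -> inner (V f) h = inner f (T h).

(** Everything about [V] is checked against indicators. With the adjoint [T], (1_B, V T h) = (g0,
    E(B) T h) = (V E(B) g0, h) = (1_B, h), so V T is the identity. Cyclicity enters only for T V: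
    the vector T V f - f is annihilated by [V], hence orthogonal to every E(B) g0. *)
Lemma spectral_representation : exists V T,
  [/\ unitary_pair V T,
    forall B f, measurable B -> L2 f -> veq (V (E B f)) (mulY (indY B) (V f)) &
    forall B, measurable B -> veq (V (E B g0)) (indY B)].
Proof.
pose P f (psi : vec Y) := L2 psi /\ n2 psi <= 8 * n2 f /\
  forall B, measurable B -> inner (indY B) psi = inner g0 (E B f).
have exP f : L2 f -> exists psi, P f psi.
  move=> Lf; have [psi [_ Lpsi npsi psiE]] := pvm_density E Lg0 Lf.
  exists psi; split => //; split => // B mB.
  have mBU := measurableI _ _ mB mU.
  rewrite inner_ind // psiE //; apply: inner_veq => //; [exact: pvm_L2..|].
  apply: veq_trans (pvm_setI E mB mU Lf) _.
  by apply: (bounded_veq (pvm_bounded E mB)) => //; [exact: pvm_L2|exact: pvm_circle].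
(* Densities are unique only almost everywhere, so one is chosen for each [f]; the default is
   reached only outside [L2]. *)
pose V f : vec Y := xget (fun=> 0) (P f).
have VP f : L2 f -> P f (V f) by move=> Lf; exact: (xgetPex _ (exP _ Lf)).
clearbody V.
have LV f : L2 f -> L2 (V f) by move=> /VP[].
have VE B f : measurable B -> L2 f -> inner (indY B) (V f) = inner g0 (E B f).
  by move=> mB /VP[_ [_]]; exact.
have LE B f : measurable B -> L2 f -> L2 (E B f) by exact: pvm_L2.
have bV : bounded_op V.
  apply: bounded_opP => //; last by exists 8 => f /VP[_ []].
  move=> c f g Lf Lg; apply: inner_ind_inj => [||B mB].
  - by apply: LV; exact: L2_lin.
  - by apply: L2_lin; exact: LV.
  have LB := L2_circle_ind mB; rewrite (inner_linr c LB (LV _ Lf) (LV _ Lg)).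
  rewrite !VE //; last exact: L2_lin.
  exact: (inner_bounded_lin c (pvm_bounded E mB) Lf Lg Lg0).
have LM B (psi : vec Y) : measurable B -> L2 psi -> L2 (mulY (indY B) psi).
  by move=> mB; apply: L2_mul_ind.
have indM B C (psi : vec Y) : measurable B -> measurable C ->
    inner (indY B) (mulY (indY C) psi) = inner (indY (B `&` C)) psi.
  move=> mB mC; apply: eq_cint => x _; rewrite /mulop !indE in_setI !rmorph_nat -mulnb natrM.
  by rewrite mulrA.
have VEB B f : measurable B -> L2 f -> veq (V (E B f)) (mulY (indY B) (V f)).
  move=> mB Lf; apply: inner_ind_inj => [||C mC].
  - exact/LV/LE.
  - exact/LM/LV.
  have mCB := measurableI _ _ mC mB.
  rewrite (indM C B _ mC mB) (VE _ _ mCB Lf) (VE _ _ mC (LE _ _ mB Lf)).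
  exact: (inner_veq Lg0 (LE _ _ mC (LE _ _ mB Lf)) (LE _ _ mCB Lf)
    (veq_sym (pvm_setI E mC mB Lf))).
have Vg0 B : measurable B -> veq (V (E B g0)) (indY B).
  move=> mB; apply: veq_trans (VEB _ _ mB Lg0) _.
  have LB := L2_circle_ind mB.
  apply: inner_ind_inj => // [|C mC]; first exact/LM/LV.
  have mCB := measurableI _ _ mC mB.
  rewrite (indM C B _ mC mB) (VE _ _ mCB Lg0) pvm_inner_n2 //.
  rewrite (_ : indY B = mulY (indY B) (indY setT)); last first.
    by apply/funext => x; rewrite /mulop [indY setT x]indE in_setT mulr1.
  rewrite (indM C B _ mC mB); have LT : L2 (indY setT) by exact: L2_circle_ind.
  rewrite (_ : inner _ _ = inner (indY (C `&` B)) (indY (C `&` B))); last first.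
    apply: eq_cint => x _; rewrite !indE in_setT rmorph_nat.
    by case: (_ \in _); rewrite ?mul0r.
  rewrite innerE; congr (_%:C)%C; apply: EFin_inj.
  rewrite n2_ind //; last by apply: fin_mu; exact: measurableI.
  have mCBU := measurableI _ _ mCB mU.
  rewrite [RHS]pvm_measureE //; congr EFin; apply: n2_veq; [exact: LE..|].
  apply: veq_sym; apply: veq_trans (pvm_setI E mCB mU Lg0) _.
  by apply: (bounded_veq (pvm_bounded E mCB)) => //; [exact: LE|exact: pvm_circle].
have [T bT VT] := has_adjoint bV.
have LT h : L2 h -> L2 (T h) by exact: (bounded_L2 bT).
have VTh h : L2 h -> veq (V (T h)) h.
  move=> Lh; apply: inner_ind_inj => // [|B mB]; first exact/LV/LT.
  have LB := L2_circle_ind mB.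
  rewrite (VE _ _ mB (LT _ Lh)) (pvm_selfadjoint E mB Lg0 (LT _ Lh)).
  rewrite -(VT _ _ (LE _ _ mB Lg0) Lh).
  by apply: inner_veql => //; [exact/LV/LE|exact: Vg0].
exists V, T; split => //; split => // f Lf.
have LVf := LV _ Lf; have Ld := L2_lin (-1) (LT _ LVf) Lf.
have := cyclic_g0 Ld; have h0 B : measurable B ->
    inner g0 (E B (lin (-1) (T (V f)) f)) = 0.
  move=> mB; rewrite (inner_bounded_lin (-1) (pvm_bounded E mB) (LT _ LVf) Lf Lg0).
  rewrite -(VE _ _ mB (LT _ LVf)) -(VE _ _ mB Lf).
  rewrite (inner_veq (L2_circle_ind mB) (LV _ (LT _ LVf)) LVf (VTh _ LVf)).
  by rewrite mulN1r addNr.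
move=> /(_ h0); apply: filterS => x h Dx; apply/eqP.
by rewrite eq_sym -subr_eq0 addrC -[- T _ _]mulN1r; apply/eqP/h.
Qed.

End spectral_representation.

Section functional_calculus_multiplication.
Context (R : realType) (X : mspace R) (E : pvm X) (g0 : vec X) (Lg0 : L2 g0).
Local Notation mu := (pvm_measure E Lg0).
Local Notation Y := (circle_space mu).
Local Notation indY := (@ind R Y).
Local Notation mulY := (@mulop R Y).
Context (V : vec X -> vec Y) (T : vec Y -> vec X).
Hypothesis VT : unitary_pair V T.
Hypothesis VE : forall (B : set (borelC R)) f, measurable B -> L2 f ->
  veq (V (E B f)) (mulY (indY B) (V f)).
Context (phi : R[i] -> R[i]).
Hypothesis hphi : cbounded_measurable (unit_circle R : set (borelC R)) phi.

(** The scalar measure of [f] has density |V f|^2 with respect to [mu], because the norm of E(B) f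
    is that of 1_B V f; the rest is a change of variables. *)
Lemma cint_pvm_measure f (Lf : L2 f) :
  cint (pvm_measure E Lf) (unit_circle R) phi =
  cint mu (unit_circle R) (fun x => phi x * (cmod (V f x) ^+ 2)%:C%C).
Proof.
have [bV _ _ _ _] := VT; have mU := @measurable_unit_circle R.
have LVf := bounded_L2 bV Lf.
have mV : cmeasurable (unit_circle R : set (borelC R)) (V f) by case: LVf.
have mw : measurable_fun (unit_circle R : set (borelC R)) (fun x => cmod (V f x) ^+ 2).
  exact: measurable_sqr_cmod.
pose w x := (cmod (V f x) ^+ 2)%:E.
have nuE (B : set (borelC R)) : measurable B ->
    pvm_measure E Lf B = (\int[mu]_(x in B `&` unit_circle R) w x)%E.
  move=> mB; rewrite pvm_measureE //; have LB := pvm_L2 E mB Lf.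
  have LM : L2 (mulY (indY B) (V f)) by exact: L2_mul_ind.
  have -> : n2 (E B f) = n2 (mulY (indY B) (V f)).
    rewrite -(n2_veq (bounded_L2 bV LB) LM (VE mB Lf)).
    by rewrite /n2 (unitary_pair_inner VT).
  rewrite n2_integral //= setIC integral_mkcondr; apply: eq_integral => x _.
  rewrite /mulop cmodM exprMn sqr_cmod_ind patchE indicE.
  by case: (_ \in _); rewrite ?mul1r ?mul0r.
have dom : pvm_measure E Lf `<< mu.
  move=> N N0 A mA AN; rewrite nuE //.
  have mAU := measurableI _ _ mA mU.
  apply: null_set_integral => //.
    by apply/measurable_EFinP; apply: measurable_funS mw => // ? [].
  by apply: N0 => // x [/AN].
pose rn := Radon_Nikodym (charge_of_finite_measure (pvm_measure E Lf)) mu.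
have irn : mu.-integrable setT rn by exact: Radon_Nikodym_integrable.
have mrn : measurable_fun (unit_circle R : set (borelC R)) rn.
  exact: measurable_funS (measurable_int _ irn).
have aew : ae_eq mu (unit_circle R) rn w.
  apply: integral_ae_eq => //.
  - exact: integrableS irn.
  - exact/measurable_EFinP.
  - move=> B BU mB; rewrite -[in RHS](setIidl BU) -nuE //; apply: esym.
    exact: (@Radon_Nikodym_integral _ _ _
      (charge_of_finite_measure (pvm_measure E Lf)) _ _ dom mB).
have fU : (pvm_measure E Lf (unit_circle R) < +oo)%E by rewrite pvm_measureE // ltry.
have [i1 i2] := cbounded_cintegrable fU mU hphi; have [[m1 m2] _] := hphi.
have main (h : R[i] -> R) : (pvm_measure E Lf).-integrable (unit_circle R) (EFin \o h) ->
    measurable_fun (unit_circle R : set (borelC R)) h ->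
    \int[pvm_measure E Lf]_(x in unit_circle R) h x =
    \int[mu]_(x in unit_circle R) (h x * cmod (V f x) ^+ 2).
  move=> ih mh; rewrite /Rintegral; apply: (congr1 fine).
  apply: etrans (esym (Radon_Nikodym_change_of_variables dom mU ih)) _.
  apply: ae_eq_integral => //.
  - by apply: emeasurable_funM => //; exact/measurable_EFinP.
  - by apply/measurable_EFinP; exact: measurable_funM.
  - by apply: filterS aew => x hx Dx; rewrite -/rn hx.
apply: complexP => /=; rewrite main //; apply: eq_Rintegral => x _;
  by rewrite !complexReIm /=; ring.
Qed.

(** Besides computing phi(U), this is the existence statement without which the [get] in
    [functional_calculus] would carry no information. *)
Lemma spectral_integral_conj : is_spectral_integral E phi (T \o mulY phi \o V).
Proof.
have [bV bT VTa _ _] := VT; have bM : bounded_op (mulY phi).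
  exact: bounded_mulop.
split=> [|f Lf]; first exact: (bounded_comp bV (bounded_comp bM bT)).
have LVf := bounded_L2 bV Lf; have LM := bounded_L2 bM LVf.
transitivity (inner (V f) (mulY phi (V f))); first exact/esym/VTa.
rewrite cint_pvm_measure; apply: eq_cint => x _.
by rewrite /mulop mulrCA mulJc.
Qed.

Lemma spectral_integral_mulop A : is_spectral_integral E phi A ->
  forall f, L2 f -> veq (V (A f)) (mulY phi (V f)).
Proof.
move=> [bA AE] f Lf; have [bV bT VTa _ VTh] := VT.
have [bA0 A0E] := spectral_integral_conj.
have LVf := bounded_L2 bV Lf.
have bM : bounded_op (mulY phi) by exact: bounded_mulop.
have LM := bounded_L2 bM LVf.
apply: veq_trans (VTh _ LM); apply: (bounded_veq bV (bounded_L2 bA Lf)).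
  exact: bounded_L2 bT _.
by apply: (polarization bA bA0) => // k Lk; rewrite (AE _ Lk) (A0E _ Lk).
Qed.

Lemma functional_calculusP : is_spectral_integral E phi (functional_calculus E phi).
Proof.
rewrite /functional_calculus.
by apply: (getPex (ex_intro _ _ spectral_integral_conj)).
Qed.

End functional_calculus_multiplication.

(** * Coordinates, truncation and adjoints on the half-lattice *)

Section ell2_facts.
Context (R : realType) (s : side) (k0 : int).
Local Notation H := (half_lattice s k0).
Local Notation X := (ell2 R s k0).
Implicit Types (f g : vec X) (k : int) (t : seq int).

Lemma counting1 k : @counting int R [set k] = 1%E.
Proof. by rewrite /counting asboolT // fset_set1 finmap.cardfs1. Qed.

Lemma L2_ind_fin (A : set int) : finite_set A -> L2 (@ind R X A).
Proof.
move=> fA; apply: L2_ind => //=.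
apply: (@le_lt_trans _ _ (@counting int R A)).
  by rewrite le_measure ?inE //; exact: subIsetl.
by rewrite /counting asboolT // ltry.
Qed.

Local Notation dl k := (@ind R X [set k]).

Lemma L2_dl k : L2 (dl k).
Proof. exact: L2_ind_fin. Qed.

Lemma dlE k j : dl k j = (j == k)%:R.
Proof.
rewrite indE; case: (eqVneq j k) => [->|jk]; first by rewrite mem_set.
by rewrite memNset //; apply/eqP.
Qed.

Lemma Rintegral_single (h : int -> R) k : H k -> (forall j, j != k -> h j = 0) ->
  \int[@counting int R]_(x in H) h x = h k.
Proof.
move=> Hk h0; have mH : measurable H by [].
have Ik : [set k] `&` H = [set k] by apply/setIidPl => _ ->.
have ik : (@counting int R).-integrable H (EFin \o \1_[set k]).
  apply/integrableP; split => //.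
  under eq_integral do rewrite /= ger0_norm //.
  by rewrite integral_indic // Ik [X in (X < _)%E]counting1 ltry.
have -> : h = (fun x => h k * \1_[set k] x).
  apply/funext => j; rewrite indicE; case: (eqVneq j k) => [->|jk].
    by rewrite mem_set // mulr1.
  by rewrite memNset ?mulr0 ?h0 //=; apply/eqP.
rewrite RintegralZl // indicE mem_set // /Rintegral.
by rewrite integral_indic // Ik [X in fine X]counting1 mulr1.
Qed.

Lemma inner_dl k f : inner (dl k) f = if `[< H k >] then f k else 0.
Proof.
case: asboolP => Hk; last first.
  rewrite -(inner0l f); apply: eq_cint => x; rewrite inE => Hx.
  by rewrite dlE; case: eqP => // xk; case: Hk; rewrite -xk.
apply: complexP; rewrite /inner /cint /=.
  rewrite (@Rintegral_single _ k) // => [|j jk].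
    by rewrite dlE eqxx rmorph1 mul1r.
  by rewrite dlE (negbTE jk) rmorph0 mul0r.
rewrite (@Rintegral_single _ k) // => [|j jk].
  by rewrite dlE eqxx rmorph1 mul1r.
by rewrite dlE (negbTE jk) rmorph0 mul0r.
Qed.

Definition trunc t f : vec X := fun k => if k \in t then f k else 0.

Lemma trunc_cons a t f : a \notin t -> trunc (a :: t) f = lin (f a) (dl a) (trunc t f).
Proof.
move=> at_; apply/funext => k; rewrite /trunc /lin dlE in_cons.
case: eqVneq => [->|_] /=; last by rewrite mulr0 add0r.
by rewrite (negbTE at_) mulr1 addr0.
Qed.

Lemma trunc_consN a t f : a \in t -> trunc (a :: t) f = trunc t f.
Proof.
move=> at_; apply/funext => k; rewrite /trunc in_cons.
by case: eqVneq => [->|//]; rewrite at_.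
Qed.

Lemma L2_trunc t f : L2 (trunc t f).
Proof.
elim: t => [|a t IH]; first exact: L2_0.
have [h|h] := boolP (a \in t); first by rewrite trunc_consN.
by rewrite trunc_cons //; apply: L2_lin => //; exact: L2_dl.
Qed.

(** Finite sets exhausting the integers along their enumeration by [pickle], the same for both
    half-lattices; numbers that code no integer are dropped by [pmap]. *)
Definition window (n : nat) : seq int := pmap (unpickle : nat -> option int) (iota 0 n).

Lemma mem_window n k : (pickle k < n)%N -> k \in window n.
Proof.
move=> kn; rewrite mem_pmap; apply/mapP; exists (pickle k).
  by rewrite mem_iota.
by rewrite pickleK.
Qed.

Lemma sub_window m n : (m <= n)%N -> {subset window m <= window n}.
Proof.
move=> mn k; rewrite !mem_pmap => /mapP[i im ik]; apply/mapP; exists i => //.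
by move: im; rewrite !mem_iota /= !add0n => /leq_trans; exact.
Qed.

(** Monotone convergence along the windows. It serves to show that the coordinatewise adjoint takes
    its values in [L2]. *)
Lemma L2_trunc_bound f (C : R) : (forall n, n2 (trunc (window n) f) <= C) ->
  L2 f /\ n2 f <= C.
Proof.
move=> fC; have mH : measurable H by [].
pose F n k := (cmod (trunc (window n) f k) ^+ 2)%:E.
have le : (\int[@counting int R]_(k in H) (cmod (f k) ^+ 2)%:E <= C%:E)%E.
  have -> : (\int[@counting int R]_(k in H) (cmod (f k) ^+ 2)%:E =
    \int[@counting int R]_(k in H) limn (F ^~ k))%E.
    apply: eq_integral => k _; apply/esym/lim_near_cst => //.
    near=> n; rewrite /F /trunc mem_window //; near: n.
    by exists (pickle k).+1.
  rewrite monotone_convergence //.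
  - apply: lime_le.
      apply: ereal_nondecreasing_is_cvgn => m n mn.
      apply: ge0_le_integral => //.
      + by move=> k _; rewrite lee_fin sqr_ge0.
      + move=> k _; rewrite /F lee_fin /trunc; have := sub_window mn (x := k).
        case: (k \in window m) => [->//|_].
        by rewrite cmod0 expr0n /= sqr_ge0.
    near=> n; rewrite -(n2_integral (L2_trunc (window n) f)) lee_fin; exact: fC.
  - by move=> n k _; rewrite lee_fin sqr_ge0.
  - move=> k _ m n mn; rewrite /F lee_fin /trunc; have := sub_window mn (x := k).
    case: (k \in window m) => [->//|_].
    by rewrite cmod0 expr0n /= sqr_ge0.
have Lf : L2 f by split => //; exact: le_lt_trans le (ltry _).
by split => //; rewrite -lee_fin n2_integral.
Unshelve. all: by end_near.
Qed.

Lemma trunc_dense f (e : R) : L2 f -> 0 < e ->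
  exists n, n2 (lin (-1) (trunc (window n) f) f) < e.
Proof.
move=> Lf e0; have mH : measurable H by [].
pose F n k := (cmod (lin (-1) (trunc (window n) f) f k) ^+ 2)%:E.
pose G k := (cmod (f k) ^+ 2)%:E.
have iG : (@counting int R).-integrable H G.
  apply/integrableP; split => //; case: Lf => _ _; apply: le_lt_trans.
  rewrite le_eqVlt; apply/orP; left; apply/eqP; apply: eq_integral => k _.
  by rewrite gee0_abs // lee_fin sqr_ge0.
have [//|//||//||_ _] := @dominated_convergence _ _ _ (@counting int R) H mH F (cst 0%E) G.
- apply: filterE => k _; apply: cvg_near_cst; near=> n.
  rewrite /F /lin /trunc mem_window; last by near: n; exists (pickle k).+1.
  by rewrite mulN1r addNr cmod0 expr0n.
- apply: filterE => k n _; rewrite /F /G /lin /trunc.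
  rewrite gee0_abs ?lee_fin ?sqr_ge0 //; case: (_ \in _).
    by rewrite mulN1r addNr cmod0 expr0n /= sqr_ge0.
  by rewrite mulr0 add0r.
rewrite integral0 => /fine_cvgP[_ /cvgrPdist_lt/(_ _ e0)][N _ /(_ N (leqnn N))].
rewrite /= sub0r normrN => h; exists N.
have Ld : L2 (lin (-1) (trunc (window N) f) f) by apply: L2_lin => //; exact: L2_trunc.
apply: le_lt_trans h; apply: le_trans (ler_norm _).
by rewrite /F -(n2_integral Ld).
Unshelve. all: by end_near.
Qed.

(** The coordinate of [T h] at k has to be (V delta_k, h). For a truncation g of [T h] this gives n2
    g = (V g, h), so Cauchy-Schwarz and the bound on [V] yield n2 g <= K n2 h, uniformly in the
    window. The adjoint relation passes from truncations of [f] to [f] by density. *)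
Lemma ell2_has_adjoint (Y : mspace R) (V : vec X -> vec Y) : bounded_op V ->
  exists2 T : vec Y -> vec X, bounded_op T &
    forall f h, L2 f -> L2 h -> inner (V f) h = inner f (T h).
Proof.
move=> bV; have LV f : L2 f -> L2 (V f) by exact: (bounded_L2 bV).
have [K K0 VK] := bounded_n2 bV.
pose T (h : vec Y) : vec X := fun k => inner (V (dl k)) h.
have TE h t t' f : L2 h -> {subset t <= t'} ->
    inner (V (trunc t f)) h = inner (trunc t f) (trunc t' (T h)).
  move=> Lh; have Lt' := L2_trunc t' (T h).
  elim: t => [|a t IH] tt'.
    rewrite (_ : trunc [::] f = fun=> 0) // inner0l.
    have L0 := L2_0 X.
    by rewrite (inner_veql Lh (LV _ L0) (L2_0 Y) (bounded_0 bV)) inner0l.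
  have {}IH := IH (fun k kt => tt' k (mem_behead (s := a :: t) kt)).
  have [h1|h1] := boolP (a \in t); first by rewrite trunc_consN.
  have Ld := L2_dl a; have Lt := L2_trunc t f.
  rewrite trunc_cons // (inner_linl _ Lt' Ld Lt).
  rewrite (inner_veql Lh (LV _ (L2_lin _ Ld Lt)) (L2_lin _ (LV _ Ld) (LV _ Lt))
    (bounded_lin _ bV Ld Lt)).
  rewrite (inner_linl _ Lh (LV _ Ld) (LV _ Lt)) IH; congr (_ * _ + _).
  rewrite inner_dl /trunc tt' ?mem_head //; case: asboolP => // Ha.
  (* A site outside the half-lattice carries a null vector, which [V] sends to a null vector. *)
  have d0 : veq (dl a) (fun=> 0).
    by apply: veq_eq => k Hk; rewrite dlE; case: eqP => // ka; case: Ha; rewrite -ka.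
  rewrite (inner_veql Lh (LV _ Ld) (LV _ (L2_0 X)) (bounded_veq bV Ld (L2_0 X) d0)).
  by rewrite (inner_veql Lh (LV _ (L2_0 X)) (L2_0 Y) (bounded_0 bV)) inner0l.
have Tb h : L2 h -> L2 (T h) /\ n2 (T h) <= K * n2 h.
  move=> Lh; apply: L2_trunc_bound => n; set g := trunc _ _.
  have Lg : L2 g by exact: L2_trunc.
  have := TE h _ _ (T h) Lh (fun k (kt : k \in window n) => kt); rewrite -/g => e.
  have := cauchy_schwarz (LV _ Lg) Lh; rewrite e innerE cmod_real.
  rewrite ger0_norm ?n2_ge0 // => h1.
  have := VK _ Lg; have := n2_ge0 h; have := n2_ge0 g => g0 h0 h2.
  have {}h1 : n2 g * n2 g <= n2 g * (K * n2 h).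
    rewrite -expr2; apply: le_trans h1 _.
    by rewrite mulrA [n2 g * K]mulrC ler_wpM2r.
  have [->|gn] := eqVneq (n2 g) 0; first by rewrite mulr_ge0.
  by rewrite -(ler_pM2l (_ : 0 < n2 g)) // lt_def gn g0.
exists T.
  apply: bounded_opP; first by move=> h /Tb[].
    move=> c h h' Lh Lh'; apply: veq_eq => k _.
    by rewrite /T inner_linr //; exact/LV/L2_dl.
  by exists K => h /Tb[].
move=> f h Lf Lh; have [LT TK] := Tb _ Lh.
pose D := inner (V f) h - inner f (T h).
suff : cmod D ^+ 2 = 0 by move=> /eqP; rewrite sqrf_eq0 cmod_eq0 subr_eq0 => /eqP.
(* By Cauchy-Schwarz |D|^2 is at most [4 * (K * n2 h)] times the squared truncation error; the [+ 1]
   allows division by [C]. *)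
pose C := 4 * (K * n2 h) + 1.
have Kh0 : 0 <= K * n2 h by rewrite mulr_ge0 // n2_ge0.
have C0 : 0 < C by rewrite /C; lra.
apply/le_anti; rewrite sqr_ge0 andbT; apply/ler_addgt0Pr => e e0; rewrite add0r.
have [n hn] := trunc_dense Lf (divr_gt0 e0 C0).
set g := trunc (window n) f in hn; have Lg : L2 g by exact: L2_trunc.
set d := lin (-1) g f in hn; have Ld : L2 d by exact: L2_lin.
have gE : inner (V g) h = inner g (T h).
  rewrite (TE h _ (window n)) //; apply: eq_cint => k _; rewrite /g /trunc.
  by case: (_ \in _); rewrite ?rmorph0 ?mul0r.
have DE : D = inner (V d) h - inner d (T h).
  rewrite (inner_veql Lh (LV _ Ld) (L2_lin _ (LV _ Lg) (LV _ Lf)) (bounded_lin _ bV Lg Lf)).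
  rewrite (inner_linl _ Lh (LV _ Lg) (LV _ Lf)) /d (inner_linl _ LT Lg Lf) gE /D; ring.
have b1 : cmod (inner (V d) h) ^+ 2 <= (K * n2 h) * n2 d.
  apply: le_trans (cauchy_schwarz (LV _ Ld) Lh) _.
  by rewrite mulrAC ler_wpM2r ?n2_ge0 // VK.
have b2 : cmod (inner d (T h)) ^+ 2 <= (K * n2 h) * n2 d.
  apply: le_trans (cauchy_schwarz Ld LT) _.
  by rewrite mulrC ler_wpM2r ?n2_ge0.
have b3 : cmod D ^+ 2 <= C * n2 d.
  have h1 : cmod D <= cmod (inner (V d) h) + cmod (inner d (T h)).
    by rewrite DE -[X in _ <= _ + X]cmodN cmodD.
  have h2 : cmod D ^+ 2 <= (cmod (inner (V d) h) + cmod (inner d (T h))) ^+ 2.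
    by rewrite ler_pXn2r // nnegrE ?addr_ge0 ?cmod_ge0.
  have := sqr_ge0 (cmod (inner (V d) h) - cmod (inner d (T h))).
  have := n2_ge0 d; rewrite /C; move: b1 b2 h2.
  move: (cmod (inner (V d) h)) (cmod (inner d (T h))) (cmod D) => x y z.
  move: (K * n2 h) (n2 d) => u v; lra.
apply: le_trans b3 _; apply: ltW.
by rewrite mulrC -ltr_pdivlMr.
Qed.

End ell2_facts.

(** * The block diagonal factors V and W on a half-lattice *)

Section cmv_factor_facts.
Context (R : realType) (s : side) (k0 : int).
Local Notation H := (half_lattice s k0).
Local Notation X := (ell2 R s k0).
Implicit Types (f g : vec X) (k : int) (b : bool) (c : int -> R[i]).

(** The blocks of a factor pair up the integers, and this is the other site of the block of [k]. The
    row of index [k] has just two entries, [cmv_diag] at [k] and [cmv_off] at the partner. *)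
Definition partner b k : int := if odd `|k|%N == b then k - 1 else k + 1.

Definition cmv_diag b c k : R[i] := if odd `|k|%N == b then (c k)^* else - c (k + 1).

Definition cmv_off b c k : R[i] := rho (c (if odd `|k|%N == b then k else k + 1)).

Lemma odd_abszD1 k : odd (absz (k + 1)) = ~~ odd (absz k).
Proof.
case: k => n; first by rewrite -PoszD /= addn1.
case: n => // n; have -> : Negz n.+1 + 1 = Negz n.
  by rewrite !NegzE -[n.+2]addn1 PoszD opprD addrNK.
by rewrite /= negbK.
Qed.

Lemma partner_parity b k :
  (odd (absz (partner b k)) == b) = ~~ (odd (absz k) == b).
Proof.
have oB : odd (absz (k - 1)) = ~~ odd (absz k).
  by rewrite -[in RHS](subrK 1 k) odd_abszD1 negbK.
rewrite /partner; case: ifPn => h; rewrite ?oB ?odd_abszD1.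
  by move: h; case: (odd _) b => [] [].
by move: h; case: (odd _) b => [] [].
Qed.

Lemma cmv_factorE b c (f : int -> R[i]) k :
  cmv_factor b c f k = cmv_diag b c k * f k + cmv_off b c k * f (partner b k).
Proof.
rewrite /cmv_factor /cmv_diag /cmv_off /partner.
case: (odd _ == b); rewrite ?eqxx !mxE //=; first by rewrite addrC.
have -> : (k == k + 1) = false by apply/eqP => /(congr1 (fun x => x - k)); rewrite subrr addrAC subrr.
by rewrite /= addrK.
Qed.

Lemma partnerK b k : partner b (partner b k) = k.
Proof.
rewrite {1}/partner partner_parity /partner; case: (odd _ == b) => /=.
  exact: subrK.
exact: addrK.
Qed.

Lemma cmv_off_partner b c k : cmv_off b c (partner b k) = cmv_off b c k.
Proof.
rewrite /cmv_off partner_parity /partner; case: (odd _ == b) => //=.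
by rewrite subrK.
Qed.

Definition cconj c : int -> R[i] := fun k => (c k)^*.

Lemma cmv_diag_conj b c k : cmv_diag b (cconj c) k = (cmv_diag b c k)^*.
Proof. by rewrite /cmv_diag /cconj; case: ifP => _ //; rewrite rmorphN. Qed.

Lemma cmv_off_conj b c k : cmv_off b (cconj c) k = cmv_off b c k.
Proof. by rewrite /cmv_off /rho cmodJ. Qed.

Lemma cmv_off_real b c k : (cmv_off b c k)^* = cmv_off b c k.
Proof. by rewrite /cmv_off /rho conj_real. Qed.

(** Orthogonality of the two columns of a block; with the normalization [cmv_diag_off] it makes the
    block unitary. *)
Lemma cmv_diag_cross b c k : (cmv_diag b c k)^* + cmv_diag b c (partner b k) = 0.
Proof.
rewrite /cmv_diag partner_parity /partner; case: (odd _ == b) => /=.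
  by rewrite subrK conjCK subrr.
by rewrite rmorphN addNr.
Qed.

Lemma cmv_diag_off b c k : (forall j, cmod (c j) <= 1) ->
  (cmv_diag b c k)^* * cmv_diag b c k + cmv_off b c k * cmv_off b c k = 1.
Proof.
move=> c1; rewrite mulJc /cmv_off /rho -rmorphM -rmorphD /= -expr2 sqr_sqrtr.
  rewrite /cmv_diag; case: ifP => _; rewrite ?cmodJ ?cmodN addrC subrK //.
by rewrite subr_ge0 expr_le1 // cmod_ge0.
Qed.

Lemma cmv_factorK b c (f : int -> R[i]) k : (forall j, cmod (c j) <= 1) ->
  cmv_factor b (cconj c) (cmv_factor b c f) k = f k.
Proof.
move=> c1; rewrite !cmv_factorE partnerK cmv_diag_conj cmv_off_conj.
rewrite cmv_off_partner -[RHS]mul1r -(cmv_diag_off b k c1).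
transitivity (((cmv_diag b c k)^* * cmv_diag b c k + cmv_off b c k * cmv_off b c k)
   * f k + cmv_off b c k * ((cmv_diag b c k)^* + cmv_diag b c (partner b k))
   * f (partner b k)); first by ring.
by rewrite cmv_diag_cross mulr0 mul0r addr0.
Qed.

Lemma cconjK c : cconj (cconj c) = c.
Proof. by apply/funext => k; rewrite /cconj conjCK. Qed.

Lemma cmod_cconj c : (forall j, cmod (c j) <= 1) -> forall j, cmod (cconj c j) <= 1.
Proof. by move=> c1 j; rewrite /cconj cmodJ. Qed.

Lemma counting_partner b (A : set int) :
  @counting int R (partner b @^-1` A) = @counting int R A.
Proof.
have pE (B : set int) : partner b @^-1` B = partner b @` B.
  apply/seteqP; split=> [k Bk|_ [k Bk <-]]; last by rewrite /preimage /= partnerK.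
  by exists (partner b k) => //; exact: partnerK.
have fin (B : set int) : finite_set B -> finite_set (partner b @^-1` B).
  by move=> fB; rewrite pE; exact: finite_image.
have pi : injective (partner b) by exact: (can_inj (@partnerK b)).
rewrite /counting; case: (pselect (finite_set A)) => fA.
  have fB := fin _ fA; rewrite !asboolT //; congr (_%:R%:E).
  by rewrite pE fset_set_image // finmap.card_imfset.
rewrite !asboolF // => fB; apply: fA; have := fin _ fB.
rewrite (_ : partner b @^-1` (partner b @^-1` A) = A) //.
by apply/seteqP; split => k; rewrite /preimage /= partnerK.
Qed.

(** The factors act on functions on all integers. When no entry links the half-lattice to its
    complement, their values on the half-lattice depend only on values there. *)
Definition decoupled c := forall b k, H k -> ~ H (partner b k) -> cmv_off b c k = 0.

(** The entries of a row have modulus at most 1, so |x + y|^2 <= 2 |x|^2 + 2 |y|^2 contributes 2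
    from each site and 2 from its partner. The sharp constant 1 follows once the adjoint is known to
    be the inverse. *)
Lemma L2_cmv_factor b c f : (forall j, cmod (c j) <= 1) -> decoupled c -> L2 f ->
  L2 (cmv_factor b c f : vec X) /\ n2 (cmv_factor b c f : vec X) <= 4 * n2 f.
Proof.
move=> c1 dc Lf; have mH : measurable H by [].
have mp : measurable_fun setT (partner b) by [].
have pos (h : int -> R[i]) k : (0 <= (cmod (h k) ^+ 2)%:E)%E by rewrite lee_fin sqr_ge0.
(* Extended by 0 to all integers, because [partner b] preserves the counting measure of the full
   lattice but may leave the half-lattice. *)
pose G k := if k \in H then (cmod (f k) ^+ 2)%:E else 0%E.
have G0 k : (0 <= G k)%E by rewrite /G; case: ifP.
have eG : (\int[@counting int R]_k G k = (n2 f)%:E)%E.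
  rewrite n2_integral // [RHS]integral_mkcond; apply: eq_integral => k _.
  by rewrite patchE.
have eGp : (\int[@counting int R]_k G (partner b k) = (n2 f)%:E)%E.
  rewrite -eG -[LHS](@ge0_integral_pushforward _ _ _ _ _ _ mp _ setT) //.
  apply: eq_measure_integral => A mA _; exact: counting_partner.
have le : (\int[@counting int R]_(k in H) (cmod (cmv_factor b c f k) ^+ 2)%:E
    <= (4 * n2 f)%:E)%E.
  apply: (@le_trans _ _ (\int[@counting int R]_k (2%:E * G k + 2%:E * G (partner b k)))%E).
    rewrite [leLHS]integral_mkcond; apply: ge0_le_integral => //.
    - by move=> k _; rewrite patchE; case: ifP.
    - move=> k _; rewrite patchE; case: ifPn => kH; last first.
        by rewrite adde_ge0 // mule_ge0.
      rewrite /G kH cmv_factorE.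
      have dgof := cmv_diag_off b k c1; rewrite mulJc in dgof.
      have ofE : cmv_off b c k * cmv_off b c k = (cmod (cmv_off b c k) ^+ 2)%:C%C.
        by rewrite -mulJc cmv_off_real.
      rewrite ofE -rmorphD /= in dgof; have {}dgof := complexI dgof.
      have le1 (z w : R[i]) : cmod z ^+ 2 <= 1 -> cmod (z * w) ^+ 2 <= cmod w ^+ 2.
        by move=> z1; rewrite cmodM exprMn -[leRHS]mul1r ler_wpM2r // sqr_ge0.
      have u1 := le1 (cmv_diag b c k) (f k).
      have u2 := le1 (cmv_off b c k) (f (partner b k)).
      have sum (z w : R[i]) : cmod (z + w) ^+ 2 <= 2 * cmod z ^+ 2 + 2 * cmod w ^+ 2.
        have h : cmod (z + w) ^+ 2 <= (cmod z + cmod w) ^+ 2.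
          by rewrite ler_pXn2r ?nnegrE ?addr_ge0 ?cmod_ge0 // cmodD.
        have := sqr_ge0 (cmod z - cmod w); lra.
      have d0 := sqr_ge0 (cmod (cmv_diag b c k)).
      have o0 := sqr_ge0 (cmod (cmv_off b c k)).
      have {}u1 : cmod (cmv_diag b c k * f k) ^+ 2 <= cmod (f k) ^+ 2 by apply: u1; lra.
      have {}u2 : cmod (cmv_off b c k * f (partner b k)) ^+ 2 <= cmod (f (partner b k)) ^+ 2.
        by apply: u2; lra.
      have := sum (cmv_diag b c k * f k) (cmv_off b c k * f (partner b k)).
      case: ifPn => pH h; first by rewrite -!EFinM -EFinD lee_fin; lra.
      have z : cmv_off b c k = 0.
        apply: dc; first by move: kH; rewrite inE.
        by move/negP: pH => pH Hp; apply: pH; rewrite inE.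
      have := sqr_ge0 (cmod (f k)).
      rewrite z mul0r addr0 mule0 adde0 -EFinM lee_fin; lra.
  rewrite ge0_integralD //.
  - rewrite !ge0_integralZl // eG eGp -!EFinM -EFinD lee_fin; lra.
  - by move=> k _; rewrite mule_ge0.
  - by move=> k _; rewrite mule_ge0.
have LV : L2 (cmv_factor b c f : vec X) by split => //; exact: le_lt_trans le (ltry _).
by split => //; rewrite -lee_fin n2_integral.
Qed.

Lemma bounded_cmv_factor b c : (forall j, cmod (c j) <= 1) -> decoupled c ->
  bounded_op (cmv_factor b c : vec X -> vec X).
Proof.
move=> c1 dc; apply: bounded_opP.
- by move=> f Lf; have [] := L2_cmv_factor b c1 dc Lf.
- move=> z f g Lf Lg; apply: veq_eq => k _.
  by rewrite /lin !cmv_factorE; ring.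
- by exists 4 => f Lf; have [] := L2_cmv_factor b c1 dc Lf.
Qed.

Lemma decoupled_cconj c : decoupled c -> decoupled (cconj c).
Proof. by move=> dc b k Hk Hp; rewrite cmv_off_conj dc. Qed.

(* The blocks [theta] are symmetric, so conjugating the coefficients gives the adjoint. *)
Lemma cmv_factor_adjoint b c f g : (forall j, cmod (c j) <= 1) -> decoupled c ->
  L2 f -> L2 g ->
  inner (cmv_factor b c f : vec X) g = inner f (cmv_factor b (cconj c) g : vec X).
Proof.
move=> c1 dc Lf Lg.
have bV := bounded_cmv_factor b c1 dc.
have bV' := bounded_cmv_factor b (cmod_cconj c1) (decoupled_cconj dc).
have [T bT VT] := ell2_has_adjoint bV.
rewrite VT //; apply: inner_veq => //; [exact: (bounded_L2 bT)|exact: (bounded_L2 bV')|].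
apply: veq_eq => k Hk.
have Ld := @L2_dl R s k0.
(* The coordinate at [k] of the abstract adjoint [T] is read off by pairing with the unit vector at
   [k], whose image under the factor is supported on [k] and its partner. *)
have := @inner_dl R s k0 k (T g); rewrite asboolT // => <-.
rewrite -(VT _ _ (Ld k) Lg).
have -> : (cmv_factor b c (@ind R X [set k]) : vec X) =
    lin (cmv_diag b c k) (@ind R X [set k])
      (lin (cmv_off b c k) (@ind R X [set partner b k]) (fun=> 0)).
  apply/funext => j; rewrite cmv_factorE /lin !dlE addr0.
  have [->|jk] := eqVneq j k.
    have pk : (k == partner b k) = false.
      rewrite /partner; case: ifP => _; apply/eqP => /(congr1 (fun x => x - k)).
        by rewrite subrr addrAC subrr.
      by rewrite subrr addrAC subrr.
    by rewrite eq_sym pk !mulr0.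
  have [e|jp] := eqVneq j (partner b k).
    by rewrite e partnerK eqxx cmv_off_partner !mulr0.
  rewrite (_ : (partner b j == k) = false) ?mulr0 //.
  by apply/eqP => e; move/eqP: jp; apply; rewrite -e partnerK.
have Ld2 := L2_lin (cmv_off b c k) (Ld (partner b k)) (L2_0 X).
rewrite (inner_linl _ Lg (Ld k) Ld2) (inner_linl _ Lg (Ld _) (L2_0 X)).
rewrite inner0l addr0 !inner_dl asboolT // cmv_factorE cmv_diag_conj cmv_off_conj.
rewrite cmv_off_real; congr (_ + _); case: asboolP => // Hp.
by rewrite (dc b k) ?mul0r.
Qed.

Lemma cmv_factor_unitary b c : (forall j, cmod (c j) <= 1) -> decoupled c ->
  unitary_pair (cmv_factor b c : vec X -> vec X) (cmv_factor b (cconj c) : vec X -> vec X).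
Proof.
move=> c1 dc; have c1' := cmod_cconj c1; have dc' := decoupled_cconj dc.
split; [exact: bounded_cmv_factor|exact: bounded_cmv_factor| | |].
- by move=> f h; exact: cmv_factor_adjoint.
- by move=> f Lf; apply: veq_eq => k _; rewrite cmv_factorK.
- move=> f Lf; apply: veq_eq => k _.
  by rewrite -{1}(cconjK c) cmv_factorK.
Qed.

End cmv_factor_facts.

(** * Cyclicity of the unit vector at the end of the half-lattice *)

Section cyclic_subspace.
Context (R : realType) (X : mspace R) (E : pvm X) (g0 : vec X) (Lg0 : L2 g0).
Context (U U' : vec X -> vec X).
Hypothesis hU : is_spectral_measure_of E U.
Hypothesis UU' : unitary_pair U U'.

Lemma cbounded_id : cbounded_measurable (unit_circle R : set (borelC R)) id.
Proof.
have [m1 m2] := cmeasurable_id R; split.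
  by split; [exact: measurable_funS m1|exact: measurable_funS m2].
by exists 1 => z /unit_circle_cmod ->.
Qed.

(** [spectral_integral_orthogonal], applied to [E B g0] and [f], has two conclusions: one gives the
    invariance under [U], the other, through the adjoint, that under [U']. *)
Lemma cyclic_complement_invariant f : L2 f ->
  (forall B : set (borelC R), measurable B -> inner g0 (E B f) = 0) ->
  forall B : set (borelC R), measurable B -> inner g0 (E B (U f)) = 0 /\ inner g0 (E B (U' f)) = 0.
Proof.
move=> Lf f0 B mB; have [bU bU' UUa _ _] := UU'.
have Lp := pvm_L2 E mB Lg0; have LUf := bounded_L2 bU Lf; have LU'f := bounded_L2 bU' Lf.
have [|h1 h2] := spectral_integral_orthogonal cbounded_id hU Lp Lf.
  move=> C mC; rewrite pvm_innerI // f0 //; exact: measurableI.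
split; first by rewrite pvm_selfadjoint.
rewrite pvm_selfadjoint // -UUa // -innerJ ?h2 ?rmorph0 //.
exact: (bounded_L2 bU Lp).
Qed.

End cyclic_subspace.

Section cmv_cyclicity.
Context (R : realType) (s : side) (k0 : int) (a : int -> R[i]).
Hypothesis ha : forall k, `|a k| < 1.
Local Notation H := (half_lattice s k0).
Local Notation X := (ell2 R s k0).
Local Notation c := (decouple s k0 a).

Lemma cmod_decouple j : cmod (c j) <= 1.
Proof.
rewrite -lecR -normC_cmod /decouple; case: ifP => _; first by rewrite normr1.
exact/ltW/ha.
Qed.

Lemma rho1 : rho 1 = 0 :> R[i].
Proof. by rewrite /rho /cmod normr1 /= expr1n subrr sqrtr0. Qed.

Lemma decoupled_decouple : decoupled s k0 c.
Proof.
move=> b k; rewrite /cmv_off /partner /decouple; case: s => /=; case: (odd _ == b) => Hk Hp.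
- by rewrite (_ : k == k0) ?rho1 //; apply/eqP; lia.
- by exfalso; apply: Hp; lia.
- by exfalso; apply: Hp; lia.
- by rewrite (_ : k + 1 == k0 + 1) ?rho1 //; apply/eqP; lia.
Qed.

(** The strict inequality |a k| < 1 makes rho nonzero, and the single coefficient replaced by 1
    links across the boundary, so it never occurs between two sites of the half-lattice. *)
Lemma cmv_off_neq0 b k : H k -> H (partner b k) -> cmv_off b c k != 0.
Proof.
have r0 j : j != (if s is Plus then k0 else k0 + 1) -> rho (c j) != 0 :> R[i].
  move=> /negbTE jk; rewrite /rho /decouple (_ : (j == _) = false); last by case: s jk.
  have a1 : cmod (a j) ^+ 2 < 1.
    by rewrite expr_lt1 ?cmod_ge0 // -ltcR -normC_cmod ha.
  by rewrite eq_complex /= eqxx andbT sqrtr_eq0 -ltNge subr_gt0.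
move=> Hk Hp; rewrite /cmv_off; apply: r0; move: Hk Hp; rewrite /partner.
by case: s => /=; case: (odd _ == b) => Hk Hp; apply/eqP; lia.
Qed.

Let e (n : nat) : int := if s is Plus then k0 + n%:Z else k0 - n%:Z.

Let He n : H (e n).
Proof. by rewrite /e; case: s => /=; lia. Qed.

(** One of the two factors links a site forward and the other links it back, except at the end of
    the half-lattice, where the backward link leads outside. *)
Let next_partner n : exists b, partner b (e n) = e n.+1 /\
  (H (partner (~~ b) (e n)) -> exists2 m, (m < n)%N & partner (~~ b) (e n) = e m).
Proof.
exists (if s is Plus then ~~ odd (absz (e n)) else odd (absz (e n))).
rewrite /e /partner; case: s; case: (odd _) => /=; split; try lia.
- by move=> h; exists n.-1; lia.
- by move=> h; exists n.-1; lia.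
- by move=> h; exists n.-1; lia.
- by move=> h; exists n.-1; lia.
Qed.

(** Inverting the outer factor at [e n] involves only that site and an earlier one, so
    [cmv_factor b d f] vanishes at [e n]. The row of the inner factor at [e n] then says that a
    nonzero entry times [f (e n.+1)] is 0. *)
Let cmv_step b (d : int -> R[i]) n (f : vec X) :
  (forall j, cmod (d j) <= 1) -> decoupled s k0 d -> cmv_off b d (e n) != 0 ->
  partner b (e n) = e n.+1 ->
  (H (partner (~~ b) (e n)) -> exists2 m, (m < n)%N & partner (~~ b) (e n) = e m) ->
  (forall m, (m <= n)%N -> f (e m) = 0) ->
  (forall m, (m <= n)%N -> cmv_factor (~~ b) d (cmv_factor b d f) (e m) = 0) ->
  f (e n.+1) = 0.
Proof.
move=> d1 dd off0 pn pp f0 F0.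
have : cmv_factor b d f (e n) = 0.
  rewrite -(cmv_factorK (~~ b) (cmv_factor b d f) (e n) d1) cmv_factorE F0 //.
  rewrite mulr0 add0r cmv_off_conj.
  have [/pp[m mn ->]|Hp] := pselect (H (partner (~~ b) (e n))).
    by rewrite F0 ?mulr0 // ltnW.
  by rewrite dd ?mul0r.
rewrite cmv_factorE f0 // mulr0 add0r pn => /eqP.
by rewrite mulf_eq0 (negbTE off0) => /eqP.
Qed.

(** In [cmv_step] the factor applied first must be the one that links forward. This is W in U = V W
    and the inverse of V in the inverse of U; which of them links forward alternates from site to
    site, whence the invariance under both. *)
Lemma cmv_invariant_eq0 (M : set (vec X)) :
  (forall f, M f -> f k0 = 0) ->
  (forall f, M f -> M (half_U R s k0 a f)) ->
  (forall f, M f -> M (cmv_factor true (cconj c) (cmv_factor false (cconj c) f))) ->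
  forall f, M f -> forall k, H k -> f k = 0.
Proof.
move=> M0 MU MU' f Mf k Hk.
suff P n : forall f, M f -> forall m, (m <= n)%N -> f (e m) = 0.
  have [n ->] : exists n, k = e n.
    by exists (absz (k - k0)); move: Hk; rewrite /e; case: s => /=; lia.
  exact: (P n).
elim: n => [|n IH] {f Mf} f Mf m.
  by rewrite leqn0 => /eqP ->; rewrite (_ : e 0 = k0) ?M0 // /e; case: s => /=; lia.
rewrite leq_eqVlt ltnS => /orP[/eqP ->|]; last exact: IH.
have [b [pn pp]] := next_partner n.
have c1 := cmod_decouple; have dc := decoupled_decouple.
have off0 : cmv_off b c (e n) != 0 by apply: cmv_off_neq0; rewrite ?pn; exact: He.
case: b pn pp off0 => pn pp off0.
  apply: (cmv_step c1 dc off0 pn pp (IH _ Mf)) => j jn.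
  exact: (IH _ (MU _ Mf)).
have off0' : cmv_off false (cconj c) (e n) != 0 by rewrite cmv_off_conj.
apply: (cmv_step (cmod_cconj c1) (decoupled_cconj dc) off0' pn pp (IH _ Mf)) => j jn.
exact: (IH _ (MU' _ Mf)).
Qed.

Definition half_Uinv : vec X -> vec X :=
  cmv_factor true (cconj c) \o cmv_factor false (cconj c).

Lemma half_U_unitary : unitary_pair (half_U R s k0 a) half_Uinv.
Proof.
have c1 := cmod_decouple; have dc := decoupled_decouple.
exact: (unitary_pair_comp (cmv_factor_unitary true c1 dc) (cmv_factor_unitary false c1 dc)).
Qed.

Lemma half_Ut_unitary : unitary_pair (half_Ut R s k0 a)
  ((cmv_factor false (cconj c) : vec X -> vec X) \o cmv_factor true (cconj c)).
Proof.
have c1 := cmod_decouple; have dc := decoupled_decouple.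
exact: (unitary_pair_comp (cmv_factor_unitary false c1 dc) (cmv_factor_unitary true c1 dc)).
Qed.

Lemma delta_cyclic (E : pvm X) : is_spectral_measure_of E (half_U R s k0 a) ->
  forall f, L2 f ->
  (forall B : set (borelC R), measurable B -> inner (@delta R s k0) (E B f) = 0) ->
  veq f (fun=> 0).
Proof.
move=> hE f Lf f0; apply: veq_eq => k Hk.
pose M : set (vec X) := [set g | L2 g /\
  forall B : set (borelC R), measurable B -> inner (@delta R s k0) (E B g) = 0].
have [bU bU' _ _ _] := half_U_unitary.
have Ld := L2_delta R s k0.
have dE : @delta R s k0 = @ind R X [set k0] by apply/funext => j; rewrite dlE.
apply: (@cmv_invariant_eq0 M) => //.
- move=> g [Lg /(_ setT measurableT)].
  rewrite (inner_veq Ld (pvm_L2 E measurableT Lg) Lg (pvm_setT E Lg)) dE inner_dl.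
  by rewrite asboolT //; case: (s) => /=.
- move=> g [Lg g0]; split; first exact: (bounded_L2 bU Lg).
  by move=> B mB; have [] := cyclic_complement_invariant Ld hE half_U_unitary Lg g0 mB.
- move=> g [Lg g0]; split; first exact: (bounded_L2 bU' Lg).
  by move=> B mB; have [] := cyclic_complement_invariant Ld hE half_U_unitary Lg g0 mB.
Qed.

End cmv_cyclicity.

(** * Growth rates of powers and ranges of spectral projections *)

Section spectral_measure_intertwining.
Context (R : realType).
Implicit Types (X : mspace R) (B C : set (borelC R)).

Definition shift X (U : vec X -> vec X) (a : R[i]) (f : vec X) : vec X := lin (- a) f (U f).

Lemma pvm_measure_circle X (E : pvm X) f (Lf : L2 f) :
  pvm_measure E Lf (unit_circle R) = (n2 f)%:E.
Proof.
have mU := @measurable_unit_circle R.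
rewrite pvm_measureE //; congr EFin; apply: n2_veq => //; first exact: pvm_L2.
exact: pvm_circle.
Qed.

(** On the circle |z - a|^2 = 1 + |a|^2 - 2 Re(conj(a) z) is affine in the real and imaginary parts
    of z. The form of [U] and the isometry of [U] therefore suffice, and multiplicativity of the
    spectral integral is not called upon. *)
Lemma n2_shift X (E : pvm X) U U' a f (Lf : L2 f) : unitary_pair U U' ->
  is_spectral_measure_of E U ->
  n2 (shift U a f) =
  \int[pvm_measure E Lf]_(z in unit_circle R) (cmod (z - a) ^+ 2).
Proof.
move=> UU hU; have [bU _ _ _ _] := UU; have LU := bounded_L2 bU Lf.
have mU := @measurable_unit_circle R.
rewrite n2_lin // cmodN (_ : n2 (U f) = n2 f); last first.
  by rewrite /n2 (unitary_pair_inner UU).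
have [_ /(_ f Lf) ->] := hU.
have fU : (pvm_measure E Lf (unit_circle R) < +oo)%E by rewrite pvm_measureE // ltry.
have [i1 i2] := cbounded_cintegrable fU mU (@cbounded_id R).
set A := Re a; set B := Im a.
have ic (r : R) : (pvm_measure E Lf).-integrable (unit_circle R) (EFin \o cst r).
  exact: finite_measure_integrable_cst.
have iZ (r : R) (h : borelC R -> R) :
    (pvm_measure E Lf).-integrable (unit_circle R) (EFin \o h) ->
    (pvm_measure E Lf).-integrable (unit_circle R) (EFin \o (fun x => r * h x)).
  by move=> ih; exact: (integrableZl mU r ih).
have eI : \int[pvm_measure E Lf]_(z in unit_circle R) (cmod (z - a) ^+ 2) =
    \int[pvm_measure E Lf]_(z in unit_circle R)
      ((1 + cmod a ^+ 2) + ((- 2 * A) * Re z + (- 2 * B) * Im z)).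
  apply: eq_Rintegral => z; rewrite inE => /unit_circle_cmod z1.
  have : cmod z ^+ 2 = 1 by rewrite z1 expr1n.
  rewrite !sqr_cmod !complexReIm /A /B; lra.
rewrite eI RintegralD //; first last.
- exact: (integrableD mU (iZ _ _ i1) (iZ _ _ i2)).
-  exact: (ic (1 + cmod a ^+ 2)).
rewrite (RintegralD mU (iZ (- 2 * A) _ i1) (iZ (- 2 * B) _ i2)).
rewrite (RintegralZl (- 2 * A) mU i1) (RintegralZl (- 2 * B) mU i2) Rintegral_cst // [X in fine X]pvm_measure_circle.
rewrite /cint !complexReIm /= -/A -/B; ring.
Qed.

Lemma pvm_measure_support X (E : pvm X) B f (Lf : L2 f) : measurable B ->
  veq (E B f) f -> pvm_measure E Lf ((unit_circle R : set (borelC R)) `\` B) = 0%E.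
Proof.
move=> mB EBf; have mU := @measurable_unit_circle R.
have mUB : measurable ((unit_circle R : set (borelC R)) `\` B) by exact: measurableD.
have LB := pvm_L2 E mB Lf.
rewrite pvm_measureE //.
rewrite -(n2_veq (pvm_L2 E mUB LB) (pvm_L2 E mUB Lf)
  (bounded_veq (pvm_bounded E mUB) LB Lf EBf)).
rewrite (n2_veq (pvm_L2 E mUB LB) (L2_0 X)) ?n2_0 //.
apply: veq_trans (pvm_set0 E Lf); apply: veq_sym.
have := pvm_setI E mUB mB Lf.
by rewrite (_ : ((unit_circle R : set (borelC R)) `\` B) `&` B = set0) // setDE -setIA setICl setI0.
Qed.

(** The scalar measure of a vector in the range of [E B] lives on [B], so an inequality known only
    on [B] can be integrated over the circle. *)
Let Rint_cst X (E : pvm X) f (Lf : L2 f) B (g : borelC R -> R) (c : R) :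
  measurable B -> veq (E B f) f -> measurable_fun (unit_circle R : set (borelC R)) g ->
  (forall z, 0 <= g z) -> (exists M : R, forall z, unit_circle R z -> g z <= M) ->
  ((forall z, B z -> g z <= c) ->
    \int[pvm_measure E Lf]_(z in unit_circle R) g z <= c * n2 f) /\
  ((forall z, B z -> c <= g z) ->
    c * n2 f <= \int[pvm_measure E Lf]_(z in unit_circle R) g z).
Proof.
move=> mB EBf mg g0 [M gM]; have mU := @measurable_unit_circle R.
have ic (r : R) : (pvm_measure E Lf).-integrable (unit_circle R) (EFin \o cst r).
  exact: finite_measure_integrable_cst.
have ig : (pvm_measure E Lf).-integrable (unit_circle R) (EFin \o g).
  apply: le_integrable (ic M) => //; first exact/measurable_EFinP.
  move=> z Uz /=; rewrite lee_fin ger0_norm //.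
  by rewrite (le_trans (gM _ Uz)) // ler_norm.
have cE : c * n2 f = \int[pvm_measure E Lf]_(z in unit_circle R) c.
  by rewrite Rintegral_cst // [X in fine X]pvm_measure_circle.
have ae : {ae (pvm_measure E Lf : {measure set (borelC R) -> \bar R}),
    forall z, unit_circle R z -> B z}.
  exists ((unit_circle R : set (borelC R)) `\` B); split; [exact: measurableD|exact: pvm_measure_support|].
  by move=> z /= /not_implyP[].
have fin (h : borelC R -> R) : (pvm_measure E Lf).-integrable (unit_circle R) (EFin \o h) ->
    (\int[pvm_measure E Lf]_(z in unit_circle R) (h z)%:E)%E \is a fin_num.
  exact: integrable_fin_num.
(* Both truncations agree with [g] almost everywhere in the case where they are used, and compare
   with [c] at every point. *)
pose gm (z : borelC R) := Num.min (g z) c; pose gM' (z : borelC R) := Num.max (g z) c.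
split=> gc; rewrite cE /Rintegral; apply: fine_le; try exact: fin; try exact: (fin (cst c)).
  rewrite (ae_eq_integral (EFin \o gm)) //; first last.
  - by apply: (@filterS _ _ (ae_filter_ringOfSetsType (pvm_measure E Lf)) _ _ _ ae) => z h Uz; rewrite /gm /= min_l // gc //; exact: h.
  - by apply/measurable_EFinP; apply: measurable_minr.
  - exact/measurable_EFinP.
  apply: le_integral => //; [|exact: (ic c)|by move=> z _; rewrite lee_fin ge_min lexx orbT].
  apply: le_integrable (ic (`|M| + `|c|)) => //.
    by apply/measurable_EFinP; exact: measurable_minr.
  move=> z Uz /=; rewrite lee_fin /gm (ger0_norm (_ : 0 <= `|M| + `|c|)) ?addr_ge0 //.
  have := gM _ Uz; have := g0 z; have := ler_norm M; have := normr_ge0 c.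
  have := normr_ge0 M; rewrite /Order.min; case: ifP => _; last lra.
  by move=> *; rewrite ger0_norm //; lra.
rewrite (ae_eq_integral (EFin \o gM') (EFin \o g)) //; first last.
- by apply: (@filterS _ _ (ae_filter_ringOfSetsType (pvm_measure E Lf)) _ _ _ ae) => z h Uz; rewrite /gM' /= max_l // gc //; exact: h.
- by apply/measurable_EFinP; apply: measurable_maxr.
- exact/measurable_EFinP.
apply: le_integral => //; [exact: (ic c)| |by move=> z _; rewrite lee_fin le_max lexx orbT].
apply: le_integrable (ic (`|M| + `|c|)) => //.
  by apply/measurable_EFinP; exact: measurable_maxr.
move=> z Uz /=; rewrite lee_fin /gM' (ger0_norm (_ : 0 <= `|M| + `|c|)) ?addr_ge0 //.
have := gM _ Uz; have := g0 z; have := ler_norm M; have := normr_ge0 c.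
have := normr_ge0 M; rewrite /Order.max; case: ifP => _; first lra.
by move=> *; rewrite ger0_norm //; lra.
Qed.

Lemma n2_shift_bounds X (E : pvm X) U U' a (r : R) f B : unitary_pair U U' ->
  is_spectral_measure_of E U -> 0 <= r -> measurable B -> L2 f -> veq (E B f) f ->
  ((forall z, B z -> cmod (z - a) <= r) -> n2 (shift U a f) <= r ^+ 2 * n2 f) /\
  ((forall z, B z -> r <= cmod (z - a)) -> r ^+ 2 * n2 f <= n2 (shift U a f)).
Proof.
move=> UU hU r0 mB Lf EBf; rewrite (n2_shift a Lf UU hU).
have mg : measurable_fun (unit_circle R : set (borelC R)) (fun z => cmod (z - a) ^+ 2).
  apply: measurable_sqr_cmod; apply: cmeasurableD; last exact: cmeasurable_cst.
  by have [] := @cbounded_id R.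
have gM : exists M : R, forall z, unit_circle R z -> cmod (z - a) ^+ 2 <= M.
  exists ((1 + cmod a) ^+ 2) => z /unit_circle_cmod z1.
  rewrite ler_pXn2r ?nnegrE ?addr_ge0 ?cmod_ge0 //.
  by rewrite -z1 -[X in _ <= _ + X]cmodN cmodD.
have [h1 h2] := Rint_cst Lf (r ^+ 2) mB EBf mg (fun z => sqr_ge0 _) gM.
split=> h; [apply: h1 => z /h|apply: h2 => z /h] => ?;
  by rewrite ler_pXn2r ?nnegrE ?cmod_ge0.
Qed.

Lemma bounded_shift X (U : vec X -> vec X) a : bounded_op U -> bounded_op (shift U a).
Proof.
move=> bU; have [K K0 UK] := bounded_n2 bU; apply: bounded_opP.
- by move=> f Lf; apply: L2_lin => //; exact: (bounded_L2 bU).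
- move=> c f g Lf Lg; apply: filterS (bounded_lin c bU Lf Lg) => x h Dx.
  by rewrite /shift /lin h // /lin; ring.
- exists (2 * cmod a ^+ 2 + 2 * K) => f Lf; have LU := bounded_L2 bU Lf.
  have h1 := n2_ge0 (lin a f (U f)); rewrite n2_lin // in h1.
  rewrite /shift n2_lin // cmodN; have := UK _ Lf; move: h1.
  rewrite !complexReIm; have := n2_ge0 f; lra.
Qed.

Lemma shift_commute X (E : pvm X) U U' a B f : unitary_pair U U' ->
  is_spectral_measure_of E U -> measurable B -> L2 f ->
  veq (E B (shift U a f)) (shift U a (E B f)).
Proof.
move=> UU hU mB Lf; have [bU _ _ _ _] := UU; have LU := bounded_L2 bU Lf.
apply: veq_trans (bounded_lin _ (pvm_bounded E mB) Lf LU) _.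
apply: veq_lin; first exact: veq_refl.
exact: (spectral_integral_commute (@cbounded_id R) hU mB Lf).
Qed.

Section intertwine.
Context (X Y : mspace R) (E : pvm X) (F : pvm Y) (U U' : vec X -> vec X) (W W' : vec Y -> vec Y).
Hypothesis UU : unitary_pair U U'.
Hypothesis WW : unitary_pair W W'.
Hypothesis hU : is_spectral_measure_of E U.
Hypothesis hW : is_spectral_measure_of F W.
Context (S : vec X -> vec Y).
Hypothesis bS : bounded_op S.
Hypothesis SU : forall f, L2 f -> veq (S (U f)) (W (S f)).

Let shift_S a f : L2 f -> veq (S (shift U a f)) (shift W a (S f)).
Proof.
move=> Lf; have [bU _ _ _ _] := UU; have LU := bounded_L2 bU Lf.
apply: veq_trans (bounded_lin _ bS Lf LU) _.
by apply: veq_lin; [exact: veq_refl|exact: SU].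
Qed.

(* The powers of [U - a] grow at most like [r ^+ n] on the range of [E (cdisk a r)],
   and those of [W - a] at least like [t ^+ n] off [cdisk a t]; so for [r < t] the
   component of [S f] off [cdisk a t] must vanish. *)
Let decay a (r t : R) f : 0 <= r -> r < t -> L2 f -> veq (E (cdisk a r) f) f ->
  n2 (F (~` cdisk a t) (S f)) = 0.
Proof.
move=> r0 rt Lf Ef; have [bU _ _ _ _] := UU; have [bW _ _ _ _] := WW.
have t0 : 0 < t by exact: le_lt_trans rt.
set C : set (borelC R) := ~` cdisk a t.
have mC : measurable C by apply: measurableC; exact: measurable_cdisk.
have mD := @measurable_cdisk R a r.
have bA := bounded_shift a bU; have bB := bounded_shift a bW.
(* [fn] stands for (U - a)^n f. Commutation of the shifts with [E] and [F] keeps [fn] in the range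
   of [E (cdisk a r)] and the component off [cdisk a t] in the range of [F C], so both shift bounds
   apply again at each stage. *)
have step n : exists fn, [/\ L2 fn, veq (E (cdisk a r) fn) fn,
    n2 fn <= (r ^+ 2) ^+ n * n2 f &
    (t ^+ 2) ^+ n * n2 (F C (S f)) <= n2 (F C (S fn))].
  elim: n => [|n [fn [Ln En nn Fn]]].
    by exists f; split => //; rewrite expr0 mul1r.
  have LA := bounded_L2 bA Ln; have LSn := bounded_L2 bS Ln.
  have LF := pvm_L2 F mC LSn; have LSA := bounded_L2 bS LA.
  exists (shift U a fn); split => //.
  - apply: veq_trans (shift_commute a UU hU mD Ln) _.
    by apply: (bounded_veq bA (pvm_L2 E mD Ln) Ln).
  - have [h _] := n2_shift_bounds a UU hU r0 mD Ln En.
    apply: le_trans (h _) _ => //.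
    by rewrite [(r ^+ 2) ^+ n.+1]exprS -mulrA ler_wpM2l ?sqr_ge0.
  - have e1 : veq (F C (S (shift U a fn))) (shift W a (F C (S fn))).
      apply: veq_trans (bounded_veq (pvm_bounded F mC) LSA (bounded_L2 bB LSn) (shift_S a Ln)) _.
      exact: shift_commute WW hW mC LSn.
    rewrite (n2_veq (pvm_L2 F mC LSA) (bounded_L2 bB LF) e1).
    have FF : veq (F C (F C (S fn))) (F C (S fn)).
      by have := pvm_setI F mC mC LSn; rewrite setIid; exact: veq_sym.
    have [_ h] := n2_shift_bounds a WW hW (ltW t0) mC LF FF.
    apply: le_trans (h _); first by rewrite [(t ^+ 2) ^+ n.+1]exprS -mulrA ler_wpM2l ?sqr_ge0.
    by move=> z /negP; rewrite -ltNge => /ltW.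
have [K K0 SK] := bounded_n2 bS.
apply/le_anti; rewrite n2_ge0 andbT leNgt; apply/negP => Fp.
pose q := r ^+ 2 / t ^+ 2.
have t20 : 0 < t ^+ 2 by rewrite exprn_gt0.
have q0 : 0 <= q by rewrite divr_ge0 ?sqr_ge0.
have q1 : q < 1 by rewrite ltr_pdivrMr // mul1r ltr_pXn2r ?nnegrE // ltW.
(* The growth rates are compared through the bound [K] on [S]: t^(2n) times the left side is at most
   r^(2n) times [K * n2 f]. *)
have bound n : n2 (F C (S f)) <= q ^+ n * (K * n2 f).
  have [fn [Ln En nn Fn]] := step n.
  have tn : 0 < (t ^+ 2) ^+ n by rewrite exprn_gt0.
  rewrite /q expr_div_n mulrAC ler_pdivlMr // mulrC.
  apply: le_trans Fn _; apply: le_trans (pvm_le F mC (bounded_L2 bS Ln)) _.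
  apply: le_trans (SK _ Ln) _.
  by rewrite mulrCA ler_wpM2l.
have : q ^+ n * (K * n2 f) @[n --> \oo] --> 0 * (K * n2 f).
  by apply: cvgMl; apply: cvg_expr; rewrite ger0_norm.
rewrite mul0r => /cvgrPdist_lt/(_ _ Fp)[N _ /(_ N (leqnn N))] /=.
rewrite sub0r normrN ger0_norm; first by rewrite ltNge bound.
by rewrite mulr_ge0 ?exprn_ge0 // mulr_ge0 // n2_ge0.
Qed.

(** [decay] requires a strictly larger radius, so the complement of the disk is exhausted by
    complements of disks of radius r + 1/(n + 1), each of which carries no mass of [S f]. *)
Lemma cdisk_intertwine a (r : R) f : 0 <= r -> L2 f -> veq (E (cdisk a r) f) f ->
  veq (F (cdisk a r) (S f)) (S f).
Proof.
move=> r0 Lf Ef; have LS := bounded_L2 bS Lf; have mD := @measurable_cdisk R a r.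
have mCD := measurableC mD.
pose G n : set (borelC R) := ~` (cdisk a (r + n.+1%:R^-1)).
have mG n : measurable (G n) by apply: measurableC; exact: measurable_cdisk.
have GE : ~` cdisk a r = \bigcup_n G n.
  apply/seteqP; split=> [z /= /negP|z [n _] /= /negP].
    rewrite -ltNge => h; have h0 : 0 < cmod (z - a) - r by rewrite subr_gt0.
    exists (Num.truncn (cmod (z - a) - r)^-1) => //=.
    apply/negP; rewrite -ltNge -ltrBrDl invf_plt ?posrE //.
    by have := truncn_itv (ltW (_ : 0 < (cmod (z - a) - r)^-1));
      rewrite invr_gt0 => /(_ h0) /andP[].
  rewrite -ltNge => h; apply/negP; rewrite -ltNge; apply: le_lt_trans h.
  by rewrite lerDl.
have G0 n : pvm_measure F LS (G n) = 0%E.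
  have rt : r < r + n.+1%:R^-1 by rewrite ltrDl invr_gt0.
  by rewrite pvm_measureE // (decay r0 rt Lf Ef).
have : pvm_measure F LS (~` cdisk a r) = 0%E.
  apply/le_anti; rewrite measure_ge0 andbT GE.
  apply: le_trans (measure_sigma_subadditive _ mG _ _) _ => //.
    by rewrite -GE.
  by rewrite eseries0 // => n _ _; exact: G0.
rewrite pvm_measureE // => -[h].
have := n2_eq0 (pvm_L2 F mCD LS) h; have := pvm_setC F mD LS.
apply: filterS2 => x h1 h2 Dx; move: (h1 Dx); rewrite h2 // /lin => /eqP.
by rewrite mulN1r addrC eq_sym subr_eq0 => /eqP ->.
Qed.

End intertwine.

End spectral_measure_intertwining.

(** * Uniqueness of the spectral measure under unitary equivalence *)

Section spectral_measure_uniqueness.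
Context (R : realType) (X Y : mspace R) (E : pvm X) (F : pvm Y).
Context (U U' : vec X -> vec X) (W W' : vec Y -> vec Y).
Hypothesis UU : unitary_pair U U'.
Hypothesis WW : unitary_pair W W'.
Hypothesis hU : is_spectral_measure_of E U.
Hypothesis hW : is_spectral_measure_of F W.
Context (S : vec X -> vec Y) (S' : vec Y -> vec X).
Hypothesis SS : unitary_pair S S'.
Hypothesis SU : forall f, L2 f -> veq (S (U f)) (W (S f)).
Implicit Types (B C : set (borelC R)).

Let S'W h : L2 h -> veq (S' (W h)) (U (S' h)).
Proof.
move=> Lh; have [bS bS' SSa SK S'K] := SS; have [bU _ _ _ _] := UU; have [bW _ _ _ _] := WW.
have LS'h := bounded_L2 bS' Lh; have LU := bounded_L2 bU LS'h.
apply: veq_trans (SK _ LU).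
apply: (bounded_veq bS' (bounded_L2 bW Lh) (bounded_L2 bS LU)).
apply: veq_trans (veq_sym (SU LS'h)).
exact: (bounded_veq bW Lh (bounded_L2 bS LS'h) (veq_sym (S'K _ Lh))).
Qed.

Let P B := measurable B /\ forall f, L2 f -> veq (F B (S f)) (S (E B f)).

(** [cdisk_intertwine] gives F S E = S E on the disk. For the inverse it gives E S' F = S' F, whose
    adjoint is F S E = F S; together F S = S E. *)
Let P_cdisk a r : P (cdisk a r).
Proof.
have mD := @measurable_cdisk R a r; split => // f Lf.
have [bS bS' SSa SK S'K] := SS.
have LSf := bounded_L2 bS Lf; have LE := pvm_L2 E mD Lf; have LF := pvm_L2 F mD LSf.
(* A disk of negative radius is empty, and then both sides vanish. *)
have [r0|r0] := leP 0 r; last first.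
  have D0 : cdisk a r = set0.
    apply/seteqP; split=> // z /= h; have := cmod_ge0 (z - a).
    by rewrite leNgt (le_lt_trans h r0).
  rewrite D0; apply: veq_trans (pvm_set0 F LSf) _; apply: veq_sym.
  apply: veq_trans (bounded_veq bS (pvm_L2 E measurable0 Lf) (L2_0 X) (pvm_set0 E Lf)) _.
  exact: bounded_0.
have idem Z (G : pvm Z) (k : vec Z) : L2 k -> veq (G (cdisk a r) (G (cdisk a r) k)) (G (cdisk a r) k).
  by move=> Lk; have := pvm_setI G mD mD Lk; rewrite setIid; exact: veq_sym.
have h1 := cdisk_intertwine UU WW hU hW bS SU r0 LE (idem _ E f Lf).
have LSE := bounded_L2 bS LE.
apply: inner_eq => // h Lh; have LFh := pvm_L2 F mD Lh; have LS'F := bounded_L2 bS' LFh.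
have h2 := cdisk_intertwine WW UU hW hU bS' S'W r0 LFh (idem _ F h Lh).
have LES := pvm_L2 E mD LS'F.
rewrite -(inner_veq Lh (pvm_L2 F mD LSE) LSE h1) !pvm_selfadjoint //.
have SSb (k : vec X) (l : vec Y) : L2 k -> L2 l -> inner l (S k) = inner (S' l) k.
  move=> Lk Ll; rewrite -[RHS]innerJ //; last exact: (bounded_L2 bS').
  by rewrite -SSa // innerJ //; exact: (bounded_L2 bS).
by rewrite !SSb // pvm_selfadjoint // (inner_veql Lf LES LS'F h2).
Qed.

(** Intersections come from multiplicativity and complements from [pvm_setC]. For disjoint unions
    only the scalar measures are known to be additive, so squared norms are compared first and the
    operators then by polarization. *)
Let P_sigma : sigma_algebra setT P.
Proof.
have [bS bS' SSa SK S'K] := SS.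
have LS k : L2 k -> L2 (S k) by exact: (bounded_L2 bS).
have LS' k : L2 k -> L2 (S' k) by exact: (bounded_L2 bS').
have LE B k : measurable B -> L2 k -> L2 (E B k) by exact: pvm_L2.
have LF B k : measurable B -> L2 k -> L2 (F B k) by exact: pvm_L2.
apply: dynkin_setI_sigma_algebra.
  split.
  - split=> // f Lf; apply: veq_trans (pvm_setT F (LS _ Lf)) _; apply: veq_sym.
    exact: (bounded_veq bS (LE _ _ measurableT Lf) Lf (pvm_setT E Lf)).
  - move=> B [mB PB]; split; first exact: measurableC.
    move=> f Lf; have mC := measurableC mB.
    apply: veq_trans (pvm_setC F mB (LS _ Lf)) _; apply: veq_sym.
    apply: veq_trans (bounded_veq bS (LE _ _ mC Lf) (L2_lin _ (LE _ _ mB Lf) Lf)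
      (pvm_setC E mB Lf)) _.
    apply: veq_trans (bounded_lin _ bS (LE _ _ mB Lf) Lf) _.
    by apply: veq_lin; [exact/veq_sym/PB|exact: veq_refl].
  - move=> B tB PB; have mB n : measurable (B n) by have [] := PB n.
    have mU : measurable (\bigcup_n B n) by exact: bigcupT_measurable.
    split=> // f Lf.
    have nE k : L2 k -> n2 (F (\bigcup_n B n) (S k)) = n2 (E (\bigcup_n B n) k).
      move=> Lk; apply: EFin_inj.
      rewrite -(pvm_measureE F (LS _ Lk)) // -(pvm_measureE E Lk) //.
      apply: etrans (measure_bigcup _ _ _ _ _) _ => //.
      apply: etrans (esym (measure_bigcup _ _ _ _ _)) => //.
      apply: eq_eseriesr => n _; transitivity (n2 (F (B n) (S k)))%:E.
        by rewrite -(pvm_measureE F (LS _ Lk)).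
      transitivity (n2 (E (B n) k))%:E; last by rewrite -(pvm_measureE E Lk).
      congr EFin; have [_ PBn] := PB n.
      rewrite (n2_veq (LF _ _ (mB n) (LS _ Lk)) (LS _ (LE _ _ (mB n) Lk)) (PBn _ Lk)).
      by rewrite /n2 (unitary_pair_inner SS _ _) //; exact: LE.
    have h : veq (S' (F (\bigcup_n B n) (S f))) (E (\bigcup_n B n) f).
      have bA := bounded_comp (bounded_comp bS (pvm_bounded F mU)) bS'.
      apply: (polarization bA (pvm_bounded E mU)) => // k Lk /=.
      rewrite -SSa //; last by apply: LF => //; exact: LS.
      rewrite pvm_inner_n2 //; last exact: LS.
      by rewrite nE // pvm_inner_n2.
    have LFS := LF _ _ mU (LS _ Lf).
    apply: veq_trans (veq_sym (S'K _ LFS)) _.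
    exact: (bounded_veq bS (LS' _ LFS) (LE _ _ mU Lf) h).
move=> A B [mA PA] [mB PB]; have mAB := measurableI _ _ mA mB; split=> // f Lf.
apply: veq_trans (pvm_setI F mA mB (LS _ Lf)) _.
apply: veq_trans (bounded_veq (pvm_bounded F mA) (LF _ _ mB (LS _ Lf))
  (LS _ (LE _ _ mB Lf)) (PB _ Lf)) _.
apply: veq_trans (PA _ (LE _ _ mB Lf)) _.
apply: (bounded_veq bS (LE _ _ mA (LE _ _ mB Lf)) (LE _ _ mAB Lf)).
exact/veq_sym/pvm_setI.
Qed.

Lemma pvm_intertwine B f : measurable B -> L2 f -> veq (F B (S f)) (S (E B f)).
Proof. by move=> mB; have [_] := borelC_cdisk_ind P_sigma P_cdisk mB; exact. Qed.

(** By [pvm_intertwine], the scalar measure of [h] under [F] is that of [S' h] under [E]. The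
    transported operator also witnesses the existence of phi of the second unitary. *)
Lemma spectral_integral_transport phi A : is_spectral_integral E phi A ->
  is_spectral_integral F phi (S \o A \o S').
Proof.
move=> [bA AE]; have [bS bS' SSa SK S'K] := SS; split.
  exact: (bounded_comp (bounded_comp bS' bA) bS).
move=> h Lh; have LS'h := bounded_L2 bS' Lh; have LA := bounded_L2 bA LS'h.
have -> : inner h ((S \o A \o S') h) = inner (S' h) (A (S' h)).
  rewrite -[RHS]innerJ // -SSa // innerJ //; exact: (bounded_L2 bS).
rewrite (AE _ LS'h); apply: eq_cint_measure => B mB _.
transitivity (n2 (E B (S' h)))%:E; first by rewrite -(pvm_measureE E LS'h).
transitivity (n2 (F B h))%:E; last by rewrite -(pvm_measureE F Lh).
congr EFin; have LE := pvm_L2 E mB LS'h; have LF := pvm_L2 F mB Lh.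
have LSS := bounded_L2 bS LS'h; have LSE := bounded_L2 bS LE.
have e : veq (F B h) (S (E B (S' h))).
  apply: veq_trans (pvm_intertwine mB LS'h).
  exact: (bounded_veq (pvm_bounded F mB) Lh LSS (veq_sym (S'K _ Lh))).
by rewrite (n2_veq LF LSE e) /n2 (unitary_pair_inner SS LE LE).
Qed.

End spectral_measure_uniqueness.

(** * Density of simple functions and simplicity of the spectrum *)

Section simple_approximation.
Import HBNNSimple.
Context (R : realType) (X : mspace R) (E : pvm X) (g0 : vec X) (Lg0 : L2 g0).
Local Notation mu := (pvm_measure E Lg0).
Local Notation Y := (circle_space mu).
Local Notation indY := (@ind R Y).
Context (V : vec X -> vec Y) (T : vec Y -> vec X).
Hypothesis VT : unitary_pair V T.
Hypothesis Vg0 : forall B : set (borelC R), measurable B -> veq (V (E B g0)) (indY B).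

Let bV : bounded_op V. Proof. by have [] := VT. Qed.

Definition pvm_span (h : vec X) := exists n (c : 'I_n -> R[i]) (B : 'I_n -> set (borelC R)),
  (forall i, measurable (B i)) /\ h = (fun x => \sum_(i < n) c i * E (B i) g0 x).

Let span0 : pvm_span (fun=> 0).
Proof.
exists 0%N, (fun=> 0), (fun=> set0); split => [i|]; first exact: measurable0.
by apply/funext => x; rewrite big_ord0.
Qed.

Let span_lin z h1 h2 : pvm_span h1 -> pvm_span h2 -> pvm_span (lin z h1 h2).
Proof.
move=> [m [c [B [mB ->]]]] [n [d [C [mC ->]]]].
exists (m + n)%N, (fun i => match fintype.split i with inl j => z * c j | inr j => d j end),
  (fun i => match fintype.split i with inl j => B j | inr j => C j end); split=> [i|].
  by case: (fintype.split i).
apply/funext => x; rewrite big_split_ord /lin mulr_sumr; congr (_ + _).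
  by apply: eq_bigr => i _; rewrite -/(unsplit (inl i)) unsplitK mulrA.
by apply: eq_bigr => i _; rewrite -/(unsplit (inr i)) unsplitK.
Qed.

Let span_pvm B : measurable B -> pvm_span (E B g0).
Proof.
move=> mB; exists 1%N, (fun=> 1), (fun=> B); split=> //.
by apply/funext => x; rewrite big_ord1 mul1r.
Qed.

Let span_L2 h : pvm_span h -> L2 h.
Proof.
move=> [n [c [B [mB ->]]]]; elim: n c B mB => [|n IH] c B mB.
  rewrite (_ : (fun x => _) = (fun=> 0) :> vec X); first exact: L2_0.
  by apply/funext => x; rewrite big_ord0.
rewrite (_ : (fun x => _) = lin (c ord0) (E (B ord0) g0)
  (fun x => \sum_(i < n) c (lift ord0 i) * E (B (lift ord0 i)) g0 x)); last first.
  by apply/funext => x; rewrite big_ord_recl.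
by apply: L2_lin; [exact: pvm_L2|apply: IH => i; exact: mB].
Qed.

(** Approximation is measured in L^2(mu), where [V] turns the span of the vectors E(B) g0 into the
    simple functions. *)
Let approx (psi : vec Y) := L2 psi /\ forall e : R, 0 < e ->
  exists2 h, pvm_span h & n2 (lin (-1) (V h) psi) < e.

Let approx_lin z psi1 psi2 : approx psi1 -> approx psi2 -> approx (lin z psi1 psi2).
Proof.
move=> [L1 a1] [L2_ a2]; split=> [|e e0]; first exact: L2_lin.
(* The squared norm of z d1 + d2 is at most 2 |z|^2 n2 d1 + 2 n2 d2, so this divisor leaves a total
   of at most [e / 2]. *)
have k0 : 0 < 4 * (cmod z ^+ 2 + 1) by have := sqr_ge0 (cmod z); lra.
have [h1 s1 n1] := a1 _ (divr_gt0 e0 k0); have [h2 s2 n2_] := a2 _ (divr_gt0 e0 k0).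
exists (lin z h1 h2); first exact: span_lin.
have Lh1 := span_L2 s1; have Lh2 := span_L2 s2.
have LV1 := bounded_L2 bV Lh1; have LV2 := bounded_L2 bV Lh2.
have Ld1 : L2 (lin (-1) (V h1) psi1) by exact: L2_lin.
have Ld2 : L2 (lin (-1) (V h2) psi2) by exact: L2_lin.
have e1 : veq (lin (-1) (V (lin z h1 h2)) (lin z psi1 psi2))
    (lin z (lin (-1) (V h1) psi1) (lin (-1) (V h2) psi2)).
  by apply: filterS (bounded_lin z bV Lh1 Lh2) => x h Dx; rewrite /lin h // /lin; ring.
have LVl : L2 (lin (-1) (V (lin z h1 h2)) (lin z psi1 psi2)).
  by apply: L2_lin; [apply: (bounded_L2 bV)|]; exact: L2_lin.
rewrite (n2_veq LVl (L2_lin z Ld1 Ld2) e1).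
have p := n2_ge0 (lin (- z) (lin (-1) (V h1) psi1) (lin (-1) (V h2) psi2)).
rewrite n2_lin // in p; rewrite n2_lin //; move: p n1 n2_; rewrite cmodN !complexReIm.
rewrite !ltr_pdivlMr //.
move: (n2 _) (n2 _) (n2_ge0 (lin (-1) (V h1) psi1)) (n2_ge0 (lin (-1) (V h2) psi2)) => u w.
have := sqr_ge0 (cmod z); move: (cmod z ^+ 2) => k; nra.
Qed.

Let span_ind_sum (s : seq R) (F : R -> set (borelC R)) : (forall y, measurable (F y)) ->
  exists2 h, pvm_span h & veq (V h) (fun x => (\sum_(y <- s) y * \1_(F y) x)%:C%C).
Proof.
move=> mF; elim: s => [|y s [h sh Vh]].
  exists (fun=> 0); first exact: span0.
  apply: veq_trans (bounded_0 bV) _; apply: veq_eq => x _.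
  by rewrite big_nil.
have Lh := span_L2 sh; have LE := pvm_L2 E (mF y) Lg0.
exists (lin y%:C%C (E (F y) g0) h); first by apply: span_lin => //; exact: span_pvm.
apply: veq_trans (bounded_lin _ bV LE Lh) _.
apply: veq_trans (veq_lin _ (Vg0 (mF y)) Vh) _; apply: veq_eq => x _.
by rewrite /lin big_cons rmorphD rmorphM.
Qed.

Let approx_nneg (w : borelC R -> R) : (forall x, 0 <= w x) ->
  L2 ((fun x => (w x)%:C%C) : vec Y) -> approx (fun x => (w x)%:C%C).
Proof.
move=> w0 Lw; split=> // e e0; have mU := @measurable_unit_circle R.
have mw : measurable_fun (unit_circle R : set (borelC R)) w by case: Lw.
have mEw : measurable_fun (unit_circle R : set (borelC R)) (EFin \o w) by exact/measurable_EFinP.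
pose s n := nnsfun_approx mU mEw n.
have s0 n x : 0 <= s n x by exact: fun_ge0.
have ms n : measurable_fun (unit_circle R : set (borelC R)) (s n).
  exact: measurable_funTS.
have sw n x : unit_circle R x -> s n x <= w x.
  move=> Ux; rewrite -lee_fin /s nnsfun_approxE; apply: (le_approx (f := EFin \o w)) => //.
  by move=> y _ /=; rewrite lee_fin.
pose G (x : borelC R) := (w x ^+ 2)%:E.
pose F n (x : borelC R) := ((w x - s n x) ^+ 2)%:E.
have wE x : cmod (w x)%:C%C ^+ 2 = w x ^+ 2.
  by rewrite cmod_real ger0_norm.
have iG : mu.-integrable (unit_circle R) G.
  apply/integrableP; split; first by apply/measurable_EFinP; exact: measurable_funX.
  case: Lw => _ _; apply: le_lt_trans.
  rewrite le_eqVlt; apply/orP; left; apply/eqP; apply: eq_integral => x _.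
  by rewrite gee0_abs ?lee_fin ?sqr_ge0 // wE.
have mF n : measurable_fun (unit_circle R : set (borelC R)) (F n).
  by apply/measurable_EFinP; apply: measurable_funX; exact: measurable_funB.
(* Since 0 <= s n <= w on the circle, the squares of w - s n are dominated by w^2. *)
have [//|||//||_ _] := @dominated_convergence _ _ _ mu (unit_circle R) mU F (cst 0%E) G.
- exact: measurable_cst.
- apply: (@filterE _ _ (ae_filter_ringOfSetsType mu)) => x Ux.
  have /fine_cvgP[_ /= c] : (EFin \o s^~ x) n @[n --> \oo] --> (EFin \o w) x.
    by apply: cvg_nnsfun_approx => // y _ /=; rewrite lee_fin.
  apply: cvg_EFin; first exact: nearW.
  rewrite [X in _ --> X](_ : _ = (w x - w x) ^+ 2); last by rewrite subrr expr0n.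
  rewrite expr2; under eq_fun do rewrite /F /= expr2.
  by apply: cvgM; apply: cvgB => //; exact: cvg_cst.
- apply: (@filterE _ _ (ae_filter_ringOfSetsType mu)) => x n Ux.
  rewrite /F /G gee0_abs ?lee_fin ?sqr_ge0 //.
  have := sw n _ Ux; have := s0 n x; have := w0 x => h1 h2 h3.
  by rewrite ler_pXn2r ?nnegrE ?subr_ge0 // lerBlDr lerDl.
rewrite integral0 => /fine_cvgP[_ /cvgrPdist_lt/(_ _ e0)][N _ /(_ N (leqnn N))].
rewrite /= sub0r normrN => h.
pose B (y : R) : set (borelC R) := s N @^-1` [set y].
have mB y : measurable (B y) by exact: measurable_sfunP.
(* [s N] takes finitely many values, so it is the sum over its range of each value times the
   indicator of its fibre. *)
have [k sk Vk] := span_ind_sum (finmap.enum_fset (fset_set (range (s N)))) mB.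
exists k => //; have Lk := span_L2 sk; have LVk := bounded_L2 bV Lk.
have Ld := L2_lin (-1) LVk Lw.
have e1 : veq (V k) (fun x => (s N x)%:C%C).
  apply: veq_trans Vk _; apply: veq_eq => x _; congr (_%:C)%C.
  by rewrite [RHS](fimfunE (s N)) fsbig_finite.
apply: le_lt_trans h; apply: le_trans (ler_norm _).
rewrite -lee_fin n2_integral // fineK.
  rewrite le_eqVlt; apply/orP; left; apply/eqP; apply: ae_eq_integral => //.
  - have [m1 m2 _] := Ld; apply/measurable_EFinP.
    exact: (measurable_sqr_cmod (conj m1 m2)).
  - apply: filterS e1 => x h Ux; rewrite /F /lin h //.
    by rewrite mulN1r -rmorphN -rmorphD /= cmod_real real_normK ?num_real // addrC.
apply: integrable_fin_num => //; apply: le_integrable iG => // x Ux.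
rewrite /F /G /= !ger0_norm ?sqr_ge0 // lee_fin.
have := sw N _ Ux; have := s0 N x; have := w0 x => h1 h2 h3.
by rewrite ler_pXn2r ?nnegrE ?subr_ge0 // lerBlDr lerDl.
Qed.

Let approx_real (w : borelC R -> R) :
  L2 ((fun x => (w x)%:C%C) : vec Y) -> approx (fun x => (w x)%:C%C).
Proof.
move=> Lw; have mw : measurable_fun (unit_circle R : set (borelC R)) w by case: Lw.
have part (p : borelC R -> R) : measurable_fun (unit_circle R : set (borelC R)) p ->
    (forall x, 0 <= p x) -> (forall x, p x <= `|w x|) -> approx (fun x => (p x)%:C%C).
  move=> mp p0 pw; apply: approx_nneg => //; split=> //.
  case: (Lw) => _ _; apply: le_lt_trans; apply: ge0_le_integral => //.
  - exact: measurable_unit_circle.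
  - by move=> x _; rewrite lee_fin sqr_ge0.
  - apply/measurable_EFinP; apply: measurable_sqr_cmod; split=> //.
    exact: measurable_cst.
  - apply/measurable_EFinP; apply: measurable_sqr_cmod; split=> //.
    exact: measurable_cst.
  - move=> x _; rewrite lee_fin !cmod_real ler_pXn2r ?nnegrE //.
    by rewrite ger0_norm.
have -> : (fun x => (w x)%:C%C) = @lin R Y (-1) (fun x => (Num.max (- w x) 0)%:C%C)
    (fun x => (Num.max (w x) 0)%:C%C).
  apply/funext => x; rewrite /lin mulN1r -rmorphN -rmorphD /=; congr (_%:C)%C.
  by case: (leP (w x) 0) => h; case: (leP (- w x) 0) => h' /=; lra.
apply: approx_lin; apply: part.
- by apply: measurable_maxr; [exact: measurable_funN|exact: measurable_cst].
- by move=> x; rewrite le_max lexx orbT.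
- by move=> x; rewrite ge_max normr_ge0 andbT -normrN ler_norm.
- by apply: measurable_maxr; [|exact: measurable_cst].
- by move=> x; rewrite le_max lexx orbT.
- by move=> x; rewrite ge_max normr_ge0 andbT ler_norm.
Qed.

(** [V f] is approximated by treating its real and imaginary parts separately, and the estimate
    returns to [f] because [V] is isometric. *)
Lemma simple_spectrum_of_cyclic : simple_spectrum E.
Proof.
exists g0 => // f Lf e e0; have LVf := bounded_L2 bV Lf.
have ReIm (p : R[i] -> R) : measurable_fun (unit_circle R : set (borelC R)) (p \o V f) ->
    (forall z, `|p z| <= cmod z) -> L2 ((fun x => (p (V f x))%:C%C) : vec Y).
  move=> mp pz; have [m1 m2 i] := LVf; split=> //.
  apply: le_lt_trans i; apply: ge0_le_integral => //.
  - exact: measurable_unit_circle.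
  - by move=> x _; rewrite lee_fin sqr_ge0.
  - apply/measurable_EFinP; apply: measurable_sqr_cmod; split=> //.
    exact: measurable_cst.
  - by apply/measurable_EFinP; apply: measurable_sqr_cmod.
  - by move=> x _; rewrite lee_fin cmod_real ler_pXn2r ?nnegrE ?cmod_ge0.
have [m1 m2 _] := LVf.
have aR := approx_real (ReIm Re m1 (@ler_Re_cmod R)).
have aI := approx_real (ReIm Im m2 (@ler_Im_cmod R)).
have [_] := approx_lin 'i%C aI aR.
rewrite (_ : lin _ _ _ = V f); last first.
  apply/funext => x; rewrite /lin; apply: complexP; rewrite !complexReIm /=; ring.
move=> /(_ (e ^+ 2)); rewrite exprn_gt0 // => /(_ isT)[h sh hn].
have Lh := span_L2 sh; have Ld := L2_lin (-1) Lh Lf.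
have [n [c [B [mB hE]]]] := sh; exists n, c, B; split => //.
rewrite -(ltr_pXn2r (n := 2)) ?nnegrE ?l2norm_ge0 ?(ltW e0) // l2norm_sqr.
rewrite (_ : (fun x => _) = lin (-1) h f); last first.
  by apply/funext => x; rewrite hE /lin mulN1r addrC.
apply: le_lt_trans hn; rewrite le_eqVlt; apply/orP; left; apply/eqP.
have LVh := bounded_L2 bV Lh.
rewrite -(n2_veq (bounded_L2 bV Ld) (L2_lin (-1) LVh LVf) (bounded_lin (-1) bV Lh Lf)).
by rewrite /n2 (unitary_pair_inner VT).
Qed.

End simple_approximation.

(** * Essential range and support of the spectral measure of the unit vector *)

Section delta_measure_facts.
Context (R : realType) (s : side) (k0 : int) (E : pvm (ell2 R s k0)).
Local Notation mu := (delta_measure E).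

Lemma spectrum_multiplication phi :
  cbounded_measurable (unit_circle R : set (borelC R)) phi ->
  spectrum (multiplication mu phi) = ess_ran mu phi.
Proof.
move=> hphi; apply: (@spectrum_mulop R (circle_space mu)) => //=.
by rewrite pvm_measureE ?ltry //; exact: measurable_unit_circle.
Qed.

(** [ess_ran] counts only points of the circle while [measure_supp] takes whole open sets of the
    plane; they agree because [E] of the circle is the identity. *)
Lemma ess_ran_id : ess_ran mu id = measure_supp mu.
Proof.
have mU := @measurable_unit_circle R; have Ld := L2_delta R s k0.
apply/seteqP; split=> z.
  move=> ez O oO /((openC_cmodP O).1 oO)[e e0 he]; apply: lt_le_trans (ez _ e0) _.
  apply: le_measure; rewrite ?inE.
  - apply: (@measurable_essential_set R (circle_space mu) id z e).
    by have [] := @cbounded_id R.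
  - exact: sub_sigma_algebra.
  - by move=> w [_ /he].
move=> sz e e0; pose O := [set w : R[i] | cmod (w - z) < e].
have oO : open O.
  apply/openC_cmodP => w /= wz; exists (e - cmod (w - z)); first by rewrite subr_gt0.
  move=> v vw; rewrite /O /=; have := cmodD (v - w) (w - z); rewrite addrA subrK; lra.
have mO : measurable (O : set (borelC R)) by exact: sub_sigma_algebra.
have : (0 < mu O)%E by apply: sz => //; rewrite /O /= subrr cmod0.
rewrite (_ : mu O = mu [set w | unit_circle R w /\ cmod (id w - z) < e]) //.
have -> : [set w | unit_circle R w /\ cmod (id w - z) < e] = O `&` unit_circle R.
  by apply/seteqP; split=> w [].
have mOU := measurableI _ _ mO mU; have LU := pvm_L2 E mU Ld.
transitivity (n2 (E O (@delta R s k0)))%:E; first by rewrite -pvm_measureE.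
transitivity (n2 (E (O `&` unit_circle R) (@delta R s k0)))%:E.
  congr EFin; apply: n2_veq; [exact: pvm_L2..|apply: veq_sym].
  apply: veq_trans (pvm_setI E mO mU Ld) _.
  exact: (bounded_veq (pvm_bounded E mO) LU Ld (pvm_circle E Ld)).
by rewrite -(pvm_measureE E Ld).
Qed.

End delta_measure_facts.

Theorem corollary2p10 (R : realType) (a : int -> R[i])
    (ha : forall k, `|a k| < 1) (s : side) (k0 : int)
    (phi : R[i] -> R[i]) (hphi : {within unit_circle R, continuous phi})
    (E Et : pvm (ell2 R s k0))
    (hE : is_spectral_measure_of E (half_U R s k0 a))
    (hEt : is_spectral_measure_of Et (half_Ut R s k0 a)) :
  let mu := delta_measure E in
  [/\ unitarily_equivalent (functional_calculus E phi) (multiplication mu phi),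
      unitarily_equivalent (functional_calculus Et phi) (multiplication mu phi),
      spectrum (functional_calculus E phi) = ess_ran mu phi,
      spectrum (functional_calculus Et phi) = ess_ran mu phi &
      [/\ spectrum (half_U R s k0 a) = measure_supp mu,
          spectrum (half_Ut R s k0 a) = measure_supp mu &
          simple_spectrum E]].
Proof.
move=> mu; pose X := ell2 R s k0; have hphi' := continuous_cbounded_measurable hphi.
have Ld := L2_delta R s k0.
have [V [T [VT VE Vd]]] := @spectral_representation R X E (@delta R s k0) Ld
  (delta_cyclic ha hE) (@ell2_has_adjoint R s k0 (circle_space mu)).
have UU := half_U_unitary s k0 ha; have WW := half_Ut_unitary s k0 ha.
have c1 := cmod_decouple s k0 ha; have dc := @decoupled_decouple R s k0 a.
pose S : vec X -> vec X := cmv_factor true (decouple s k0 a).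
pose S' : vec X -> vec X := cmv_factor true (cconj (decouple s k0 a)).
have SS : unitary_pair S S' := cmv_factor_unitary true c1 dc.
(* Both sides unfold to W V W f, so the intertwining relation is definitional. *)
have SU f : L2 f -> veq (S (half_U R s k0 a f)) (half_Ut R s k0 a (S f)) by move=> _; exact: veq_refl.
have VS := unitary_pair_comp (unitary_pair_sym SS) VT.
have [bS bS' SSa SK S'K] := SS; have [bV bT _ _ _] := VT.
(* [At] and S A S' have the same quadratic form, hence agree up to [veq]; after [S'] the map [V]
   turns [A] into multiplication. *)
have transport psi A At : cbounded_measurable (unit_circle R : set (borelC R)) psi ->
    is_spectral_integral E psi A -> is_spectral_integral Et psi At ->
    forall f, L2 f -> veq (V (S' (At f))) (multiplication mu psi (V (S' f))).
  move=> hpsi hA hAt f Lf; have [bA _] := hA; have [bAt AtE] := hAt.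
  have [bB BE] := spectral_integral_transport UU WW hE hEt SS SU hA.
  have LS' := bounded_L2 bS' Lf; have LA := bounded_L2 bA LS'.
  have LAt := bounded_L2 bAt Lf.
  apply: veq_trans (spectral_integral_mulop VT VE hpsi hA LS').
  apply: (bounded_veq bV (bounded_L2 bS' LAt) LA).
  apply: veq_trans (SK _ LA).
  apply: (bounded_veq bS' LAt (bounded_L2 bS LA)).
  by apply: (polarization bAt bB) => // k Lk; rewrite (AtE _ Lk) (BE _ Lk).
have hA := functional_calculusP VT VE hphi'.
(* The [get] for [Et] needs its own witness: phi(U) transported by [S]. *)
have hAt : is_spectral_integral Et phi (functional_calculus Et phi).
  rewrite /functional_calculus.
  by apply: (getPex (ex_intro _ _ (spectral_integral_transport UU WW hE hEt SS SU hA))).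
have bM psi : cbounded_measurable (unit_circle R : set (borelC R)) psi ->
    bounded_op (multiplication mu psi).
  by move=> hpsi; exact: (@bounded_mulop R (circle_space mu)).
have hid := @cbounded_id R.
split.
- exists V; first exact: unitary_pair_unitary VT.
  exact: (spectral_integral_mulop VT VE hphi' hA).
- exists (V \o S'); first exact: unitary_pair_unitary VS.
  exact: (transport _ _ _ hphi' hA hAt).
- rewrite -spectrum_multiplication //.
  apply: (spectrum_unitary VT (proj1 hA) (bM _ hphi')).
  exact: (spectral_integral_mulop VT VE hphi' hA).
- rewrite -spectrum_multiplication //.
  apply: (spectrum_unitary VS (proj1 hAt) (bM _ hphi')).
  exact: (transport _ _ _ hphi' hA hAt).
split.
(* By assumption [half_U] is itself the spectral integral of the identity function, so the case of
   the function [id] applies to it directly. *)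
- rewrite -ess_ran_id -spectrum_multiplication //.
  apply: (spectrum_unitary VT (proj1 hE) (bM _ hid)).
  exact: (spectral_integral_mulop VT VE hid hE).
- rewrite -ess_ran_id -spectrum_multiplication //.
  apply: (spectrum_unitary VS (proj1 hEt) (bM _ hid)).
  exact: (transport _ _ _ hid hE hEt).
- exact: (simple_spectrum_of_cyclic VT Vd).
Qed.
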